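(* Let $(S_v)_{v\in\mathbb T}$ be an irreducible $d$-type branching random walk as described in the context, with mean matrix $M$ satisfying: there is $l\ge 1$ with $M^l(i,j)>0$ for all $i,j\in\mathcal C$; the Perron–Frobenius eigenvalue $\rho$ of $M$ satisfies $\rho>1$; $\mathbb E_i[Z_1^j\log Z_1^j]<\infty$ for all $i,j\in\mathcal C$; and $\mathbb P(Z_n\to 0)=0$. Assume that the displacements are independent, have finite moments, and that for each $j\in\mathcal C$ $$\mathbb P(\xi^j\ge t)=a_j(t)\exp\{-L_j(t)t^{r_j}\},$$ where $a_j,L_j$ are slowly varying, $L_j(t)/t^{1-r_j}$ is eventually nonincreasing, and $r_j\in(0,1)$. Let $r=\min\{r_i:i\in\mathcal C\}$, $L(t)=\min\{L_i(t): i\in\mathcal C,\ r_i=r\}$, and let $\psi$ be a positive function with $\psi(n)\to\infty$ and $$\frac{L(\psi(n))\,\psi(n)^r}{n}\xrightarrow[n\to\infty]{}1.$$ Then $$\frac{R_n}{\psi(n)}\xrightarrow[n\to\infty]{}(\log\rho)^{1/r}\qquad\text{almost surely.}$$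
   Context: Model: $\mathcal C=\{1,\dots,d\}$ is the set of types. The process starts with one particle at the origin. Each particle of type $i$ lives one unit of time and then, independently of the other particles, dies and gives birth to $N_{i,j}$ children of type $j$ for each $j\in\mathcal C$; each child of type $j$ is displaced from its parent's position by a random variable with the law of $\xi^j$ (the law depends only on the child's own type). ''The displacements are independent'' means that all displacements are mutually independent and independent of the genealogical tree. ''Finite moments'' means $\mathbb E|\xi^j|^p<\infty$ for all $p>0$. $\mathbb T$ is the genealogical tree, $|v|$ the generation of $v$, $S_v$ its position, and $R_n=\sup_{|v|=n}S_v$. $Z_n=(Z_n^1,\dots,Z_n^d)$, where $Z_n^j$ is the number of particles of type $j$ in generation $n$. The mean matrix is $M=(\mathbb E[N_{i,j}])_{i,j\in\mathcal C}$. $\mathbb P_i$, $\mathbb E_i$ denote probability and expectation when the initial particle has type $i$; without index, the initial particle has type $1$. A function $L$ is slowly varying if $L(cx)/L(x)\to1$ as $x\to\infty$ for every $c>0$. *)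

(* Defs.v *)
From mathcomp Require Import all_boot all_order all_algebra.
From mathcomp Require Import all_classical all_reals all_analysis.
From mathcomp Require Import complex.

Set Implicit Arguments.
Unset Strict Implicit.
Unset Printing Implicit Defensive.

Import Order.TTheory GRing.Theory Num.Theory.
Import numFieldNormedType.Exports.

Local Open Scope classical_set_scope.
Local Open Scope ring_scope.

(* Ulam-Harris labels, most recent ancestor first: [::] is the initial particle
   and (j, k) :: v is the k-th child of type j of v (k = 0, 1, ...). *)
Definition label (d : nat) := seq ('I_d * nat).

Definition ptype d (i : 'I_d) (v : label d) : 'I_d :=
  if v is (j, _) :: _ then j else i.

Section Tree.
Context {R : realType} {d : nat} {disp : measure_display}
  {Omega : measurableType disp}.
Variable N : label d -> 'I_d -> {mfun Omega >-> nat}.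
Variable X : label d -> {mfun Omega >-> R}.

(* Duplicate-free list of the particles v of the tree with |v| = n. *)
Fixpoint generation (n : nat) (w : Omega) : seq (label d) :=
  if n is m.+1 then
    [seq jk :: v | v <- generation m w,
       jk <- [seq (j, k) | j <- enum 'I_d, k <- iota 0 (N v j w)]]
  else [:: [::]].

Fixpoint position (v : label d) (w : Omega) : R :=
  if v is _ :: u then position u w + X v w else 0.

(* R_n; it is -oo when generation n is empty. *)
Definition max_position (n : nat) (w : Omega) : \bar R :=
  ereal_sup [set (position v w)%:E | v in [set` generation n w]].

(* Z_n^j, the initial particle having type i. *)
Definition population (i : 'I_d) (n : nat) (j : 'I_d) (w : Omega) : nat :=
  count (fun v => ptype i v == j) (generation n w).

End Tree.

Definition mutually_independent {R : realType} {disp : measure_display}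
    {Omega : measurableType disp} (P : probability Omega R)
    (I : eqType) (F : I -> set (set Omega)) : Prop :=
  forall (s : seq I) (A : I -> set Omega), uniq s ->
    (forall x, x \in s -> F x (A x)) ->
    P (\bigcap_(x in [set` s]) A x) = (\prod_(x <- s) P (A x))%E.

(* inl v: events depending on the offspring vector of v;
   inr v: events depending on the displacement of v. *)
Definition driving_events {R : realType} {d : nat} {disp : measure_display}
    {Omega : measurableType disp}
    (N : label d -> 'I_d -> {mfun Omega >-> nat})
    (X : label d -> {mfun Omega >-> R})
    (x : label d + label d) : set (set Omega) :=
  match x with
  | inl v => [set [set w | B (fun j => N v j w)] | B in [set: set ('I_d -> nat)]]
  | inr v => [set X v @^-1` B | B in [set B : set R | measurable B]]
  end.

(* P i is the probability when the initial particle has type i. The reference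
   variables N0 i j and xi j, living on the space (Omega0, Q), carry the
   reproduction laws and the displacement laws; for a fixed i the N0 i j may be
   dependent. The variable X [::] is never used by [position]. *)
Record branching_random_walk {R : realType} {d : nat}
    {disp disp0 : measure_display}
    {Omega : measurableType disp} {Omega0 : measurableType disp0}
    (P : 'I_d -> probability Omega R) (Q : probability Omega0 R)
    (N0 : 'I_d -> 'I_d -> {mfun Omega0 >-> nat})
    (xi : 'I_d -> {mfun Omega0 >-> R})
    (N : label d -> 'I_d -> {mfun Omega >-> nat})
    (X : label d -> {mfun Omega >-> R}) : Prop := BranchingRandomWalk {
  brw_offspring : forall (i : 'I_d) (v : label d) (k : 'I_d -> nat),
    P i [set w | forall j, N v j w = k j] =
    Q [set u | forall j, N0 (ptype i v) j u = k j] ;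
  brw_displacement : forall (i : 'I_d) (v : label d) (j : 'I_d) (k : nat)
      (B : set R), measurable B ->
    P i (X ((j, k) :: v) @^-1` B) = Q (xi j @^-1` B) ;
  brw_independent : forall i : 'I_d,
    mutually_independent (P i) (driving_events N X)
}.

Definition mean_matrix {R : realType} {d : nat} {disp0 : measure_display}
    {Omega0 : measurableType disp0} (Q : probability Omega0 R)
    (N0 : 'I_d -> 'I_d -> {mfun Omega0 >-> nat}) : 'M[R]_d :=
  \matrix_(i, j) fine ('E_Q[fun u => (N0 i j u)%:R])%E.

(* rho is a real eigenvalue dominating the modulus of every complex one. *)
Definition perron_frobenius_eigenvalue {R : realType} {d : nat}
    (M : 'M[R]_d) (rho : R) : Prop :=
  eigenvalue M rho /\
  forall z : R[i], eigenvalue (map_mx (real_complex R) M) z ->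
    `|z| <= real_complex R rho.

Definition slowly_varying {R : realType} (L : R -> R) : Prop :=
  forall c : R, 0 < c -> L (c * x) / L x @[x --> +oo] --> (1 : R).

Definition eventually_nonincreasing {R : realType} (f : R -> R) : Prop :=
  exists x0 : R, forall x y : R, x0 <= x -> x <= y -> f y <= f x.

Definition min_exponent {R : realType} {d : nat} (r : 'I_d.+1 -> R) : R :=
  \big[Num.min/r ord0]_i r i.

(* The default value of the iterated minimum is one of its own terms. *)
Definition min_slow {R : realType} {d : nat} (r : 'I_d.+1 -> R)
    (L : 'I_d.+1 -> R -> R) (t : R) : R :=
  \big[Num.min/L [arg min_(i < ord0) r i]%O t]_(i | r i == min_exponent r) L i t.

(* Main.v *)
(* Generation n has about rho^n particles, and log P(xi >= t) is of order -g(t),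
   where g(t) = L(t) t^r and g(y psi(n)) ~ y^r n; the maximum is produced by a
   single large jump, so the critical height y psi(n) is the one where
   rho^n exp(- y^r n) = 1.

   Upper bound. For one particle, either an ancestor makes a jump of size at least
   z = y psi(n), or all jumps are smaller and Chernoff's inequality with slope
   s = (1 - 2e) g(z) / z applies: since g(t) / t is nonincreasing, the truncated
   exponential moment tends to 1. Multiply by E|T_n| <= C (rho + e)^n.

   Lower bound. Let j attain the minimum defining L at z. Given the generation, its
   type j particles jump independently, and the first one that jumps beyond z has
   no bad ancestor (a jump below - c psi(n) / n) except with polynomially small
   probability, because psi(n) grows faster than a power n^q with q > 1 and all
   moments are finite. That the number of type j particles exceeds mu^n (mu < rho)
   outside an event of exponentially small probability is read off the Laplace
   transforms Lambda_n(c) = E exp(- sum c_i Z_n^i): the branching property gives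
   Lambda_{n+1}(theta c) <= Lambda_n(theta (1 - eta) M c) for small theta, and
   survival gives Lambda_n(theta u) <= kappa^n for a positive u with M u >= rho u. *)

Require Import Defs.
From mathcomp Require Import all_boot all_order all_algebra.
From mathcomp Require Import all_classical all_reals all_analysis.
From mathcomp Require Import measurable_realfun.
From mathcomp Require Import complex.
From mathcomp Require Import ring lra.
Import Order.TTheory GRing.Theory Num.Theory.
Import numFieldNormedType.Exports.
Local Open Scope classical_set_scope.
Local Open Scope ring_scope.

Set Implicit Arguments.
Unset Strict Implicit.
Unset Printing Implicit Defensive.

(** * Independence and the genealogy *)

(** Independence is given only as a product formula for events, so no conditional expectation is
    formed. Labels are countable, and conditioning on generation n means summing over the countably
    many lists that it can equal: [integral_generation] gives the product formula on each event
    [generation N n = g]; estimates are made there and then summed.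

    Slow variation is a pointwise limit and [a], [L] carry no measurability assumption, so
    uniformity in the dilation factor cannot be extracted from it. Limits are read only along
    geometric grids c^k t0; between grid points two monotone quantities carry the bounds, the tail
    of xi^j and f(t)/t. The factor [a] is absorbed because ln a has bounded increments along a grid
    on which the exponent grows geometrically.

    The type attaining the minimal exponent may change with the height, so the lower bound needs the
    counts of all types at once, and a type fixed for each n before any random event. The x log x
    condition enters as finiteness of the mean matrix, on which the first-order expansion of the
    Laplace transforms rests. *)

Section integral_of_products.
Context d (T : measurableType d) (R : realType).
Variable P : {measure set T -> \bar R}.
Variables (H G : T -> R) (c : R).
Hypotheses (mH : measurable_fun setT H) (mG : measurable_fun setT G).
Hypotheses (H0 : forall x, 0 <= H x) (G0 : forall x, 0 <= G x).
Hypothesis c0 : 0 <= c.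
Hypothesis HG : forall A : set R, measurable A ->
  (\int[P]_(w in G @^-1` A) (H w)%:E = c%:E * P (G @^-1` A))%E.

Import HBNNSimple.

Let integralM_nnsfun (h : {nnsfun R >-> R}) :
  (\int[P]_w (H w * h (G w))%:E = c%:E * \int[P]_w (h (G w))%:E)%E.
Proof.
have mh r : measurable (h @^-1` [set r]).
  by rewrite -[X in measurable X]setTI; apply: measurable_funP.
have mGh r : measurable (G @^-1` (h @^-1` [set r])).
  by rewrite -[X in measurable X]setTI; exact: mG.
have hE w : h (G w) = \sum_(r \in range h) r * \1_(h @^-1` [set r]) (G w).
  by rewrite fimfunE.
have mi r : measurable_fun setT (fun w => \1_(h @^-1` [set r]) (G w) : R).
  by apply: measurableT_comp => //; exact: measurable_indic.
have r0 r w : 0 <= r * \1_(h @^-1` [set r]) (G w).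
  by rewrite -lee_fin EFinM nnfun_muleindic_ge0.
have key r : (\int[P]_w (r * \1_(h @^-1` [set r]) (G w))%:E
   = r%:E * P (G @^-1` (h @^-1` [set r])))%E.
  case: (ltP r 0) => [r_lt0|r_ge0].
    rewrite preimage_nnfun0// preimage_set0 measure0 mule0.
    by rewrite integral0_eq// => w _; rewrite indicE in_set0 mulr0.
  under eq_integral do rewrite EFinM.
  rewrite ge0_integralZl//.
  - by rewrite -[RHS]/(_ * P _)%E -(setIT (G @^-1` _)) -integral_indic.
  - by apply/measurable_EFinP.
have keyH r : (\int[P]_w (H w * (r * \1_(h @^-1` [set r]) (G w)))%:E
   = r%:E * (c%:E * P (G @^-1` (h @^-1` [set r]))))%E.
  case: (ltP r 0) => [r_lt0|r_ge0].
    rewrite preimage_nnfun0// preimage_set0 measure0 !mule0.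
    by rewrite integral0_eq// => w _; rewrite indicE in_set0 !mulr0.
  under eq_integral do rewrite mulrCA EFinM.
  rewrite ge0_integralZl//; last 2 first.
  - by apply/measurable_EFinP; exact: measurable_funM.
  - by move=> w _; rewrite lee_fin mulr_ge0// indicE.
  congr (_ * _)%E; rewrite -HG// [in RHS]integral_mkcond; apply: eq_integral => w _.
  rewrite patchE indicE.
  have -> : (w \in G @^-1` (h @^-1` [set r])) = (G w \in h @^-1` [set r]).
    by apply/idP/idP; rewrite !inE.
  by case: ifPn; rewrite ?mulr1 ?mulr0.
have hHE w : (H w * h (G w))%:E =
    (\sum_(r \in range h) (H w * (r * \1_(h @^-1` [set r]) (G w)))%:E)%E.
  rewrite hE EFinM -fsumEFin// ge0_mule_fsumr//.
  by move=> r; rewrite lee_fin.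
have hE' w : (h (G w))%:E =
    (\sum_(r \in range h) (r * \1_(h @^-1` [set r]) (G w))%:E)%E.
  by rewrite hE -fsumEFin.
under eq_integral do rewrite hHE.
under [in RHS]eq_integral do rewrite hE'.
rewrite !ge0_integral_fsum//.
- rewrite ge0_mule_fsumr.
    by apply: eq_fsbigr => r _; rewrite key muleCA -keyH.
  by move=> r; apply: integral_ge0 => w _; rewrite lee_fin.
- by move=> r; apply/measurable_EFinP; exact: measurable_funM.
- by move=> r w _; rewrite lee_fin.
- move=> r; apply/measurable_EFinP.
  by apply: measurable_funM => //; exact: measurable_funM.
- by move=> r w _; rewrite lee_fin mulr_ge0.
Qed.

(** [HG] says that the conditional mean of [H] given [G] is the constant [c]. The identity passes
    from preimages to simple functions of [G], then to [G] by monotone convergence. *)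
Lemma integralM_preimage :
  (\int[P]_w (H w * G w)%:E = c%:E * \int[P]_w (G w)%:E)%E.
Proof.
(* The absolute value is nonnegative on all of R, as the approximation by simple functions requires,
   and it is the identity on the values of [G]. *)
pose f (x : R) : \bar R := `|x|%:E.
have mf : measurable_fun setT f by apply/measurable_EFinP; exact: normr_measurable.
pose f_ := nnsfun_approx measurableT mf.
have fcvg x : (f_ n x)%:E @[n --> \oo] --> f x.
  by apply: cvg_nnsfun_approx => // ? _; rewrite lee_fin.
have fG w : f (G w) = (G w)%:E by rewrite /f ger0_norm.
have mfn n : measurable_fun setT (fun w => f_ n (G w)).
  by apply: measurableT_comp => //; exact: measurable_funP.
have c1 : (\int[P]_w (H w * f_ n (G w))%:E)%E @[n --> \oo] -->
    (\int[P]_w (H w * G w)%:E)%E.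
  have -> : (\int[P]_w (H w * G w)%:E)%E =
     (\int[P]_w limn (fun n => (H w * f_ n (G w))%:E))%E.
    apply: eq_integral => w _; apply/esym/cvg_lim => //.
    rewrite EFinM -fG; under eq_fun do rewrite EFinM.
    by apply: cvgeZl.
  apply: (@cvg_monotone_convergence _ _ _ P setT measurableT
     (fun n w => (H w * f_ n (G w))%:E)).
  - by move=> n; apply/measurable_EFinP; exact: measurable_funM.
  - by move=> n w _; rewrite lee_fin mulr_ge0.
  - move=> w _ m n mn; rewrite lee_fin ler_wpM2l//.
    exact/lefP/nd_nnsfun_approx.
have c2 : (\int[P]_w (f_ n (G w))%:E)%E @[n --> \oo] --> (\int[P]_w (G w)%:E)%E.
  have -> : (\int[P]_w (G w)%:E)%E =
     (\int[P]_w limn (fun n => (f_ n (G w))%:E))%E.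
    apply: eq_integral => w _; apply/esym/cvg_lim => //.
    by rewrite -fG.
  apply: (@cvg_monotone_convergence _ _ _ P setT measurableT
     (fun n w => (f_ n (G w))%:E)).
  - by move=> n; apply/measurable_EFinP.
  - by move=> n w _; rewrite lee_fin.
  - by move=> w _ m n mn; rewrite lee_fin; exact/lefP/nd_nnsfun_approx.
have c3 : (c%:E * \int[P]_w (f_ n (G w))%:E)%E @[n --> \oo] -->
    (c%:E * \int[P]_w (G w)%:E)%E by exact: cvgeZl.
move: c1; under eq_fun do rewrite integralM_nnsfun.
by move/cvg_lim => <-//; apply/cvg_lim.
Qed.

End integral_of_products.

(** * Random variables with countably many values *)

Lemma bigcup_countable_measurable d (T : measurableType d) (C : countType)
    (D : set C) (F : C -> set T) :
  (forall c, D c -> measurable (F c)) -> measurable (\bigcup_(c in D) F c).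
Proof.
move=> mF; have -> : \bigcup_(c in D) F c = \bigcup_k
    (if unpickle k is Some c then if c \in D then F c else set0 else set0).
  apply/seteqP; split => [w [c Dc Fc]|w [k _]].
    by exists (pickle c) => //; rewrite pickleK mem_set.
  case: (unpickle k) => [c|//]; case: ifPn => // /set_mem Dc Fc.
  by exists c.
apply: bigcup_measurable => k _; case: (unpickle k) => [c|//].
by case: ifPn => // /set_mem Dc; exact: mF.
Qed.

Section countable_fibres.
Context d (T : measurableType d) (R : realType) (C : countType) (f : T -> C).
Hypothesis mf : forall c, measurable (f @^-1` [set c]).

Lemma measurable_countable_preimage (D : set C) : measurable (f @^-1` D).
Proof.
have -> : f @^-1` D = \bigcup_(c in D) (f @^-1` [set c]).
  apply/seteqP; split => [w Dw|w [c Dc /= fc]]; first by exists (f w).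
  by rewrite /preimage/= fc.
exact: bigcup_countable_measurable.
Qed.

Lemma integral_fibres (P : {measure set T -> \bar R}) (B : set T)
    (g : T -> \bar R) :
  measurable B -> measurable_fun B g -> (forall w, B w -> (0 <= g w)%E) ->
  (\int[P]_(w in B) g w =
   \sum_(k <oo) \int[P]_(w in B `&` (f @^-1` [set c | pickle c = k])) g w)%E.
Proof.
move=> mB mg g0.
pose F k := B `&` (f @^-1` [set c | pickle c = k]).
have BE : B = \bigcup_k F k.
  by apply/seteqP; split => [w Bw|w [k _ []//]]; exists (pickle (f w)).
rewrite [in LHS]BE ge0_integral_bigcup//.
- by move=> k; apply: measurableI => //; exact: measurable_countable_preimage.
- by rewrite -BE.
- by move=> w; rewrite -BE; exact: g0.
- by apply/trivIsetP => i j _ _ /eqP ij; apply/seteqP; split => // w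
    [[_ /= wi] [_ /= wj]]; apply: ij; rewrite -wi -wj.
Qed.

(** Sums over a countable type are written as series over [pickle] codes; a code of no element
    contributes an empty fibre. *)
Lemma fibre_code (k : nat) :
  (exists c, [set c : C | pickle c = k] = [set c]) \/
  [set c : C | pickle c = k] = set0.
Proof.
have [[c ck]|nk] := pselect (exists c : C, pickle c = k).
  left; exists c; apply/seteqP; split => [c' /= ck'|c' /= ->//].
  by apply: (pcan_inj pickleK); rewrite ck ck'.
by right; apply/seteqP; split => // c /= ck; apply: nk; exists c.
Qed.

(** This plays the part of monotonicity of conditional expectations given [f]: comparing the
    integrals on each atom is enough. *)
Lemma le_integral_fibres (P : {measure set T -> \bar R}) (B B' : set T)
    (g h : T -> \bar R) :
  measurable B -> measurable_fun B g -> (forall w, B w -> (0 <= g w)%E) ->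
  measurable B' -> measurable_fun B' h -> (forall w, B' w -> (0 <= h w)%E) ->
  (forall c, (\int[P]_(w in B `&` (f @^-1` [set c])) g w <=
              \int[P]_(w in B' `&` (f @^-1` [set c])) h w)%E) ->
  (\int[P]_(w in B) g w <= \int[P]_(w in B') h w)%E.
Proof.
move=> mB mg g0 mB' mh h0 gh.
rewrite integral_fibres// [leRHS]integral_fibres//.
apply: lee_nneseries => [k _ _|k _].
  by apply: integral_ge0 => w [/g0].
have [[c ->]|->] := fibre_code k; first exact: gh.
by rewrite preimage_set0 !setI0 !integral_set0.
Qed.

End countable_fibres.

(** * Expectations of products of independent nonnegative variables *)

Section independent_products.
Context d (T : measurableType d) (R : realType) (P : probability T R).
Variables (I : eqType) (F : I -> set (set T)).
Hypothesis indepF : mutually_independent P F.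
Hypothesis mF : forall x A, F x A -> measurable A.

(** A nonnegative variable that depends on the source [x] only. As [F x] is an arbitrary family of
    events, measurability with respect to it is stated through preimages. *)
Definition driven (x : I) (G : T -> R) : Prop :=
  (forall w, 0 <= G w) /\
  forall A : set R, measurable A -> F x (G @^-1` A).

Lemma measurable_driven x G : driven x G -> measurable_fun setT G.
Proof. by move=> [_ FG] _ A mA; rewrite setTI; exact/mF/FG. Qed.

Lemma integral_driven_ge0 x G : driven x G -> (0 <= \int[P]_w (G w)%:E)%E.
Proof. by move=> [G0 _]; apply: integral_ge0 => w _; rewrite lee_fin. Qed.

Lemma measurable_prod_driven (s : seq I) (G : I -> T -> R) :
  (forall x, x \in s -> driven x (G x)) ->
  measurable_fun setT (fun w => \prod_(x <- s) G x w).
Proof.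
elim: s => [|x s IH] dG; first by under eq_fun do rewrite big_nil; exact: measurable_cst.
under eq_fun do rewrite big_cons; apply: measurable_funM.
  by apply: measurable_driven (dG x _); rewrite inE eqxx.
by apply: IH => y ys; apply: dG; rewrite inE ys orbT.
Qed.

(** Sources are moved one at a time from the side of events ([s2]) to the side of functions ([s1]).
    To integrate [G x] against the remaining product, [integralM_preimage] asks only for integrals
    over preimages under [G x], and these are the induction hypothesis with [x] placed among the
    events. *)
Let integral_prod_driven_on (s1 s2 : seq I) (G : I -> T -> R) (A : I -> set T) :
  uniq (s1 ++ s2) ->
  (forall x, x \in s1 -> driven x (G x)) ->
  (forall x, x \in s1 -> (\int[P]_w (G x w)%:E < +oo)%E) ->
  (forall x, x \in s2 -> F x (A x)) ->
  (\int[P]_(w in \bigcap_(x in [set` s2]) A x) (\prod_(x <- s1) G x w)%:E =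
   (\prod_(x <- s1) \int[P]_w (G x w)%:E) * \prod_(x <- s2) P (A x))%E.
Proof.
elim: s1 s2 A => [|x s1 IH] s2 A us dG fG FA.
  rewrite big_nil mul1e -indepF//.
  under eq_integral do rewrite big_nil.
  rewrite integral_cst ?mul1e//.
  by apply: fin_bigcap_measurable => // x xs; exact/mF/FA.
move: us; rewrite cat_cons => /= /andP[]; rewrite mem_cat negb_or => /andP[xs1 xs2].
move=> us.
pose D := \bigcap_(y in [set` s2]) A y.
have mD : measurable D.
  by apply: fin_bigcap_measurable => // y ys; exact/mF/FA.
have dGs y : y \in s1 -> driven y (G y).
  by move=> ys; apply: dG; rewrite inE ys orbT.
have fGs y : y \in s1 -> (\int[P]_w (G y w)%:E < +oo)%E.
  by move=> ys; apply: fG; rewrite inE ys orbT.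
have dx : driven x (G x) by apply: dG; rewrite inE eqxx.
pose H w := (\prod_(y <- s1) G y w) * \1_D w.
pose c := fine ((\prod_(y <- s1) \int[P]_w (G y w)%:E) * \prod_(y <- s2) P (A y))%E.
have cE : c%:E =
    ((\prod_(y <- s1) \int[P]_w (G y w)%:E) * \prod_(y <- s2) P (A y))%E.
  rewrite fineK// fin_numM//.
    rewrite big_seq; apply: prode_fin_num => y ys.
    by rewrite ge0_fin_numE ?fGs//; apply: integral_driven_ge0 (dGs _ ys).
  rewrite big_seq; apply: prode_fin_num => y ys.
  by apply: fin_num_measure; exact/mF/FA.
have c0 : 0 <= c.
  rewrite fine_ge0// mule_ge0//.
    rewrite big_seq; apply: prode_ge0 => y ys.
    exact: integral_driven_ge0 (dGs _ ys).
  by apply: prode_ge0 => y _.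
have P0 w : 0 <= \prod_(y <- s1) G y w.
  by rewrite big_seq; apply: prodr_ge0 => y ys; case: (dGs _ ys).
have HE (B : set T) : measurable B -> (\int[P]_(w in B) (H w)%:E =
    \int[P]_(w in B `&` D) (\prod_(y <- s1) G y w)%:E)%E.
  move=> mB; rewrite [RHS]integral_mkcondr; apply: eq_integral => w _.
  by rewrite patchE /H indicE; case: ifPn; rewrite ?mulr1 ?mulr0.
have HGA (B : set R) : measurable B ->
    (\int[P]_(w in G x @^-1` B) (H w)%:E = c%:E * P (G x @^-1` B))%E.
  move=> mB; rewrite HE; last by apply/mF/(dx.2).
  pose A' y := if y == x then G x @^-1` B else A y.
  have -> : G x @^-1` B `&` D = \bigcap_(y in [set` x :: s2]) A' y.
    have AA' y : y \in s2 -> A' y = A y.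
      by move=> ys; rewrite /A'; case: eqP => // yx; rewrite -yx ys in xs2.
    apply/seteqP; split => [w [Gw Dw] y /=|w A'w].
      rewrite inE => /predU1P[->|ys]; first by rewrite /A' eqxx.
      by rewrite AA'//; exact: Dw.
    split; first by have := A' x; have := A'w x (mem_head _ _); rewrite /A' eqxx.
    by move=> y /= ys; rewrite -AA'//; apply: A'w; rewrite /= inE ys orbT.
  rewrite IH//; last first.
  - move=> y; rewrite inE /A'; case: eqP => [->_|_]; first exact: dx.2.
    exact: FA.
  - by rewrite -cat1s uniq_catCA/= mem_cat negb_or xs1 xs2.
  have AA' : (\prod_(y <- s2) P (A' y) = \prod_(y <- s2) P (A y))%E.
    apply: eq_big_seq => y ys; rewrite /A'.
    by case: eqP => // yx; rewrite -yx ys in xs2.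
  rewrite big_cons AA' {1}/A' eqxx cE -muleA; congr (_ * _)%E; exact: muleC.
transitivity (\int[P]_w (H w * G x w)%:E)%E.
  rewrite -[in LHS](setTI (\bigcap_(_ in _) _)) integral_mkcondr.
  apply: eq_integral => w _; rewrite patchE /H indicE -/D big_cons mulrC.
  by case: ifPn; rewrite ?mulr1 ?mulr0 ?mul0r.
rewrite (@integralM_preimage _ _ _ P H (G x) c)//.
- by rewrite cE big_cons muleC muleA.
- apply: measurable_funM; last exact: measurable_indic.
  exact: measurable_prod_driven.
- exact: measurable_driven dx.
- by move=> w; rewrite mulr_ge0.
- exact: dx.1.
Qed.

Lemma integral_prod_driven (s : seq I) (G : I -> T -> R) :
  uniq s ->
  (forall x, x \in s -> driven x (G x)) ->
  (forall x, x \in s -> (\int[P]_w (G x w)%:E < +oo)%E) ->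
  (\int[P]_w (\prod_(x <- s) G x w)%:E =
   \prod_(x <- s) \int[P]_w (G x w)%:E)%E.
Proof.
move=> us dG fG; have := @integral_prod_driven_on s [::] G (fun=> setT).
rewrite cats0 big_nil mule1 set_nil bigcap_set0; exact.
Qed.

End independent_products.

(** * Generations as functions of the offspring vectors *)

Section genealogy.
Context {R : realType} {d : nat} {disp : measure_display}
  {Omega : measurableType disp}.
Variable N : label d -> 'I_d -> {mfun Omega >-> nat}.
Variable X : label d -> {mfun Omega >-> R}.

Definition offspring (k : 'I_d -> nat) : seq ('I_d * nat) :=
  [seq (j, i) | j <- enum 'I_d, i <- iota 0 (k j)].

Definition next_generation (g : seq (label d)) (k : label d -> 'I_d -> nat) :
    seq (label d) :=
  [seq jk :: v | v <- g, jk <- offspring (k v)].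

Definition child_of (v : label d) (j : 'I_d) : pred (label d) :=
  fun u => if u is (j', _) :: v' then (j' == j) && (v' == v) else false.

(** A generation determines the offspring numbers in the preceding one; this count reads them off
    the list of labels. *)
Definition children_in (g' : seq (label d)) (v : label d) (j : 'I_d) : nat :=
  count (child_of v j) g'.

Lemma generationS m w :
  generation N m.+1 w = next_generation (generation N m w) (fun v j => N v j w).
Proof. by []. Qed.

Lemma count_offspring (k : 'I_d -> nat) j :
  count (fun jk => jk.1 == j) (offspring k) = k j.
Proof.
rewrite /offspring count_flatten sumnE !big_map.
rewrite (bigD1 j)//= big1 ?addn0 => [|i ij]; rewrite count_map.
  rewrite (@eq_count _ _ predT) ?count_predT ?size_iota// => i /=.
  by rewrite eqxx.
rewrite (@eq_count _ _ pred0) ?count_pred0// => l /=.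
exact: negbTE.
Qed.

Lemma offspring_uniq (k : 'I_d -> nat) : uniq (offspring k).
Proof.
apply: allpairs_uniq_dep => [|i _|[i1 j1] [i2 j2] _ _ /= [-> ->]//].
  exact: enum_uniq.
exact: iota_uniq.
Qed.

Lemma next_generation_uniq g k : uniq g -> uniq (next_generation g k).
Proof.
move=> ug; apply: allpairs_uniq_dep => // [v _|].
  exact: offspring_uniq.
by move=> [v1 jk1] [v2 jk2] _ _ /= [-> ->].
Qed.

Lemma count_next_generation (a : pred (label d)) g k :
  count a (next_generation g k) =
  (\sum_(v <- g) count (fun jk => a (jk :: v)) (offspring (k v)))%N.
Proof.
rewrite /next_generation count_flatten sumnE !big_map.
by apply: eq_bigr => v _; rewrite count_map.
Qed.

Lemma children_in_next_generation g k v j :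
  uniq g -> v \in g -> children_in (next_generation g k) v j = k v j.
Proof.
move=> ug vg; rewrite /children_in count_next_generation (bigD1_seq v)//=.
rewrite big1 ?addn0 => [|u /negbTE uv].
  rewrite -[RHS]count_offspring; apply: eq_count => -[j' i] /=.
  by rewrite eqxx andbT.
rewrite (@eq_count _ _ pred0) ?count_pred0// => -[j' i] /=.
by rewrite uv andbF.
Qed.

Lemma eq_next_generation g k k' :
  (forall v, v \in g -> k v =1 k' v) ->
  next_generation g k = next_generation g k'.
Proof.
move=> kk; rewrite /next_generation; congr flatten.
apply/eq_in_map => v vg; congr map; rewrite /offspring; congr flatten.
by apply: eq_map => j; rewrite kk.
Qed.

Lemma generation_uniq n w : uniq (generation N n w).
Proof.
by elim: n => // n IH; rewrite generationS next_generation_uniq.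
Qed.

Lemma size_generation n w v : v \in generation N n w -> size v = n.
Proof.
elim: n v => [|n IH] v; first by rewrite inE => /eqP ->.
by rewrite generationS => /allpairsPdep[u [jk [/IH <- _ ->]]].
Qed.

(** This splits the passage from [g] to [g'] into a consistency condition that involves no
    randomness and a condition on the offspring vector of each particle of [g] separately. The
    second is an intersection of independent events. *)
Lemma next_generationE g k g' : uniq g ->
  next_generation g k = g' <->
  next_generation g (children_in g') = g' /\
  forall v, v \in g -> k v =1 children_in g' v.
Proof.
move=> ug; split => [<-|[<- kg]].
  have kk v : v \in g -> k v =1 children_in (next_generation g k) v.
    by move=> vg j; rewrite children_in_next_generation.
  by split => //; apply/esym/eq_next_generation.
apply: eq_next_generation => v vg j; rewrite kg//.
by rewrite children_in_next_generation.
Qed.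

(** A finite function rather than a plain one, so that its values form a countable type. *)
Definition offspring_vector (v : label d) (w : Omega) : {ffun 'I_d -> nat} :=
  [ffun j => N v j w].

Lemma measurable_offspring_vector v (k : {ffun 'I_d -> nat}) :
  measurable (offspring_vector v @^-1` [set k]).
Proof.
have -> : offspring_vector v @^-1` [set k] =
    \bigcap_(j in [set: 'I_d]) (N v j @^-1` [set k j]).
  apply/seteqP; split => [w /= <- j _ /=|w /= Nk]; first by rewrite ffunE.
  by apply/ffunP => j; rewrite ffunE; exact: Nk.
apply: fin_bigcap_measurable => // j _.
by rewrite -[X in measurable X]setTI; exact: measurable_funP.
Qed.

Lemma measurable_driving_events x A :
  driving_events N X x A -> measurable A.
Proof.
case: x => v /= [B mB <-]; last first.
  by rewrite -[X in measurable X]setTI; exact: measurable_funP.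
have -> : [set w | B (fun j => N v j w)] =
    offspring_vector v @^-1` [set k : {ffun 'I_d -> nat} | B k].
  apply/seteqP; split => w /=; rewrite (_ : (fun j => _) = offspring_vector v w)//;
  by apply/funext => j; rewrite ffunE.
exact/measurable_countable_preimage/measurable_offspring_vector.
Qed.

Lemma driven_offspring v (phi : ('I_d -> nat) -> R) : (forall k, 0 <= phi k) ->
  driven (driving_events N X) (inl v) (fun w => phi (fun j => N v j w)).
Proof.
move=> phi0; split => [w|A mA /=]; first exact: phi0.
by exists (phi @^-1` A).
Qed.

Lemma driven_displacement v (phi : R -> R) : (forall x, 0 <= phi x) ->
  measurable_fun setT phi ->
  driven (driving_events N X) (inr v) (fun w => phi (X v w)).
Proof.
move=> phi0 mphi; split => [w|A mA /=]; first exact: phi0.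
exists (phi @^-1` A) => //=.
by rewrite -[X in measurable X]setTI; exact: mphi.
Qed.

Lemma measurable_generation n g : measurable (generation N n @^-1` [set g]).
Proof.
elim: n g => [|n IH] g.
  have [<-|ng] := pselect ([:: [::]] = g).
    rewrite (_ : _ @^-1` _ = setT) //.
    by apply/seteqP; split.
  by rewrite (_ : _ @^-1` _ = set0)//; apply/seteqP; split => w.
pose consistent g0 := next_generation g0 (children_in g) = g.
have -> : generation N n.+1 @^-1` [set g] = \bigcup_(g0 in consistent)
    (generation N n @^-1` [set g0] `&` \bigcap_(v in [set` g0])
       (offspring_vector v @^-1` [set [ffun j => children_in g v j]])).
  apply/seteqP; split => [w /= wg|w /= [g0 E [/= wg0 Nk]]].
    have [E kE] := (next_generationE _ _ (generation_uniq n w)).1 wg.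
    exists (generation N n w) => //; split => // v vg /=.
    by apply/ffunP => j; rewrite !ffunE kE.
  rewrite -/(generation N n.+1 w) generationS wg0; apply/next_generationE.
    by rewrite -wg0 generation_uniq.
  split => // v vg j; have := Nk v vg; move/ffunP => /(_ j).
  by rewrite !ffunE.
apply: bigcup_countable_measurable => g0 _; apply: measurableI => //.
by apply: fin_bigcap_measurable => // v _; exact: measurable_offspring_vector.
Qed.

End genealogy.

Lemma prod_natb (R : comPzRingType) (I : Type) (s : seq I) (b : I -> bool) :
  \prod_(x <- s) (b x)%:R = (all b s)%:R :> R.
Proof.
elim: s => [|x s IH] /=; first by rewrite big_nil.
by rewrite big_cons IH -natrM mulnb.
Qed.

(** * Conditioning on a generation *)

Section conditioning_on_a_generation.
Context {R : realType} {d : nat} {disp : measure_display}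
  {Omega : measurableType disp}.
Variable P : probability Omega R.
Variable N : label d -> 'I_d -> {mfun Omega >-> nat}.
Variable X : label d -> {mfun Omega >-> R}.
Hypothesis indep : mutually_independent P (driving_events N X).

Local Notation gen n g := (generation N n @^-1` [set g]).
Local Notation driven := (driven (driving_events N X)).

(* The sources independent of generation n: reproduction from generation n on,
   and every displacement. *)
Definition after (n : nat) (x : label d + label d) : bool :=
  if x is inl v then (n <= size v)%N else true.

(** Induction on n. On [generation N n = g0], the event [generation N n.+1 = g] is an intersection
    of events driven by the offspring of the particles of [g0]. Their labels have length n, so these
    sources are not in [s], and their indicators can be added as factors in the induction
    hypothesis. *)
Lemma integral_generation n g (s : seq (label d + label d))
    (G : label d + label d -> Omega -> R) :
  uniq s -> (forall x, x \in s -> after n x) ->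
  (forall x, x \in s -> driven x (G x)) ->
  (forall x, x \in s -> (\int[P]_w (G x w)%:E < +oo)%E) ->
  (\int[P]_(w in gen n g) (\prod_(x <- s) G x w)%:E =
   P (gen n g) * \prod_(x <- s) \int[P]_w (G x w)%:E)%E.
Proof.
have mF := @measurable_driving_events R d disp Omega N X.
elim: n g s G => [|n IH] g s G us aft dG fG.
  have [<-|ng] := pselect ([:: [::]] = g).
    have -> : gen 0%N [:: [::]] = setT by apply/seteqP; split.
    by rewrite probability_setT mul1e (integral_prod_driven indep mF us dG fG).
  have -> : gen 0%N g = set0 by apply/seteqP; split => w //.
  by rewrite integral_set0 measure0 mul0e.
have mprod : measurable_fun setT (fun w => (\prod_(x <- s) G x w)%:E).
  by apply/measurable_EFinP; exact: (measurable_prod_driven mF dG).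
have prod0 w : (0 <= (\prod_(x <- s) G x w)%:E)%E.
  by rewrite lee_fin big_seq; apply: prodr_ge0 => x xs; case: (dG x xs).
have Eprod0 : (0 <= \prod_(x <- s) \int[P]_w (G x w)%:E)%E.
  by rewrite big_seq; apply: prode_ge0 => x xs; exact: integral_driven_ge0 (dG x xs).
have step g0 : (\int[P]_(w in gen n.+1 g `&` gen n g0) (\prod_(x <- s) G x w)%:E
    = P (gen n.+1 g `&` gen n g0) * \prod_(x <- s) \int[P]_w (G x w)%:E)%E.
  have [[w0 [gw0 g0w0]]|empty] := pselect (exists w, (gen n.+1 g `&` gen n g0) w);
    last first.
    have -> : gen n.+1 g `&` gen n g0 = set0.
      by apply/seteqP; split => // w gw; apply: empty; exists w.
    by rewrite integral_set0 measure0 mul0e.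
  have {}gw0 : generation N n.+1 w0 = g by [].
  have {}g0w0 : generation N n w0 = g0 by [].
  have ug0 : uniq g0 by rewrite -g0w0 generation_uniq.
  have sg0 v : v \in g0 -> size v = n by rewrite -g0w0; exact: size_generation.
  have E : next_generation g0 (children_in g) = g.
    by move: gw0; rewrite generationS g0w0 => /(next_generationE _ _ ug0)[].
  pose b v w := [forall j, N v j w == children_in g v j].
  have gK w : generation N n w = g0 -> (generation N n.+1 w = g <-> all (b^~ w) g0).
    move=> wg0; rewrite generationS wg0; split => [/(next_generationE _ _ ug0)[_ kE]|].
      by apply/allP => v vg; apply/forallP => j; apply/eqP; exact: kE.
    move=> /allP ball; apply/(next_generationE _ _ ug0); split => // v /ball.
    by move=> /forallP vb j; exact/eqP/vb.
  (* [G'] puts the indicator [b v] on the source [inl v] for v in [g0] and agrees with [G] on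
     [s]. *)
  pose G' x w : R := if x is inl v then
    if v \in g0 then (b v w)%:R else G x w else G x w.
  have sub : {in s, forall x w, G' x w = G x w}.
    move=> [v|v] vs w //=; case: ifPn => // /sg0 vn.
    by have := aft _ vs; rewrite /= vn ltnn.
  have key (s' : seq (label d + label d)) : {subset s' <= s} -> uniq s' ->
      (\int[P]_(w in gen n.+1 g `&` gen n g0) (\prod_(x <- s') G x w)%:E =
      P (gen n g0) * (\prod_(v <- g0) \int[P]_w (b v w)%:R%:E) *
      \prod_(x <- s') \int[P]_w (G x w)%:E)%E.
    move=> ss us'.
    rewrite setIC integral_mkcondr.
    transitivity (\int[P]_(w in gen n g0)
        (\prod_(x <- map inl g0 ++ s') G' x w)%:E)%E.
      apply: eq_integral => w /set_mem /= wg0; rewrite patchE big_cat big_map/=.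
      have -> : \prod_(v <- g0) (if v \in g0 then (b v w)%:R else G (inl v) w) =
          (all (b^~ w) g0)%:R.
        by rewrite -prod_natb; apply: eq_big_seq => v ->.
      have -> : \prod_(x <- s') G' x w = \prod_(x <- s') G x w.
        by apply: eq_big_seq => x /ss xs; rewrite sub.
      have [gw|gw] := pselect (generation N n.+1 w = g).
        by rewrite mem_set// ((gK w wg0).1 gw) mul1r.
      rewrite memNset//; case: (boolP (all _ _)) => [/(gK w wg0)//|_].
      by rewrite mul0r.
    have db v : driven (inl v) (fun w => (b v w)%:R : R).
      apply: (@driven_offspring R d disp Omega N X v
        (fun k => [forall j, k j == children_in g v j]%:R)) => k.
      exact: ler0n.
    have dG' x : x \in map inl g0 ++ s' -> driven x (G' x).
      rewrite mem_cat => /orP[/mapP[v vg ->]|/ss xs] /=.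
        by rewrite /G' vg.
      by rewrite (_ : G' x = G x)//; [exact: dG|apply/funext => w; exact: sub].
    rewrite IH//; first last.
    - move=> x; rewrite mem_cat => /orP[/mapP[v vg ->]|/ss xs] /=.
        rewrite vg; apply: (@le_lt_trans _ _ (\int[P]_w (cst 1%:E) w)%E).
          apply: ge0_le_integral => //.
          + by apply/measurable_EFinP; exact: (measurable_driven mF (db v)).
          + by move=> w _; rewrite lee_fin lern1 leq_b1.
        by rewrite integral_cst// mul1e (le_lt_trans (probability_le1 _ _)) ?ltry.
      under eq_integral do rewrite sub//.
      exact: fG.
    - move=> x; rewrite mem_cat => /orP[/mapP[v vg ->]|/ss xs] /=.
        by rewrite sg0.
      by have := aft _ xs; case: x {xs} => //= v; exact: ltnW.
    - rewrite cat_uniq map_inj_uniq ?ug0 ?us' ?andbT/=; last by move=> ? ? [].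
      apply/hasPn => x /ss xs; apply/mapP => -[v vg xv].
      by have := aft _ xs; rewrite xv /= sg0// ltnn.
    rewrite big_cat/= muleA big_map; congr (_ * _ * _)%E.
      by apply: eq_big_seq => v vg /=; rewrite vg.
    by apply: eq_big_seq => x /ss xs; apply: eq_integral => w _; rewrite sub.
  rewrite key//; congr (_ * _)%E.
  (* The empty product identifies the first two factors as the probability of the joint event. *)
  have := key [::]; under eq_integral do rewrite big_nil.
  rewrite integral_cst; last by apply: measurableI; exact: measurable_generation.
  by rewrite mul1e big_nil mule1 => <-.
have mgen m := @measurable_generation d disp Omega N m.
rewrite (integral_fibres (mgen n) P (mgen n.+1 g))//; last exact: measurable_funTS.
have PE : P (gen n.+1 g) = (\sum_(k <oo) P (gen n.+1 g `&`
    (generation N n @^-1` [set c | pickle c = k])))%E.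
  have := @integral_fibres _ _ R _ _ (mgen n) P (gen n.+1 g) (cst 1%E) (mgen n.+1 g).
  rewrite integral_cst// mul1e => -> //; apply: eq_eseriesr => k _.
  rewrite integral_cst ?mul1e//; apply: measurableI => //.
  exact: measurable_countable_preimage.
have fin : (\prod_(x <- s) \int[P]_w (G x w)%:E)%E \is a fin_num.
  rewrite big_seq; apply: prode_fin_num => x xs.
  by rewrite ge0_fin_numE ?fG//; exact: integral_driven_ge0 (dG x xs).
rewrite PE muleC -(fineK fin) -nneseriesZl//; apply: eq_eseriesr => k _.
rewrite (fineK fin) muleC.
have [[c ->]|->] := @fibre_code (seq (label d)) k; first exact: step.
by rewrite preimage_set0 !setI0 integral_set0 measure0 mul0e.
Qed.

End conditioning_on_a_generation.

Lemma lee_prod (R : realDomainType) (I : eqType) (s : seq I) (f g : I -> \bar R) :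
  (forall x, x \in s -> (0 <= f x)%E) -> (forall x, x \in s -> (f x <= g x)%E) ->
  (\prod_(x <- s) f x <= \prod_(x <- s) g x)%E.
Proof.
elim: s => [|x s IH] f0 fg; first by rewrite !big_nil.
rewrite !big_cons; apply: lee_pmul.
- by rewrite f0// mem_head.
- by rewrite big_seq; apply: prode_ge0 => y ys; rewrite f0// inE ys orbT.
- by rewrite fg// mem_head.
- by apply: IH => y ys; [rewrite f0|rewrite fg]; rewrite // inE ys orbT.
Qed.

(** * Transfer to the reference variables *)

Section equality_in_law.
Context d d' (T : measurableType d) (T' : measurableType d') (R : realType).
Variables (P : probability T R) (Q : probability T' R).

Lemma measurable_fun_fibres (C : countType) (f : T -> C) (h : C -> R) :
  (forall c, measurable (f @^-1` [set c])) ->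
  measurable_fun setT (h \o f).
Proof.
move=> mf _ A _; rewrite setTI comp_preimage.
exact: measurable_countable_preimage.
Qed.

Lemma integral_eq_fibres (C : countType) (f : T -> C) (f' : T' -> C)
    (phi : C -> R) :
  (forall c, measurable (f @^-1` [set c])) ->
  (forall c, measurable (f' @^-1` [set c])) ->
  (forall c, P (f @^-1` [set c]) = Q (f' @^-1` [set c])) ->
  (forall c, 0 <= phi c) ->
  (\int[P]_w (phi (f w))%:E = \int[Q]_u (phi (f' u))%:E)%E.
Proof.
move=> mf mf' PQ phi0.
have fib d0 (T0 : measurableType d0) (P0 : probability T0 R) (f0 : T0 -> C) c :
    measurable (f0 @^-1` [set c]) ->
    (\int[P0]_(w in setT `&` f0 @^-1` [set c]) (phi (f0 w))%:E =
     (phi c)%:E * P0 (f0 @^-1` [set c]))%E.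
  move=> m0; rewrite setTI -integral_cst//; apply: eq_integral => w.
  by rewrite inE /= => ->.
rewrite (integral_fibres mf P measurableT); last 2 first.
- by apply/measurable_EFinP; exact: (measurable_fun_fibres phi mf).
- by move=> w _; rewrite lee_fin.
have mphi' : measurable_fun setT (phi \o f').
  by move=> _ A _; rewrite setTI comp_preimage; exact: measurable_countable_preimage.
rewrite (integral_fibres mf' Q measurableT); last 2 first.
- by apply/measurable_EFinP.
- by move=> w _; rewrite lee_fin.
apply: eq_eseriesr => k _.
have [[c ->]|->] := @fibre_code C k; first by rewrite !fib// PQ.
by rewrite !preimage_set0 !setI0 !integral_set0.
Qed.

Lemma integral_eq_law (f : {mfun T >-> R}) (f' : {mfun T' >-> R})
    (phi : R -> R) :
  measurable_fun setT phi ->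
  (forall A : set R, measurable A -> P (f @^-1` A) = Q (f' @^-1` A)) ->
  (forall x, 0 <= phi x) ->
  (\int[P]_w (phi (f w))%:E = \int[Q]_u (phi (f' u))%:E)%E.
Proof.
move=> mphi PQ phi0.
have mf : measurable_fun setT f by exact: measurable_funP.
have mf' : measurable_fun setT f' by exact: measurable_funP.
have := @ge0_integral_pushforward _ _ T _ R f mf P setT (EFin \o phi) measurableT.
rewrite preimage_setT => <-; last 2 first.
- by apply/measurable_EFinP.
- by move=> x _; rewrite lee_fin.
have := @ge0_integral_pushforward _ _ T' _ R f' mf' Q setT (EFin \o phi) measurableT.
rewrite preimage_setT => <-; last 2 first.
- by apply/measurable_EFinP.
- by move=> x _; rewrite lee_fin.
apply: eq_measure_integral => A mA _; exact: PQ.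
Qed.

End equality_in_law.

(** * One-step inequalities for the branching random walk *)

Section branching.
Context {R : realType} {d : nat} {disp disp0 : measure_display}
  {Omega : measurableType disp} {Omega0 : measurableType disp0}.
Variables (P : probability Omega R) (Q : probability Omega0 R).
Variables (N0 : 'I_d -> 'I_d -> {mfun Omega0 >-> nat})
  (xi : 'I_d -> {mfun Omega0 >-> R}).
Variables (N : label d -> 'I_d -> {mfun Omega >-> nat})
  (X : label d -> {mfun Omega >-> R}).
Variable root : 'I_d.
Hypothesis indep : mutually_independent P (driving_events N X).
Hypothesis law_offspring : forall v (k : 'I_d -> nat),
  P [set w | forall j, N v j w = k j] =
  Q [set u | forall j, N0 (ptype root v) j u = k j].
Hypothesis law_displacement : forall v j k (B : set R), measurable B ->
  P (X ((j, k) :: v) @^-1` B) = Q (xi j @^-1` B).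

Local Notation gen n g := (generation N n @^-1` [set g]).
Local Notation driven := (driven (driving_events N X)).

Lemma integral_offspring v (phi : ('I_d -> nat) -> R) : (forall k, 0 <= phi k) ->
  (\int[P]_w (phi (fun j => N v j w))%:E =
   \int[Q]_u (phi (fun j => N0 (ptype root v) j u))%:E)%E.
Proof.
move=> phi0.
pose f' u : {ffun 'I_d -> nat} := [ffun j => N0 (ptype root v) j u].
have fE (w : Omega) : (fun j => N v j w) = offspring_vector N v w.
  by apply/funext => j; rewrite ffunE.
have f'E (u : Omega0) : (fun j => N0 (ptype root v) j u) = f' u.
  by apply/funext => j; rewrite ffunE.
under eq_integral do rewrite fE.
under [in RHS]eq_integral do rewrite f'E.
apply: (@integral_eq_fibres _ _ _ _ _ P Q _ (offspring_vector N v) f'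
  (fun k : {ffun _} => phi k)) => [c|c|c|//].
- exact: measurable_offspring_vector.
- have -> : f' @^-1` [set c] =
      \bigcap_(j in [set: 'I_d]) (N0 (ptype root v) j @^-1` [set c j]).
    apply/seteqP; split => [w /= <- j _ /=|w /= Nk]; first by rewrite ffunE.
    by apply/ffunP => j; rewrite ffunE; exact: Nk.
  apply: fin_bigcap_measurable => // j _.
  by rewrite -[X in measurable X]setTI; exact: measurable_funP.
- transitivity (P [set w | forall j, N v j w = c j]).
    congr (P _); apply/seteqP; split => w /=.
      by move=> <- j; rewrite ffunE.
    by move=> Nc; apply/ffunP => j; rewrite ffunE.
  rewrite law_offspring; congr (Q _); apply/seteqP; split => w /=.
    by move=> Nc; apply/ffunP => j; rewrite ffunE.
  by move=> <- j; rewrite ffunE.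
Qed.

Lemma integral_displacement j k v (phi : R -> R) :
  measurable_fun setT phi -> (forall x, 0 <= phi x) ->
  (\int[P]_w (phi (X ((j, k) :: v) w))%:E = \int[Q]_u (phi (xi j u))%:E)%E.
Proof. by move=> mphi phi0; apply: integral_eq_law => // A; exact: law_displacement. Qed.

(** For generation n this is the linear functional sum_i c_i Z_n^i of the population vector. *)
Definition weight (c : 'I_d -> R) (g : seq (label d)) : R :=
  \sum_(v <- g) c (ptype root v).

Lemma weight_ge0 c g : (forall i, 0 <= c i) -> 0 <= weight c g.
Proof. by move=> c0; apply: sumr_ge0 => v _. Qed.

Lemma weight_generationS c n w :
  weight c (generation N n.+1 w) =
  \sum_(v <- generation N n w) \sum_j c j * (N v j w)%:R.
Proof.
rewrite generationS /weight /next_generation big_flatten/= big_map.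
apply: eq_bigr => v _; rewrite big_map /offspring big_flatten/= big_map big_enum/=.
apply: eq_bigr => j _; rewrite big_map/= big_const_seq count_predT size_iota.
by rewrite iter_addr_0 mulr_natr.
Qed.

Lemma measurable_fun_generation n (h : seq (label d) -> R) :
  measurable_fun setT (fun w => h (generation N n w)).
Proof. exact/measurable_fun_fibres/measurable_generation. Qed.

Lemma le_integral_generation n (f h : Omega -> R) :
  measurable_fun setT f -> measurable_fun setT h ->
  (forall w, 0 <= f w) -> (forall w, 0 <= h w) ->
  (forall g, uniq g ->
    (\int[P]_(w in gen n g) (f w)%:E <= \int[P]_(w in gen n g) (h w)%:E)%E) ->
  (\int[P]_w (f w)%:E <= \int[P]_w (h w)%:E)%E.
Proof.
move=> mf mh f0 h0 fh.
apply: (le_integral_fibres (@measurable_generation _ _ _ N n)) => //.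
- exact/measurable_EFinP.
- by move=> w _; rewrite lee_fin.
- exact/measurable_EFinP.
- by move=> w _; rewrite lee_fin.
move=> g; rewrite setTI.
have [[w <-]|ng] := pselect (exists w, generation N n w = g).
  exact/fh/generation_uniq.
have -> : gen n g = set0 by apply/seteqP; split => // w ?; apply: ng; exists w.
by rewrite !integral_set0.
Qed.

(** Lists containing a label of the wrong length are never attained. For the others the length n of
    the labels is what [after] demands of their offspring sources. *)
Lemma generation_size_or_set0 n (g : seq (label d)) :
  (forall v, v \in g -> size v = n) \/ gen n g = set0.
Proof.
have [gn|ngn] := pselect (forall v, v \in g -> size v = n); first by left.
right; apply/seteqP; split => // w gw; apply: ngn => v vg.
by apply: (@size_generation _ _ _ N n w); rewrite (_ : generation N n w = g).
Qed.

(** Branching property: given generation n, exp(- weight) of the next one is a product over the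
    particles of independent factors, each with mean at most exp(- c') at the type of its
    particle. *)
Lemma laplace_step (c c' : 'I_d -> R) n :
  (forall i, 0 <= c i) ->
  (forall i, (\int[Q]_u (expR (- \sum_j c j * (N0 i j u)%:R))%:E <=
    (expR (- c' i))%:E)%E) ->
  (\int[P]_w (expR (- weight c (generation N n.+1 w)))%:E <=
   \int[P]_w (expR (- weight c' (generation N n w)))%:E)%E.
Proof.
move=> c0 cc'.
apply: (@le_integral_generation n).
- exact: (measurable_fun_generation n.+1 (fun g => expR (- weight c g))).
- exact: (measurable_fun_generation n (fun g => expR (- weight c' g))).
- by move=> w; exact: expR_ge0.
- by move=> w; exact: expR_ge0.
move=> g ug.
pose G (x : label d + label d) w : R :=
  if x is inl v then expR (- \sum_j c j * (N v j w)%:R) else 1.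
have dG v : driven (inl v) (G (inl v)).
  apply: (@driven_offspring R d disp Omega N X v
    (fun k => expR (- \sum_j c j * (k j)%:R))) => k.
  exact: expR_ge0.
have EG v : (\int[P]_w (G (inl v) w)%:E <= (expR (- c' (ptype root v)))%:E)%E.
  by rewrite (integral_offspring v (phi := fun k => expR (- \sum_j c j * (k j)%:R))).
have [gn|->] := generation_size_or_set0 n g; last by rewrite !integral_set0.
have -> : (\int[P]_(w in gen n g) (expR (- weight c (generation N n.+1 w)))%:E =
    \int[P]_(w in gen n g) (\prod_(x <- map inl g) G x w)%:E)%E.
  apply: eq_integral => w /set_mem/= wg; rewrite weight_generationS wg.
  by rewrite big_map/= -sumrN expR_sum.
rewrite (integral_generation indep)//; first last.
- move=> _ /mapP[v vg ->]; apply: le_lt_trans (EG v) _; exact: ltry.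
- by move=> _ /mapP[v vg ->].
- by move=> _ /mapP[v vg ->] /=; rewrite gn.
- by rewrite map_inj_uniq// => ? ? [].
have -> : (\int[P]_(w in gen n g) (expR (- weight c' (generation N n w)))%:E =
    P (gen n g) * (expR (- weight c' g))%:E)%E.
  rewrite muleC -integral_cst; last exact: measurable_generation.
  by apply: eq_integral => w /set_mem/= ->.
apply: lee_wpmul2l; first exact: measure_ge0.
rewrite big_map /weight -sumrN expR_sum -prodEFin.
by apply: lee_prod => v _; [exact: integral_driven_ge0 (dG v)|exact: EG].
Qed.

(** The linear counterpart of [laplace_step]: given generation n, the next weight is a sum over the
    particles. *)
Lemma mean_step (c c' : 'I_d -> R) n :
  (forall i, 0 <= c i) ->
  (forall i, (\int[Q]_u (\sum_j c j * (N0 i j u)%:R)%:E <= (c' i)%:E)%E) ->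
  (\int[P]_w (weight c (generation N n.+1 w))%:E <=
   \int[P]_w (weight c' (generation N n w))%:E)%E.
Proof.
move=> c0 cc'.
have c'0 i : 0 <= c' i.
  rewrite -lee_fin; apply: le_trans (cc' i); apply: integral_ge0 => u _.
  by rewrite lee_fin sumr_ge0// => j _; rewrite mulr_ge0.
apply: (@le_integral_generation n).
- exact: (measurable_fun_generation n.+1 (weight c)).
- exact: (measurable_fun_generation n (weight c')).
- by move=> w; exact: weight_ge0.
- by move=> w; exact: weight_ge0.
move=> g ug.
pose phi (k : 'I_d -> nat) : R := \sum_j c j * (k j)%:R.
have phi0 k : 0 <= phi k by rewrite sumr_ge0// => j _; rewrite mulr_ge0.
pose G (x : label d + label d) w : R :=
  if x is inl v then phi (fun j => N v j w) else 1.
have dG v : driven (inl v) (G (inl v)).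
  exact: (@driven_offspring R d disp Omega N X v phi).
have EG v : (\int[P]_w (G (inl v) w)%:E <= (c' (ptype root v))%:E)%E.
  rewrite (integral_offspring v phi0); exact: cc'.
have [gn|->] := generation_size_or_set0 n g; last by rewrite !integral_set0.
have mgen := @measurable_generation _ _ _ N n g.
have -> : (\int[P]_(w in gen n g) (weight c (generation N n.+1 w))%:E =
    \sum_(v <- g) \int[P]_(w in gen n g) (\prod_(x <- [:: inl v]) G x w)%:E)%E.
  rewrite -ge0_integral_sum//.
  - apply: eq_integral => w /set_mem/= wg; rewrite weight_generationS wg sumEFin.
    by congr _%:E; apply: eq_bigr => v _; rewrite big_seq1.
  - move=> v; apply: measurable_funTS; apply/measurable_EFinP.
    under eq_fun do rewrite big_seq1.
    exact: (measurable_driven (@measurable_driving_events _ _ _ _ N X) (dG v)).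
  - by move=> v w _; rewrite big_seq1 lee_fin; case: (dG v).
have -> : (\int[P]_(w in gen n g) (weight c' (generation N n w))%:E =
    P (gen n g) * (weight c' g)%:E)%E.
  by rewrite muleC -integral_cst//; apply: eq_integral => w /set_mem/= ->.
rewrite /weight -sumEFin ge0_sume_distrr//; last by move=> v _; rewrite lee_fin.
rewrite big_seq [leRHS]big_seq; apply: lee_sum => v vg.
rewrite (integral_generation indep)//.
- by rewrite big_seq1; apply: lee_wpmul2l => //; exact: measure_ge0.
- by move=> x; rewrite inE => /eqP -> /=; rewrite gn.
- by move=> x; rewrite inE => /eqP ->.
- by move=> x; rewrite inE => /eqP ->; apply: le_lt_trans (EG v) _; exact: ltry.
Qed.

Lemma integral_gen_indic n g (A : set Omega) : measurable A ->
  (\int[P]_(w in gen n g) (\1_A w)%:E = P (gen n g `&` A))%E.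
Proof. by move=> mA; rewrite integral_indic 1?setIC//; exact: measurable_generation. Qed.

Lemma prob_generation_displacements n g (s : seq (label d)) (B : label d -> set R) :
  uniq s -> (forall u, measurable (B u)) ->
  (P (gen n g `&` \bigcap_(u in [set` s]) (X u @^-1` B u)) =
   P (gen n g) * \prod_(u <- s) P (X u @^-1` B u))%E.
Proof.
move=> us mB.
pose G (x : label d + label d) w : R := if x is inr u then \1_(B u) (X u w) else 1.
have mXB u : measurable (X u @^-1` B u).
  by rewrite -[Y in measurable Y]setTI; exact: measurable_funP.
have EG u : (\int[P]_w (G (inr u) w)%:E = P (X u @^-1` B u))%E.
  transitivity (P (X u @^-1` B u `&` setT)); last by rewrite setIT.
  by rewrite -integral_indic.
transitivity (\int[P]_(w in gen n g) (\prod_(x <- map inr s) G x w)%:E)%E.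
  rewrite -integral_gen_indic; last by apply: fin_bigcap_measurable.
  apply: eq_integral => w _; congr _%:E; rewrite big_map/=.
  rewrite [RHS](_ : _ = \prod_(u <- s) (X u w \in B u)%:R); last first.
    by apply: eq_bigr => u _; rewrite indicE.
  rewrite prod_natb indicE; congr (nat_of_bool _)%:R.
  apply/idP/idP => [/set_mem sw|/allP sw].
    by apply/allP => u us'; apply/mem_set; exact: sw.
  by apply/mem_set => u /sw /set_mem.
rewrite (integral_generation indep).
- by rewrite big_map; congr (_ * _)%E; apply: eq_bigr => u _; exact: EG.
- by rewrite map_inj_uniq// => ? ? [].
- by move=> _ /mapP[u _ ->].
- move=> _ /mapP[u _ ->].
  apply: (@driven_displacement R d disp Omega N X u (\1_(B u))) => //.
- move=> _ /mapP[u _ ->]; rewrite EG.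
  by apply: le_lt_trans (probability_le1 _ (mXB u)) _; exact: ltry.
Qed.

(** The particle and its ancestors, without the initial particle, whose displacement does not enter
    [position]. A label of length n thus has exactly n steps. *)
Fixpoint lineage (v : label d) : seq (label d) :=
  if v is _ :: u then v :: lineage u else [::].

Lemma size_lineage v : size (lineage v) = size v.
Proof. by elim: v => //= jk u ->. Qed.

Lemma positionE v w : position X v w = \sum_(u <- lineage v) X u w.
Proof.
by elim: v => [|jk u IH]; rewrite ?big_nil// big_cons addrC -IH.
Qed.

Lemma mem_lineage_size u v : u \in lineage v -> (0 < size u <= size v)%N.
Proof.
elim: v => // jk v IH; rewrite inE => /predU1P[->|/IH/andP[-> uv]] /=.
  by rewrite leqnn.
exact: leqW.
Qed.

Lemma lineage_uniq v : uniq (lineage v).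
Proof.
elim: v => // jk v IH; rewrite cons_uniq IH andbT.
by apply/negP => /mem_lineage_size /=; rewrite ltnn.
Qed.

Lemma law_displacement' u (B : set R) : (0 < size u)%N -> measurable B ->
  exists j, P (X u @^-1` B) = Q (xi j @^-1` B).
Proof. by case: u => // -[j k] u _ mB; exists j; exact: law_displacement. Qed.

Lemma measurable_position v : measurable_fun setT (position X v).
Proof.
elim: v => [|jk u IH]; first exact: measurable_cst.
by apply: measurable_funD => //; exact: measurable_funP.
Qed.

Definition truncated_exp (s z x : R) : R := expR (s * x) * \1_[set y | y < z] x.

Lemma truncated_exp_ge0 s z x : 0 <= truncated_exp s z x.
Proof. by rewrite mulr_ge0// expR_ge0. Qed.

Lemma measurable_truncated_exp s z : measurable_fun setT (truncated_exp s z).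
Proof.
apply: measurable_funM.
  apply: measurableT_comp; first exact: measurable_expR.
  by apply: measurable_funM => //; exact: measurable_cst.
by apply: measurable_indic; rewrite (_ : [set _ | _] = `]-oo, z[%classic).
Qed.

(** Pointwise, the indicator of S_v >= z is at most the number of steps of size at least z plus
    exp(- s z) times the product of the truncated exponentials along the lineage. The second term is
    Chernoff's bound when no step reaches z. *)
Lemma prob_position_ge n g v (z s p m : R) : size v = n -> 0 <= s ->
  (forall j, Q [set u | (z <= xi j u)%R] <= p%:E)%E ->
  (forall j, \int[Q]_u (truncated_exp s z (xi j u))%:E <= m%:E)%E ->
  (P (gen n g `&` [set w | (z <= position X v w)%R]) <=
   P (gen n g) * (n%:R * p + expR (- (s * z)) * m ^+ n)%:E)%E.
Proof.
move=> vn s0 hp hm.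
have p0 : 0 <= p by rewrite -lee_fin; apply: le_trans (hp root); exact: measure_ge0.
pose big u := [set w | z <= X u w].
have mge : measurable [set x : R | z <= x].
  rewrite (_ : [set _ | _] = `[z, +oo[%classic)//.
  by apply/seteqP; split => x /=; rewrite in_itv /= andbT.
have mbig u : measurable (big u).
  rewrite (_ : big u = X u @^-1` [set x | z <= x])//.
  by rewrite -[Y in measurable Y]setTI; exact: measurable_funP.
have mpos : measurable [set w | z <= position X v w].
  rewrite (_ : [set _ | _] = position X v @^-1` [set x | z <= x])//.
  by rewrite -[Y in measurable Y]setTI; exact: measurable_position.
pose G (x : label d + label d) w : R :=
  if x is inr u then truncated_exp s z (X u w) else 1.
have dG u : driven (inr u) (G (inr u)).
  apply: (@driven_displacement R d disp Omega N X u (truncated_exp s z)).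
    exact: truncated_exp_ge0.
  exact: measurable_truncated_exp.
have EG u : u \in lineage v -> (\int[P]_w (G (inr u) w)%:E <= m%:E)%E.
  move=> /mem_lineage_size; case: u => // -[j k] u _.
  rewrite (integral_displacement j k u (phi := truncated_exp s z))//.
    exact: measurable_truncated_exp.
  exact: truncated_exp_ge0.
have mG w : 0 <= \prod_(u <- lineage v) G (inr u) w.
  by apply: prodr_ge0 => u _; exact: truncated_exp_ge0.
have eG0 w : 0 <= expR (- (s * z)) * \prod_(u <- lineage v) G (inr u) w.
  by rewrite mulr_ge0// expR_ge0.
have mprod : measurable_fun setT (fun w => \prod_(u <- lineage v) G (inr u) w).
  have := @measurable_prod_driven _ _ R _ _
    (@measurable_driving_events _ _ _ _ N X) (map inr (lineage v)) G.
  under eq_fun do rewrite big_map; apply.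
  by move=> _ /mapP[u _ ->].
have mgen := @measurable_generation _ _ _ N n g.
rewrite -integral_gen_indic//.
apply: (@le_trans _ _ (\int[P]_(w in gen n g)
  ((\sum_(u <- lineage v) \1_(big u) w)%:E +
   (expR (- (s * z)) * \prod_(u <- lineage v) G (inr u) w)%:E))%E).
  apply: ge0_le_integral => //.
  - by apply/measurable_EFinP/measurable_funTS/measurable_indic.
  - apply: emeasurable_funD; apply/measurable_EFinP/measurable_funTS.
      by apply: measurable_sum => u; exact: measurable_indic.
    by apply: measurable_funM => //; exact: measurable_cst.
  move=> w _; rewrite -EFinD lee_fin indicE.
  have [/set_mem/= zS|_] := boolP (w \in _); last first.
    by rewrite addr_ge0 ?sumr_ge0.
  have [/hasP[u uv zu]|/hasPn small] := boolP (has (fun u => z <= X u w) (lineage v)).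
    apply: ler_wpDr; first exact: eG0.
    rewrite (bigD1_seq u) ?lineage_uniq// indicE mem_set//.
    have s0' : 0 <= \sum_(i <- lineage v | i != u) \1_(big i) w :> R.
      by apply: sumr_ge0 => i _.
    exact: ler_wpDr s0' (lexx _).
  have -> : \prod_(u <- lineage v) G (inr u) w = expR (s * position X v w).
    rewrite positionE mulr_sumr expR_sum; apply: eq_big_seq => u uv.
    by rewrite /G /truncated_exp indicE mem_set ?mulr1//= ltNge small.
  rewrite -expRD ler_wpDl ?sumr_ge0// -[leLHS]expR0 ler_expR addrC subr_ge0.
  by rewrite ler_wpM2l.
rewrite ge0_integralD//; first last.
- by apply/measurable_EFinP/measurable_funTS; apply: measurable_funM => //; exact: measurable_cst.
- by move=> w _; rewrite lee_fin mulr_ge0// expR_ge0.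
- apply/measurable_EFinP/measurable_funTS.
  by apply: measurable_sum => u; exact: measurable_indic.
- by move=> w _; rewrite lee_fin sumr_ge0.
rewrite EFinD muleDr; last 2 first.
- exact: fin_num_measure.
- exact: fin_num_adde_defl.
apply: leeD.
  under eq_integral do rewrite -sumEFin.
  rewrite ge0_integral_sum//; first last.
  - by move=> u; apply/measurable_EFinP/measurable_funTS/measurable_indic.
  apply: (@le_trans _ _ (\sum_(u <- lineage v) (P (gen n g) * p%:E))%E).
    rewrite big_seq [leRHS]big_seq; apply: lee_sum => u uv.
    rewrite integral_gen_indic//.
    have := @prob_generation_displacements n g [:: u] (fun=> [set x | z <= x]).
    rewrite big_seq1 set_cons1 bigcap_set1 => -> //.
    apply: lee_wpmul2l; first exact: measure_ge0.
    have /andP[u0 _] := mem_lineage_size uv.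
    by have [j ->] := law_displacement' u0 mge; exact: hp.
  rewrite -ge0_sume_distrr; last by move=> _ _; rewrite lee_fin.
  rewrite sumEFin big_const_seq count_predT size_lineage vn iter_addr_0.
  by rewrite mulr_natl.
under eq_integral do rewrite EFinM.
rewrite ge0_integralZl//; first last.
- by move=> w _; rewrite lee_fin.
- exact/measurable_EFinP/measurable_funTS.
rewrite EFinM muleCA; apply: lee_wpmul2l; first by rewrite lee_fin expR_ge0.
have -> : (\int[P]_(w in gen n g) (\prod_(u <- lineage v) G (inr u) w)%:E =
    \int[P]_(w in gen n g) (\prod_(x <- map inr (lineage v)) G x w)%:E)%E.
  by apply: eq_integral => w _; rewrite big_map.
rewrite (integral_generation indep) ?big_map.
- apply: lee_wpmul2l; first exact: measure_ge0.
  apply: le_trans (@lee_prod _ _ _ _ (fun=> m%:E) _ EG) _.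
    by move=> u _; apply: integral_driven_ge0 (dG u).
  by rewrite prodEFin lee_fin big_const_seq count_predT size_lineage vn iter_mulr_1.
- by rewrite map_inj_uniq ?lineage_uniq// => ? ? [].
- by move=> _ /mapP[u _ ->].
- by move=> _ /mapP[u _ ->].
- by move=> _ /mapP[u uv ->]; apply: le_lt_trans (EG u uv) _; exact: ltry.
Qed.

(** Estimates are made for this measurable event; the supremum [max_position] is compared with it
    only at the end. *)
Definition hit n z : set Omega :=
  [set w | exists2 v, v \in generation N n w & z <= position X v w].

Lemma measurable_position_ge v z : measurable [set w | z <= position X v w].
Proof.
rewrite (_ : [set _ | _] = position X v @^-1` `[z, +oo[%classic).
  by rewrite -[Y in measurable Y]setTI; exact: measurable_position.
by apply/seteqP; split => w /=; rewrite in_itv /= andbT.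
Qed.

Lemma measurable_hit n z : measurable (hit n z).
Proof.
have -> : hit n z = \bigcup_(v in [set: label d])
    (generation N n @^-1` [set g : seq (label d) | v \in g] `&`
     [set w | z <= position X v w]).
  by apply/seteqP; split => [w [v vg zv]|w [v _ [vg zv]]]; exists v.
apply: (@bigcup_countable_measurable _ _ (seq ('I_d * nat))) => v _.
apply: measurableI; last exact: measurable_position_ge.
exact/measurable_countable_preimage/measurable_generation.
Qed.

Lemma measure_bigcup_seq (s : seq (label d)) (A : label d -> set Omega) :
  (forall u, u \in s -> measurable (A u)) ->
  measurable (\bigcup_(u in [set` s]) A u) /\
  (P (\bigcup_(u in [set` s]) A u) <= \sum_(u <- s) P (A u))%E.
Proof.
elim: s => [|u s IH] mA.
  by rewrite set_nil bigcup_set0 big_nil measure0.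
have [mU leU] : measurable (\bigcup_(u in [set` s]) A u) /\
    (P (\bigcup_(u in [set` s]) A u) <= \sum_(u <- s) P (A u))%E.
  by apply: IH => v vs; apply: mA; rewrite inE vs orbT.
have mu : measurable (A u) by apply: mA; rewrite mem_head.
have -> : \bigcup_(v in [set` u :: s]) A v = A u `|` \bigcup_(v in [set` s]) A v.
  apply/seteqP; split => [w [v /=]|w [Au|[v vs Av]]].
  - rewrite inE => /predU1P[->|vs] Av; [by left|by right; exists v].
  - by exists u => //=; rewrite mem_head.
  - by exists v => //=; rewrite inE vs orbT.
split; first exact: measurableU.
rewrite big_cons; apply: le_trans (measureU2 _ mu mU) _.
exact: leeD2l.
Qed.

(** Union bound over the particles of each possible generation; the bound [b] is common to all of
    them, and [weight (fun=> 1)] counts them. *)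
Lemma prob_hit n (z s p m b : R) : 0 <= s ->
  (forall j, Q [set u | (z <= xi j u)%R] <= p%:E)%E ->
  (forall j, \int[Q]_u (truncated_exp s z (xi j u))%:E <= m%:E)%E ->
  (n%:R * p + expR (- (s * z)) * m ^+ n <= b) ->
  (P (hit n z) <= b%:E * \int[P]_w (weight (fun=> 1) (generation N n w))%:E)%E.
Proof.
move=> s0 hp hm hb.
have p0 : 0 <= p by rewrite -lee_fin; apply: le_trans (hp root); exact: measure_ge0.
have m0 : 0 <= m.
  rewrite -lee_fin; apply: le_trans (hm root); apply: integral_ge0 => u _.
  by rewrite lee_fin truncated_exp_ge0.
have b0 : 0 <= b.
  by apply: le_trans hb; rewrite addr_ge0 ?mulr_ge0 ?expR_ge0 ?exprn_ge0.
have w0 w : 0 <= weight (fun=> 1) (generation N n w) by exact: weight_ge0.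
have mw := measurable_fun_generation n (weight (fun=> 1)).
rewrite -ge0_integralZl//; first last.
- by move=> w _; rewrite lee_fin.
- exact/measurable_EFinP.
have -> : P (hit n z) = (\int[P]_w (\1_(hit n z) w)%:E)%E.
  by rewrite integral_indic ?setIT//; exact: measurable_hit.
apply: (@le_integral_generation n).
- by apply: measurable_indic; exact: measurable_hit.
- by apply: measurable_funM => //; exact: measurable_cst.
- by [].
- by move=> w; rewrite mulr_ge0.
move=> g ug; have mgen := @measurable_generation _ _ _ N n g.
have [gn|->] := generation_size_or_set0 n g; last by rewrite !integral_set0.
have -> : (\int[P]_(w in gen n g) (b * weight (fun=> 1) (generation N n w))%:E =
    P (gen n g) * (b * (size g)%:R)%:E)%E.
  rewrite muleC -integral_cst//; apply: eq_integral => w /set_mem/= ->.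
  by rewrite /weight big_const_seq count_predT iter_addr_0.
rewrite integral_gen_indic; last exact: measurable_hit.
pose A v := gen n g `&` [set w | z <= position X v w].
have mA v : v \in g -> measurable (A v).
  by move=> _; apply: measurableI => //; exact: measurable_position_ge.
have [mU leU] := measure_bigcup_seq mA.
apply: (@le_trans _ _ (P (\bigcup_(v in [set` g]) A v))).
  apply: le_measure; rewrite ?inE//.
    by apply: measurableI => //; exact: measurable_hit.
  by move=> w [gw [v vg zv]]; exists v => //=; rewrite -gw.
apply: le_trans leU _.
apply: (@le_trans _ _ (\sum_(v <- g) (P (gen n g) * b%:E))%E).
  rewrite big_seq [leRHS]big_seq; apply: lee_sum => v vg.
  apply: le_trans (prob_position_ge g (gn _ vg) s0 hp hm) _.
  by apply: lee_wpmul2l; rewrite ?lee_fin//; exact: measure_ge0.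
rewrite -ge0_sume_distrr; last by move=> _ _; rewrite lee_fin.
by rewrite sumEFin big_const_seq count_predT iter_addr_0 mulr_natr.
Qed.

(** [behead] removes [v] itself: the jump of [v] is treated separately and must stay independent of
    this event. *)
Definition ancestral_drop (b : R) v : set Omega :=
  \bigcup_(u in [set` lineage (behead v)]) (X u @^-1` `]-oo, (- b)%R[%classic).

(* The particles of s are known to jump by less than z, those of l remain to be
   examined: the first of l that jumps beyond z must have an ancestor dropping by
   more than b, and the resulting costs telescope along l. *)
Lemma prob_no_big_jump n g (j : 'I_d) (z b q pi : R) (s l : seq (label d)) :
  uniq (s ++ l) ->
  (forall v, v \in s ++ l -> size v = n.+1 /\ ptype root v = j) ->
  (Q (xi j @^-1` `]-oo, z[%classic) = pi%:E) ->
  (forall i, Q (xi i @^-1` `]-oo, (- b)%R[%classic) <= q%:E)%E ->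
  (P (gen n.+1 g `&` \bigcap_(v in [set` s]) (X v @^-1` `]-oo, z[%classic) `&`
      \bigcap_(v in [set` l]) (X v @^-1` `]-oo, z[%classic `|` ancestral_drop b v)) <=
   P (gen n.+1 g) * (pi ^+ (size (s ++ l)) +
     n%:R * q * (pi ^+ size s - pi ^+ (size (s ++ l))))%:E)%E.
Proof.
move=> + + hpi hq.
have pi0 : 0 <= pi by rewrite -lee_fin -hpi; exact: measure_ge0.
have pi1 : pi <= 1.
  rewrite -lee_fin -hpi; apply: probability_le1.
  by rewrite -[Y in measurable Y]setTI; exact: measurable_funP.
have q0 : 0 <= q by rewrite -lee_fin; apply: le_trans (hq root); exact: measure_ge0.
have mX (u : label d) (B : set R) : measurable B -> measurable (X u @^-1` B).
  by move=> mB; rewrite -[Y in measurable Y]setTI; exact: measurable_funP.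
have mgen := @measurable_generation _ _ _ N n.+1 g.
have mbad v : measurable (ancestral_drop b v).
  by apply: fin_bigcup_measurable => // u _; exact: mX.
have msmalls (s' : seq (label d)) :
    measurable (\bigcap_(v in [set` s']) (X v @^-1` `]-oo, z[%classic)).
  by apply: fin_bigcap_measurable => // u _; exact: mX.
have mrests (s' : seq (label d)) :
    measurable (\bigcap_(v in [set` s']) (X v @^-1` `]-oo, z[%classic `|` ancestral_drop b v)).
  by apply: fin_bigcap_measurable => // u _; apply: measurableU => //; exact: mX.
have lawX v : size v = n.+1 -> ptype root v = j -> forall B : set R, measurable B ->
    P (X v @^-1` B) = Q (xi j @^-1` B).
  by case: v => // -[i k] v _ /= <- B mB; exact: law_displacement.
have Psmall s' : uniq s' ->
    (forall v, v \in s' -> size v = n.+1 /\ ptype root v = j) ->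
    (P (gen n.+1 g `&` \bigcap_(v in [set` s']) (X v @^-1` `]-oo, z[%classic)) =
     P (gen n.+1 g) * (pi ^+ size s')%:E)%E.
  move=> us' hs'.
  rewrite (@prob_generation_displacements _ _ _ (fun=> `]-oo, z[%classic))//.
  congr (_ * _)%E; rewrite (eq_big_seq (fun=> pi%:E)) => [|v vs].
    by rewrite prodEFin big_const_seq count_predT iter_mulr_1.
  by have [vn vj] := hs' v vs; rewrite lawX.
elim: l s => [|v l IH] s.
  rewrite cats0 set_nil bigcap_set0 setIT => us hs.
  by rewrite Psmall// subrr mulr0 addr0.
move=> us hs.
have hcat : (rcons s v) ++ l = s ++ v :: l by rewrite cat_rcons.
have [vn vj] : size v = n.+1 /\ ptype root v = j.
  by apply: hs; rewrite mem_cat mem_head orbT.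
have us' : uniq s by move: us; rewrite cat_uniq => /and3P[].
have vs : v \notin s.
  by move: us; rewrite cat_uniq => /and3P[_ /hasPn/(_ v (mem_head _ _))].
have hs' u : u \in s -> size u = n.+1 /\ ptype root u = j.
  by move=> us''; apply: hs; rewrite mem_cat us''.
pose small := \bigcap_(v in [set` s]) (X v @^-1` `]-oo, z[%classic).
pose rest := \bigcap_(v in [set` l]) (X v @^-1` `]-oo, z[%classic `|` ancestral_drop b v).
(* All of [s] stay below [z], [v] jumps beyond it and the strict ancestor [u] drops. The label of
   [u] is shorter than n+1, so [u] differs from [v] and from the members of [s], and the conditions
   are independent. *)
pose A u := gen n.+1 g `&` small `&` (X v @^-1` `[z, +oo[%classic) `&`
  (X u @^-1` `]-oo, (- b)%R[%classic).
have msmall : measurable small := msmalls s.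
have mrest : measurable rest := mrests l.
have mA u : u \in lineage (behead v) -> measurable (A u).
  move=> _; apply: measurableI; last exact: mX.
  by apply: measurableI; [exact: measurableI|exact: mX].
have [mU leU] := measure_bigcup_seq mA.
have PA u : u \in lineage (behead v) ->
    (P (A u) <= P (gen n.+1 g) * (pi ^+ size s * (1 - pi) * q)%:E)%E.
  move=> uv; have := mem_lineage_size uv; rewrite size_behead vn /= => /andP[u0 un].
  have u_sz : size u != n.+1 by rewrite neq_ltn ltnS un.
  pose B x := if x == v then `[z, +oo[%classic else
    if x == u then `]-oo, (- b)%R[%classic else `]-oo, z[%classic : set R.
  have uNv : u != v by apply: contraNneq u_sz => ->; rewrite vn.
  have uNs : u \notin s.
    by apply/negP => /hs'[us'' _]; rewrite us'' eqxx in u_sz.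
  have Bs x : x \in s -> B x = `]-oo, z[%classic.
    move=> xs; rewrite /B; case: eqP => [xv|_]; first by rewrite -xv xs in vs.
    by case: eqP => // xu; rewrite -xu xs in uNs.
  have -> : A u = gen n.+1 g `&` \bigcap_(x in [set` v :: u :: s]) (X x @^-1` B x).
    apply/seteqP; split => [w [[[gw sw] vw] uw]|w [gw Bw]].
      split => // x /=; rewrite !inE => /or3P[/eqP->|/eqP->|xs].
      - by rewrite /B eqxx.
      - by rewrite /B (negbTE uNv) eqxx.
      - by rewrite Bs//; exact: sw.
    split; [split; [split => //|]|].
    - by move=> x xs; rewrite -(Bs x xs); apply: Bw; rewrite /= !inE xs !orbT.
    - by have := Bw v; rewrite /B eqxx; apply; rewrite /= mem_head.
    - by have := Bw u; rewrite /B (negbTE uNv) eqxx; apply; rewrite /= !inE eqxx orbT.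
  rewrite prob_generation_displacements; first last.
  - by move=> x; rewrite /B; case: ifP => // _; case: ifP.
  - by rewrite /= inE negb_or eq_sym uNv vs uNs us'.
  apply: lee_wpmul2l; first exact: measure_ge0.
  rewrite !big_cons (eq_big_seq (fun=> pi%:E)); last first.
    by move=> x xs; have [xn xj] := hs' x xs; rewrite Bs// lawX.
  rewrite prodEFin big_const_seq count_predT iter_mulr_1.
  have -> : P (X v @^-1` B v) = (1 - pi)%:E.
    rewrite /B eqxx lawX//.
    have := @probability_setC _ _ _ Q (xi j @^-1` `]-oo, z[%classic).
    rewrite preimage_setC setCitvl => ->; first by rewrite hpi EFinB.
    by rewrite -[Y in measurable Y]setTI; exact: measurable_funP.
  have -> : B u = `]-oo, (- b)%R[%classic by rewrite /B (negbTE uNv) eqxx.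
  have [i ->] := @law_displacement' u `]-oo, (- b)%R[%classic u0 ltac:(by []).
  rewrite muleCA [leRHS](_ : _ = (q%:E * ((1 - pi)%:E * (pi ^+ size s)%:E))%E); last first.
    by rewrite -!EFinM; congr _%:E; ring.
  apply: lee_wpmul2r => //.
  by rewrite -EFinM lee_fin mulr_ge0 ?subr_ge0 ?exprn_ge0.
apply: (@le_trans _ _ (P (gen n.+1 g `&`
    \bigcap_(v in [set` rcons s v]) (X v @^-1` `]-oo, z[%classic) `&` rest) +
    P (\bigcup_(u in [set` lineage (behead v)]) A u))%E).
  have m1 : measurable (gen n.+1 g `&` \bigcap_(v in [set` rcons s v])
      (X v @^-1` `]-oo, z[%classic) `&` rest).
    by apply: measurableI mrest; apply: measurableI mgen _; exact: msmalls.
  apply: le_trans (measureU2 _ m1 mU).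
  apply: le_measure; rewrite ?inE.
  - by apply: measurableI (mrests _); exact: measurableI.
  - exact: measurableU.
  move=> w [[gw sw] lw].
  have rw : rest w by move=> x xl; apply: lw; rewrite /= inE xl orbT.
  have [Xz|zX] := ltP (X v w) z.
    left; split => //; split => // x /=; rewrite mem_rcons inE => /predU1P[->|xs].
      by rewrite /= in_itv.
    exact: sw.
  right; have [|[u uv ub]] := lw v (mem_head _ _).
    by rewrite /= in_itv/= ltNge zX.
  by exists u => //; split => //; split => //; rewrite /= in_itv/= zX.
have us2 : uniq (rcons s v ++ l) by rewrite hcat.
have hs2 x : x \in rcons s v ++ l -> size x = n.+1 /\ ptype root x = j.
  by rewrite hcat; exact: hs.
apply: le_trans (leeD (IH _ us2 hs2) leU) _.
apply: (@le_trans _ _ (P (gen n.+1 g) * (pi ^+ size (rcons s v ++ l) +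
   n%:R * q * (pi ^+ size (rcons s v) - pi ^+ size (rcons s v ++ l)))%:E +
   P (gen n.+1 g) * (n%:R * (pi ^+ size s * (1 - pi) * q))%:E)%E).
  apply: leeD2l.
  apply: (@le_trans _ _ (\sum_(u <- lineage (behead v))
     (P (gen n.+1 g) * (pi ^+ size s * (1 - pi) * q)%:E))%E).
    by rewrite big_seq [leRHS]big_seq; exact: lee_sum.
  rewrite -ge0_sume_distrr; last first.
    by move=> _ _; rewrite lee_fin mulr_ge0// mulr_ge0 ?exprn_ge0 ?subr_ge0.
  rewrite sumEFin big_const_seq count_predT iter_addr_0 size_lineage size_behead vn.
  by rewrite mulr_natl.
rewrite -muleDr; last 2 first.
- exact: fin_num_measure.
- exact: fin_num_adde_defl.
rewrite hcat size_rcons -EFinD; apply: lee_wpmul2l; first exact: measure_ge0.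
(* Telescoping: pi^|s| (1 - pi), the probability that [v] is the first to jump, equals pi^|s| -
   pi^(|s|+1). *)
rewrite lee_fin exprS le_eqVlt; apply/orP; left; apply/eqP.
by ring.
Qed.

Definition all_below n y : set Omega :=
  [set w | forall v, v \in generation N n w -> position X v w < y].

Lemma all_belowE n y : all_below n y = ~` hit n y.
Proof.
apply/seteqP; split => [w lt_y [v vg]|w nhit v vg].
  by rewrite leNgt lt_y.
by rewrite ltNge; apply/negP => yv; apply: nhit; exists v.
Qed.

(** A particle of generation n+1 has n strict ancestors with a displacement. If none drops by more
    than [b] and the particle itself jumps by at least [z], it ends at or above z - n b >= y. Hence
    on [all_below] every type j particle jumps by less than [z] or has a bad ancestor. *)
Lemma prob_all_below n (j : 'I_d) (y z b q pi : R) (K : nat) : 0 <= b ->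
  y <= z - n%:R * b ->
  (Q (xi j @^-1` `]-oo, z[%classic) = pi%:E) ->
  (forall i, Q (xi i @^-1` `]-oo, (- b)%R[%classic) <= q%:E)%E ->
  (P (all_below n.+1 y `&`
      [set w | (K <= count (fun v => ptype root v == j) (generation N n.+1 w))%N]) <=
   (pi ^+ K + n%:R * q)%:E)%E.
Proof.
move=> b0 yz hpi hq.
have pi0 : 0 <= pi by rewrite -lee_fin -hpi; exact: measure_ge0.
have pi1 : pi <= 1.
  rewrite -lee_fin -hpi; apply: probability_le1.
  by rewrite -[Y in measurable Y]setTI; exact: measurable_funP.
have q0 : 0 <= q by rewrite -lee_fin; apply: le_trans (hq root); exact: measure_ge0.
set A := _ `&` _.
have mA : measurable A.
  apply: measurableI; first by rewrite all_belowE; apply/measurableC/measurable_hit.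
  exact: (measurable_countable_preimage (@measurable_generation _ _ _ N n.+1)
    [set g : seq (label d) | (K <= count (fun v => ptype root v == j) g)%N]).
have mX (u : label d) (B : set R) : measurable B -> measurable (X u @^-1` B).
  by move=> mB; rewrite -[Y in measurable Y]setTI; exact: measurable_funP.
have c0 : 0 <= pi ^+ K + n%:R * q by rewrite addr_ge0 ?exprn_ge0 ?mulr_ge0.
have -> : P A = (\int[P]_w (\1_A w)%:E)%E by rewrite integral_indic ?setIT.
have -> : (pi ^+ K + n%:R * q)%:E = (\int[P]_w (cst (pi ^+ K + n%:R * q) w)%:E)%E.
  transitivity ((pi ^+ K + n%:R * q)%:E * P setT)%E.
    by rewrite probability_setT mule1.
  by rewrite -integral_cst.
apply: (@le_integral_generation n.+1) => //.
move=> g ug; have mgen := @measurable_generation _ _ _ N n.+1 g.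
have [gn|->] := generation_size_or_set0 n.+1 g; last by rewrite !integral_set0.
rewrite integral_gen_indic//.
have -> : (\int[P]_(w in gen n.+1 g) (cst (pi ^+ K + n%:R * q) w)%:E =
    P (gen n.+1 g) * (pi ^+ K + n%:R * q)%:E)%E.
  by rewrite muleC -integral_cst.
pose l := [seq v <- g | ptype root v == j].
have [Kl|lK] := leqP K (size l); last first.
  have -> : gen n.+1 g `&` A = set0.
    apply/seteqP; split => // w [gw [_ Kw]].
    have {}Kw : (K <= count (fun v => ptype root v == j) (generation N n.+1 w))%N := Kw.
    by move: Kw; rewrite (_ : generation N n.+1 w = g)// -size_filter leqNgt lK.
  by rewrite measure0 mule_ge0// lee_fin.
have ul : uniq ([::] ++ l) by exact: filter_uniq.
have hl v : v \in [::] ++ l -> size v = n.+1 /\ ptype root v = j.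
  by rewrite mem_filter => /andP[/eqP vj /gn].
apply: (@le_trans _ _ (P (gen n.+1 g) * (pi ^+ size l +
    n%:R * q * (1 - pi ^+ size l))%:E)%E); last first.
  apply: lee_wpmul2l; first exact: measure_ge0.
  rewrite lee_fin lerD// ?ler_wiXn2l//.
  by rewrite ler_piMr ?mulr_ge0// gerBl exprn_ge0.
apply: le_trans (prob_no_big_jump g ul hl hpi hq).
rewrite set_nil bigcap_set0 setIT; apply: le_measure; rewrite ?inE.
- exact: measurableI.
- apply: measurableI => //; apply: fin_bigcap_measurable => // v _.
  apply: measurableU; first exact: mX.
  by apply: fin_bigcup_measurable => // u _; exact: mX.
move=> w [gw [lt_y _]]; split => // v /= vl.
have [vn vj] := hl v vl.
have [Xz|zX] := ltP (X v w) z; first by left; rewrite /= in_itv.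
right; apply: contrapT => nbad.
have vg : v \in generation N n.+1 w.
  by rewrite (_ : generation N n.+1 w = g)//; move: vl; rewrite mem_filter => /andP[].
have := lt_y v vg; apply/negP; rewrite -leNgt; apply: le_trans yz _.
case: v vn nbad {vl vj vg} zX => // jk v /= [vn] nbad zX.
rewrite addrC lerD// positionE.
rewrite -mulrN -vn -(size_lineage v) mulr_natl -iter_addr_0 -(count_predT (lineage v)) -big_const_seq.
rewrite big_seq [leRHS]big_seq; apply: ler_sum => u uv.
rewrite leNgt; apply/negP => Xb; by apply: nbad; exists u.
Qed.

End branching.

(** * Regularly varying tails *)

Section growth_of_sequences.
Context {R : realType}.
Implicit Types (u v : nat -> R).

Lemma eventually_ge_of_increments v (delta M : R) (K : nat) : 0 < delta ->
  (forall k, (K <= k)%N -> v k + delta <= v k.+1) ->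
  exists K', (K <= K')%N /\ forall k, (K' <= k)%N -> M <= v k.
Proof.
move=> d0 dv.
have lin m : v K + m%:R * delta <= v (K + m)%N.
  elim: m => [|m IH]; first by rewrite mul0r addr0 addn0.
  rewrite addnS; apply: le_trans (dv _ (leq_addr _ _)).
  by rewrite -natr1 mulrDl mul1r addrA lerD2r.
pose m0 := Num.truncn (`|(M - v K) / delta|); pose m := m0.+1.
exists (K + m)%N; split; first exact: leq_addr.
move=> k Kmk; have Kk : (K <= k)%N by apply: leq_trans Kmk; exact: leq_addr.
have := lin (k - K)%N; rewrite subnKC//; apply: le_trans.
have mk : (m <= k - K)%N by rewrite leq_subRL.
have h1 : (M - v K) / delta <= (k - K)%:R.
  apply: le_trans (ler_norm _) _; apply: (@le_trans _ _ m%:R); last by rewrite ler_nat.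
  exact/ltW/truncnS_gt.
by move: h1; rewrite ler_pdivrMr// => h1; rewrite -lerBlDl.
Qed.

Lemma eventually_ge_of_ratio u (q M : R) (K : nat) : 1 < q ->
  (forall k, (K <= k)%N -> 0 < u k) ->
  (forall k, (K <= k)%N -> q * u k <= u k.+1) ->
  exists K', (K <= K')%N /\ forall k, (K' <= k)%N -> M <= u k.
Proof.
move=> q1 u0 qu.
have mono k : (K <= k)%N -> u K <= u k.
  elim: k => [|k IH]; first by rewrite leqn0 => /eqP ->.
  rewrite leq_eqVlt => /predU1P[->//|]; rewrite ltnS => Kk.
  apply: le_trans (IH Kk) (le_trans _ (qu k Kk)).
  by rewrite ler_peMl ?ltW ?u0.
apply: (@eventually_ge_of_increments u ((q - 1) * u K)).
  by rewrite mulr_gt0 ?subr_gt0 ?u0.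
move=> k Kk; apply: le_trans (qu k Kk).
have := mono k Kk; have := u0 K (leqnn _); nra.
Qed.

(** Along a sequence [u] of geometric growth, a sequence with bounded increments is o(u); this is
    how slowly varying factors are discarded. *)
Lemma bounded_increments_negligible u v (q e : R) (K : nat) : 1 < q -> 0 < e ->
  (forall k, (K <= k)%N -> 0 < u k) ->
  (forall k, (K <= k)%N -> q * u k <= u k.+1) ->
  (forall k, (K <= k)%N -> `|v k.+1 - v k| <= 1) ->
  exists K', (K <= K')%N /\ forall k, (K' <= k)%N -> `|v k| <= e * u k.
Proof.
move=> q1 e0 u0 qu dv.
have eq0 : 0 < e * (q - 1) by rewrite mulr_gt0 ?subr_gt0.
(* Above this threshold e u gains at least 2 per step while |v| gains at most 1. *)
have [K1 [KK1 uK1]] := eventually_ge_of_ratio (2 / (e * (q - 1))) q1 u0 qu.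
have [K2 [K12 wK2]] : exists K', (K1 <= K')%N /\
    forall k, (K' <= k)%N -> 0 <= e * u k - `|v k|.
  apply: (@eventually_ge_of_increments (fun k => e * u k - `|v k|) 1) => // k K1k.
  have Kk : (K <= k)%N := leq_trans KK1 K1k.
  have := uK1 k K1k; rewrite ler_pdivrMr// => h.
  have h2 : `|v k.+1| <= `|v k| + 1.
    apply: le_trans (_ : `|v k| + `|v k.+1 - v k| <= _); last by rewrite lerD2l dv.
    by rewrite -{1}(subrK (v k) (v k.+1)) addrC ler_normD.
  have := qu k Kk; have : 0 < u k := u0 k Kk; nra.
exists K2; split; first exact: leq_trans K12.
by move=> k /wK2; rewrite subr_ge0.
Qed.

Lemma geometric_grid (c t : R) (K : nat) : 1 < c -> c ^+ K <= t ->
  exists k, (K <= k)%N /\ c ^+ k <= t < c ^+ k.+1.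
Proof.
move=> c1 Kt.
have [K' [_ hK']] : exists K', (0 <= K')%N /\ forall k, (K' <= k)%N -> t + 1 <= c ^+ k.
  apply: (eventually_ge_of_ratio _ c1) => k _; last by rewrite exprS.
  by rewrite exprn_gt0// (lt_trans ltr01).
have ex : exists k, t < c ^+ k.
  by exists K'; apply: lt_le_trans (hK' _ (leqnn _)); rewrite ltrDl.
pose k := ex_minn ex; have : k = ex_minn ex by []; case: ex_minnP => m tm mmin km.
have Km : (K < m)%N.
  rewrite ltnNge; apply/negP => mK; have : c ^+ m <= c ^+ K.
    by rewrite ler_weXn2l// ltW.
  by move=> /le_trans/(_ Kt); rewrite leNgt tm.
case: m Km tm mmin km => // m; rewrite ltnS => Km tm mmin _.
exists m; split => //; rewrite tm andbT leNgt; apply/negP => /mmin.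
by rewrite ltnn.
Qed.

End growth_of_sequences.

(** * Tail exponents along geometric grids *)

Section regular_variation.
Context {R : realType}.
Implicit Types (f g a L : R -> R) (r : R).

(** Thresholds are at least 1, so the points concerned are positive. *)
Definition eventually_R (A : R -> Prop) : Prop := exists2 T : R, 1 <= T & forall t, T <= t -> A t.

Lemma eventually_R_and (A B : R -> Prop) : eventually_R A -> eventually_R B ->
  eventually_R (fun t => A t /\ B t).
Proof.
move=> [T T1 hA] [T' T'1 hB]; exists (Num.max T T'); first by rewrite le_max T1.
by move=> t; rewrite ge_max => /andP[/hA ? /hB].
Qed.

Lemma eventually_R_le (T : R) : eventually_R (fun t => T <= t).
Proof.
exists (Num.max 1 T); first by rewrite le_max lexx.
by move=> t; rewrite ge_max => /andP[].
Qed.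

Lemma eventually_R_imp (A B : R -> Prop) : (forall t, A t -> B t) ->
  eventually_R A -> eventually_R B.
Proof. by move=> AB [T T1 hA]; exists T => // t /hA/AB. Qed.

Lemma eventually_R_forall (I : finType) (A : I -> R -> Prop) :
  (forall i, eventually_R (A i)) -> eventually_R (fun t => forall i, A i t).
Proof.
move=> hA; have /choice[T hT] : forall i, exists T, forall t, T <= t -> A i t.
  by move=> i; have [S S1 hS] := hA i; exists S.
exists (\big[Num.max/1]_i T i); first exact: bigmax_ge_id.
move=> t Tt i; apply: hT; apply: le_trans Tt.
exact: le_bigmax.
Qed.

Lemma eventually_R_scale (A : R -> Prop) (c : R) : 0 < c ->
  eventually_R A -> eventually_R (fun t => A (c * t)).
Proof.
move=> c0 [T T1 hA]; have [S S1 hS] := eventually_R_le (T / c); exists S => //.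
by move=> t /hS; rewrite ler_pdivrMr// mulrC => /hA.
Qed.

Lemma cvgy_eventually (f : R -> R) (l e : R) : f x @[x --> +oo] --> l ->
  0 < e -> eventually_R (fun t => `|f t - l| < e).
Proof.
move=> /cvgrPdist_lt fl e0; have [T [Treal hT]] := fl _ e0.
exists (Num.max 1 (T + 1)); first by rewrite le_max lexx.
move=> t; rewrite ge_max => /andP[_ Tt]; rewrite distrC; apply: hT.
by apply: lt_le_trans Tt; rewrite ltrDl.
Qed.

(* The first clause says that f t / t is eventually nonincreasing, the second that
   f (c t) / f t tends to c `^ r. *)
Definition regular f r : Prop :=
  eventually_R (fun s => 0 < f s /\ forall t, s <= t -> f t * s <= f s * t) /\
  forall c e, 0 < c -> 0 < e ->
    eventually_R (fun t => (c `^ r - e) * f t <= f (c * t) <= (c `^ r + e) * f t).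

Lemma powR_gt1 (c x : R) : 1 < c -> 0 < x -> 1 < c `^ x.
Proof.
move=> c1 x0; have := gt0_ltr_powR x0 (ler01 : 1 \in Num.nneg) _ c1.
by rewrite powR1; apply; rewrite nnegrE ltW// (lt_trans ltr01).
Qed.

Lemma regular_ratio_gt f r c : regular f r -> 0 < r -> 1 < c ->
  exists2 q, 1 < q & eventually_R (fun t => q * f t <= f (c * t)).
Proof.
move=> [_ hf] r0 c1; have cr := powR_gt1 c1 r0.
exists ((c `^ r + 1) / 2); first by lra.
have [||T T1 hT] := hf c ((c `^ r - 1) / 2); [by lra|by lra|].
exists T => // t /hT/andP[h _]; apply: le_trans h.
by rewrite le_eqVlt; apply/orP; left; apply/eqP; congr (_ * _); field.
Qed.

Lemma slowly_varying_ratio a c e : slowly_varying a -> 0 < c -> 0 < e ->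
  eventually_R (fun t => `|a (c * t) / a t - 1| < e).
Proof. by move=> ha c0 e0; exact: cvgy_eventually (ha c c0) e0. Qed.

(** Where a t = 0 the convention on inverses makes the ratio a t / a t equal to 0, at distance 1
    from its limit. *)
Lemma slowly_varying_neq0 a : slowly_varying a -> eventually_R (fun t => a t != 0).
Proof.
move=> /slowly_varying_ratio -/(_ 1 1 ltr01 ltr01); apply: eventually_R_imp => t.
by apply: contraTneq => ->; rewrite invr0 mulr0 sub0r normrN1 ltxx.
Qed.

Lemma ln_le_subr1 (x : R) : 0 < x -> ln x <= x - 1.
Proof.
move=> x0; rewrite -{1}(subrKC 1 x); apply: le_ln1Dx.
by rewrite ltrBrDl subrr.
Qed.

Lemma norm_ln_le1 (x : R) : `|x - 1| < 1 / 2 -> `|ln x| <= 1.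
Proof.
rewrite ltr_norml => /andP[x1 x2]; have x0 : 0 < x by lra.
rewrite ler_norml; apply/andP; split; last by apply: le_trans (ln_le_subr1 x0) _; lra.
rewrite lerNl -lnV ?posrE//; apply: le_trans (ln_le_subr1 _) _; first by rewrite invr_gt0.
rewrite lerBlDr -div1r ler_pdivrMr//; lra.
Qed.

Lemma eventually_grid (A : R -> Prop) (c t0 : R) : 1 < c -> 0 < t0 ->
  eventually_R A -> exists K, forall k, (K <= k)%N -> A (c ^+ k * t0).
Proof.
move=> c1 t00 [T T1 hT].
have [||K [_ hK]] := @eventually_ge_of_ratio _ (fun k => c ^+ k * t0) c T 0 c1.
- by move=> k _; rewrite mulr_gt0// exprn_gt0// (lt_trans ltr01).
- by move=> k _; rewrite exprS mulrA.
by exists K => k /hK /hT.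
Qed.

(** Consecutive grid values of [a] have ratio close to 1, so ln a moves by at most 1 per step and is
    negligible against any [u] of geometric growth. *)
Lemma ln_slowly_varying_grid a u (c t0 q e : R) (K : nat) :
  slowly_varying a -> eventually_R (fun t => 0 < a t) -> 1 < c -> 0 < t0 ->
  1 < q -> 0 < e ->
  (forall k, (K <= k)%N -> 0 < u k) ->
  (forall k, (K <= k)%N -> q * u k <= u k.+1) ->
  exists K', forall k, (K' <= k)%N -> `|ln (a (c ^+ k * t0))| <= e * u k.
Proof.
move=> ha a0 c1 t00 q1 e0 u0 qu.
have c0 : 0 < c := lt_trans ltr01 c1.
have half0 : (0 : R) < 1 / 2 by lra.
have [K1 hK1] := eventually_grid c1 t00 (eventually_R_and a0
  (eventually_R_and (eventually_R_scale c0 a0) (slowly_varying_ratio ha c0 half0))).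
have [|||K2 [_ hK2]] := @bounded_increments_negligible _ u
  (fun k => ln (a (c ^+ k * t0))) q e (maxn K K1) q1 e0.
- by move=> k; rewrite geq_max => /andP[/u0].
- by move=> k; rewrite geq_max => /andP[/qu].
- move=> k; rewrite geq_max => /andP[_ /hK1[at0 [act0 rat]]].
  rewrite exprS -mulrA -ln_div ?posrE//; exact: norm_ln_le1.
by exists K2.
Qed.

Section subexponential_tail.
Variables (H a L : R -> R) (r : R).
Hypothesis HE : forall t, 0 < t -> H t = a t * expR (- (L t * t `^ r)).
Hypothesis H_anti : forall s t, s <= t -> H t <= H s.
Hypothesis H0 : forall t, 0 <= H t.
Hypothesis H1 : forall t, H t <= 1.
Hypothesis ha : slowly_varying a.
Hypothesis hL : slowly_varying L.
Hypothesis hmono : eventually_nonincreasing (fun t => L t / t `^ (1 - r)).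
Hypothesis r01 : 0 < r < 1.

Let f t := L t * t `^ r.

Let fE t : 0 < t -> f t = L t / t `^ (1 - r) * t.
Proof.
move=> t0; rewrite /f -mulrA; congr (_ * _).
have t1 : t `^ (1 - r) != 0 by rewrite gt_eqF// powR_gt0.
apply: (mulfI t1); rewrite mulrA divff// mul1r -powRD ?subrK ?powRr1 ?ltW//.
by rewrite gt_eqF ?implybT.
Qed.

Let a_gt0 : eventually_R (fun t => 0 < a t).
Proof.
apply: eventually_R_imp (eventually_R_and (eventually_R_le 1) (slowly_varying_neq0 ha)).
move=> t [t1 at0]; have t0 : 0 < t := lt_le_trans ltr01 t1.
rewrite lt_neqAle eq_sym at0/=; have := H0 t.
by rewrite HE// pmulr_lge0// expR_gt0.
Qed.

Let HlnE t : 0 < t -> 0 < a t -> H t = expR (ln (a t) - f t).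
Proof. by move=> t0 at0; rewrite HE// expRD lnK ?posrE. Qed.

(** The sign of [L] comes from H <= 1. If L t1 < 0, monotonicity of L t / t^(1-r) gives - f t >=
    kappa t beyond t1; on the grid 2^k t1 the term ln a is at most half of that, so H would exceed
    1. *)
Let L_gt0 : eventually_R (fun t => 0 < L t).
Proof.
have [x0 mono] := hmono.
have [T T1 hT] := eventually_R_and (eventually_R_le x0)
  (eventually_R_and (slowly_varying_neq0 hL) a_gt0).
exists T => // t1 Tt1; have [xt1 [Lt1 _]] := hT t1 Tt1.
have t10 : 0 < t1 by apply: lt_le_trans Tt1; exact: lt_le_trans ltr01 T1.
rewrite lt_neqAle eq_sym Lt1/= leNgt; apply/negP => Lneg.
pose kappa := - (L t1 / t1 `^ (1 - r)).
have k0 : 0 < kappa by rewrite oppr_gt0 pmulr_llt0// invr_gt0 powR_gt0.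
have f_le t : t1 <= t -> kappa * t <= - f t.
  move=> t1t; have t0 := lt_le_trans t10 t1t.
  rewrite fE// -mulNr ler_pM2r// lerN2; exact: mono.
have two1 : (1 : R) < 2 by rewrite ltr1n.
have half0 : (0 : R) < 1 / 2 by lra.
pose u k : R := kappa * (2 ^+ k * t1).
have u0 k : (0 <= k)%N -> 0 < u k by move=> _; rewrite !mulr_gt0// exprn_gt0.
have qu k : (0 <= k)%N -> 2 * u k <= u k.+1.
  by move=> _; rewrite /u exprS mulrCA -mulrA.
have [K hK] := ln_slowly_varying_grid ha a_gt0 two1 t10 two1 half0 u0 qu.
have tK : t1 <= 2 ^+ K * t1 by rewrite ler_peMl ?exprn_ege1// ltW.
have tK0 := lt_le_trans t10 tK.
have [_ [_ aK]] := hT _ (le_trans Tt1 tK).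
have := hK K (leqnn _); rewrite ler_norml => /andP[lnK _].
have := H1 (2 ^+ K * t1); rewrite HlnE// expR_le1 leNgt => /negP; apply.
have := f_le _ tK; have := u0 K isT; rewrite /u in lnK *; lra.
Qed.

Lemma tail_exponent_regular : regular f r.
Proof.
split.
  have [x0 mono] := hmono.
  apply: eventually_R_imp (eventually_R_and (eventually_R_le 1)
    (eventually_R_and (eventually_R_le x0) L_gt0)) => s [s1 [x0s Ls]].
  have s0 : 0 < s := lt_le_trans ltr01 s1.
  split; first by rewrite mulr_gt0// powR_gt0.
  move=> t st; have t0 : 0 < t := lt_le_trans s0 st.
  rewrite !fE// mulrAC [leRHS]mulrAC -mulrA -[leRHS]mulrA [s * t]mulrC.
  by apply: ler_wpM2r; [rewrite mulr_ge0// ltW|exact: mono].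
move=> c e c0 e0; have cr0 : 0 < c `^ r by rewrite powR_gt0.
have ec0 : 0 < e / c `^ r by rewrite divr_gt0.
apply: eventually_R_imp (eventually_R_and (eventually_R_le 1)
  (eventually_R_and L_gt0 (slowly_varying_ratio hL c0 ec0))) => t [t1 [Lt rat]].
have t0 : 0 < t := lt_le_trans ltr01 t1.
have ft0 : 0 < f t by rewrite mulr_gt0// powR_gt0.
have -> : f (c * t) = L (c * t) / L t * c `^ r * f t.
  rewrite /f powRM ?ltW//; field; exact: lt0r_neq0.
move: rat; rewrite ltr_norml => /andP[r1 r2].
have h1 : - e <= (L (c * t) / L t - 1) * c `^ r.
  by rewrite -ler_pdivrMr// mulNr ltW.
have h2 : (L (c * t) / L t - 1) * c `^ r <= e by rewrite -ler_pdivlMr// ltW.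
by rewrite !ler_pM2r//; apply/andP; split; lra.
Qed.

(** On the grid |ln a| <= delta f. Between c^k and c^(k+1) the tail [H] is monotone, and [f] changes
    by a factor at most c because f t / t is nonincreasing. *)
Lemma tail_bounds e : 0 < e < 1 ->
  eventually_R (fun t => expR (- ((1 + e) * f t)) <= H t <= expR (- ((1 - e) * f t))).
Proof.
(* These values satisfy (1 + delta) c <= 1 + e and (1 - e) c <= 1 - delta. *)
move=> /andP[e0 e1]; pose c := 1 + e / 4; pose delta := e / 4.
have c1 : 1 < c by rewrite /c; lra.
have d0 : 0 < delta by rewrite /delta; lra.
have c0 : 0 < c := lt_trans ltr01 c1.
have reg := tail_exponent_regular.
have /andP[r0 _] := r01.
have [q q1 hq] := regular_ratio_gt reg r0 c1.
have [f_mono _] := reg.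
have [K hK] := eventually_grid c1 ltr01 (eventually_R_and f_mono
  (eventually_R_and hq a_gt0)).
have fK k : (K <= k)%N -> 0 < f (c ^+ k) by move=> /hK[]; rewrite mulr1 => -[].
have qK k : (K <= k)%N -> q * f (c ^+ k) <= f (c ^+ k.+1).
  by move=> /hK[_ []]; rewrite mulr1 exprS.
have [K1 hK1] := ln_slowly_varying_grid ha a_gt0 c1 ltr01 q1 d0 fK qK.
pose K2 := maxn K K1.
apply: eventually_R_imp (eventually_R_and f_mono (eventually_R_le (c ^+ K2))).
move=> t [[ft ft_mono] /(geometric_grid c1)[k [K2k /andP[ckt tck]]]].
have Kk : (K <= k)%N by apply: leq_trans K2k; exact: leq_maxl.
have K1k : (K1 <= k)%N by apply: leq_trans K2k; exact: leq_maxr.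
have ck0 m : 0 < c ^+ m by rewrite exprn_gt0.
have t0 : 0 < t := lt_le_trans (ck0 k) ckt.
have bnd m : (K <= m)%N -> (K1 <= m)%N ->
    expR (- ((1 + delta) * f (c ^+ m))) <= H (c ^+ m) <=
    expR (- ((1 - delta) * f (c ^+ m))).
  move=> Km K1m; have [_ [_ am]] := hK m Km; rewrite mulr1 in am.
  have := hK1 m K1m; rewrite mulr1 ler_norml => /andP[l1 l2].
  by rewrite HlnE// !ler_expR; apply/andP; split; lra.
have [[_ fk_mono] _] := hK k Kk; rewrite mulr1 in fk_mono.
have ftk : f t <= c * f (c ^+ k).
  rewrite -(ler_pM2r (ck0 k)); apply: le_trans (fk_mono _ ckt) _.
  rewrite [leRHS]mulrAC -exprS [leLHS]mulrC; apply: ler_wpM2r (ltW tck).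
  exact/ltW/fK.
have fkt : f (c ^+ k.+1) <= c * f t.
  rewrite -(ler_pM2r t0); apply: le_trans (ft_mono _ (ltW tck)) _.
  by rewrite exprS mulrCA mulrA ler_wpM2l// mulr_ge0 ?ltW.
have fk0 := fK k Kk.
have /andP[_ up] := bnd k Kk K1k.
have /andP[lo _] := bnd k.+1 (leqW Kk) (leqW K1k).
apply/andP; split.
  apply: le_trans (H_anti (ltW tck)); apply: le_trans lo.
  rewrite ler_expR lerN2; apply: (@le_trans _ _ ((1 + delta) * (c * f t))).
    by rewrite ler_wpM2l//; rewrite /delta; lra.
  by rewrite mulrA ler_wpM2r ?ltW// /delta /c; nra.
apply: le_trans (H_anti ckt) _; apply: le_trans up _.
rewrite ler_expR lerN2; apply: (@le_trans _ _ ((1 - e) * (c * f (c ^+ k)))).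
  by rewrite ler_wpM2l// subr_ge0 ltW.
by rewrite mulrA ler_wpM2r ?ltW// /delta /c; nra.
Qed.

End subexponential_tail.

End regular_variation.

(** * Comparison of regularly varying functions *)

Section regular_comparison.
Context {R : realType}.
Implicit Types (f g h : R -> R) (r p s : R).

(** Along the powers of 2 the ratio h/f is multiplied at each step by about 2^(s-p) > 1, hence it
    becomes large. Exponent s = 1 is allowed, which later compares the tail exponent with linear
    functions. *)
Lemma regular_dominated f h p s : 0 < p -> p < s -> regular f p -> regular h s ->
  eventually_R (fun t => f t <= h t).
Proof.
move=> p0 ps [f_mono rf] [h_mono rh].
have two1 : (1 : R) < 2 by rewrite ltr1n.
have two0 : (0 : R) < 2 by [].
(* A quarter of the gap keeps S2 - e above P2 + e, so that q > 1. *)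
pose P2 : R := 2 `^ p; pose S2 : R := 2 `^ s; pose e := (S2 - P2) / 4.
have P1 : 1 < P2 := powR_gt1 two1 p0.
have PS : P2 < S2.
  rewrite /S2 -(subrKC p s) powRD ?pnatr_eq0 ?implybT// -/P2.
  by rewrite ltr_pMr ?powR_gt1 ?subr_gt0// (lt_trans ltr01).
have e0 : 0 < e by rewrite /e; lra.
pose q := (S2 - e) / (P2 + e).
have q1 : 1 < q by rewrite /q ltr_pdivlMr; rewrite /e; lra.
have [K hK] := eventually_grid two1 ltr01 (eventually_R_and
  (eventually_R_and f_mono h_mono) (eventually_R_and (rf _ _ two0 e0) (rh _ _ two0 e0))).
pose u k := h (2 ^+ k) / f (2 ^+ k).
have u0 k : (K <= k)%N -> 0 < u k.
  by move=> /hK; rewrite mulr1 => -[[[fk _] [hk _]] _]; rewrite divr_gt0.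
have qu k : (K <= k)%N -> q * u k <= u k.+1.
  move=> Kk; have := hK _ Kk; rewrite mulr1 => -[[[fk _] [hk _]] [/andP[_ f2] /andP[h2 _]]].
  have := hK _ (leqW Kk); rewrite mulr1 => -[[[fk' _] _] _].
  rewrite -exprS -/P2 -/S2 in f2 h2.
  have Pe : 0 < P2 + e by lra.
  have Se : 0 <= S2 - e by rewrite /e; lra.
  rewrite /u /q mulf_div ler_pdivrMr ?mulr_gt0// mulrAC ler_pdivlMr//.
  by apply: (ler_pM _ (ltW fk') h2 f2); rewrite mulr_ge0// ltW.
(* The factor 4 pays for leaving the grid: [f] and [h] each lose at most a factor 2 inside a dyadic
   block. *)
have [K1 [KK1 uK1]] := eventually_ge_of_ratio 4 q1 u0 qu.
apply: eventually_R_imp (eventually_R_and h_mono (eventually_R_le (2 ^+ K1))).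
move=> t [[ht ht_mono] /(geometric_grid two1)[k [K1k /andP[ckt tck]]]].
have := hK _ (leq_trans KK1 K1k).
rewrite mulr1 => -[[[fk f_mono'] [hk _]] [_ /andP[h2 _]]].
have := uK1 k K1k; rewrite /u ler_pdivlMr// => h4.
have ck0 : (0 : R) < 2 ^+ k by rewrite exprn_gt0.
have t0 : 0 < t := lt_le_trans ck0 ckt.
have ft := f_mono' _ ckt; have htk := ht_mono _ (ltW tck).
rewrite -exprS -/S2 in h2; rewrite exprS in tck.
have h2' : h (2 ^+ k) <= h (2 ^+ k.+1) by apply: le_trans h2; rewrite /e; nra.
have a1 : f t <= 2 * f (2 ^+ k).
  by rewrite -(ler_pM2r ck0); apply: le_trans ft _; nra.
have a2 : h (2 ^+ k.+1) <= 2 * h t.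
  rewrite -(ler_pM2r t0); apply: le_trans htk _; rewrite exprS; nra.
lra.
Qed.

Lemma regular_powR s : 0 < s < 1 -> regular (fun t => t `^ s) s.
Proof.
move=> /andP[s0 s1]; split.
  apply: eventually_R_imp (eventually_R_le 1) => t t1.
  have t0 : 0 < t := lt_le_trans ltr01 t1.
  split; first exact: powR_gt0.
  move=> x tx; have x0 := lt_le_trans t0 tx.
  have E y : 0 < y -> y = y `^ s * y `^ (1 - s).
    move=> y0; rewrite -powRD ?subrKC ?powRr1 ?ltW//.
    by rewrite gt_eqF ?implybT.
  rewrite {1}(E t t0) {2}(E x x0) [leLHS]mulrCA.
  apply: ler_wpM2l; first exact: powR_ge0.
  apply: ler_wpM2l; first exact: powR_ge0.
  by apply: ge0_ler_powR; rewrite ?nnegrE ?subr_ge0// ltW.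
move=> c e c0 e0; apply: eventually_R_imp (eventually_R_le 1) => t t1.
have t0 : 0 < t := lt_le_trans ltr01 t1.
have ts : 0 < t `^ s by rewrite powR_gt0.
have -> : (c * t) `^ s = c `^ s * t `^ s by rewrite powRM// ltW.
by rewrite !ler_pM2r//; apply/andP; split; lra.
Qed.

Lemma regular_sublinear g r : 0 < r < 1 -> regular g r ->
  exists2 s, 0 < s < 1 & eventually_R (fun t => g t <= t `^ s).
Proof.
move=> /andP[r0 r1] rg; have s01 : 0 < (1 + r) / 2 < 1 by lra.
exists ((1 + r) / 2) => //.
apply: (regular_dominated r0 _ rg (regular_powR s01)); lra.
Qed.

End regular_comparison.

(** * The minimal tail exponent *)

Section minimal_exponent.
Context {R : realType} {d : nat}.
Variables (L : 'I_d.+1 -> R -> R) (r : 'I_d.+1 -> R).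
Hypothesis r01 : forall i, 0 < r i < 1.

Local Notation f := (fun i (t : R) => L i t * t `^ r i).
Hypothesis reg : forall i, regular (f i) (r i).
Local Notation rho := (min_exponent r).

Definition min_tail (t : R) : R := min_slow r L t * t `^ rho.

Lemma min_exponent_le i : rho <= r i.
Proof. exact: bigmin_le. Qed.

Lemma min_exponent_arg : r [arg min_(i < ord0) r i]%O = rho.
Proof.
case: arg_minP => // i _ hi; apply/le_anti; rewrite min_exponent_le andbT.
by apply/bigmin_geP; split => [|j _]; exact: hi.
Qed.

Lemma min_exponent01 : 0 < rho < 1.
Proof. by rewrite -min_exponent_arg. Qed.

Lemma min_tail_le i t : 0 <= t -> r i = rho -> min_tail t <= f i t.
Proof.
move=> t0 ri; rewrite /min_tail ri ler_wpM2r ?powR_ge0//.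
by apply: bigmin_le_cond; rewrite ri.
Qed.

Lemma min_tail_attained t : exists2 i, r i = rho & min_tail t = f i t.
Proof.
suff [i ri E] : exists2 i, r i = rho & min_slow r L t = L i t.
  by exists i; rewrite // /min_tail E ri.
rewrite /min_slow; elim/big_rec: _ => [|i x /eqP ri [j rj ->]].
  by exists [arg min_(i < ord0) r i]%O => //; exact: min_exponent_arg.
by case: (leP (L i t) (L j t)) => _; [exists i|exists j].
Qed.

(** The minimizing type depends on t. The upper bounds, including the monotonicity of the quotient
    by t, use the type that is minimal at t; the lower bound uses the one that is minimal at c t. *)
Lemma min_tail_regular : regular min_tail rho.
Proof.
have all_mono := eventually_R_forall (fun i => (reg i).1).
split.
  apply: eventually_R_imp (eventually_R_and (eventually_R_le 1) all_mono) => s [s1 hs].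
  have s0 : 0 <= s := le_trans ler01 s1.
  have [i ri E] := min_tail_attained s; have [fs fm] := hs i.
  rewrite E; split => // t st; apply: le_trans (fm t st).
  by rewrite ler_wpM2r//; apply: min_tail_le ri; exact: le_trans st.
move=> c e c0 e0.
have all_ratio := eventually_R_forall (fun i => (reg i).2 c e c0 e0).
apply: eventually_R_imp (eventually_R_and (eventually_R_le 1)
  (eventually_R_and (eventually_R_and all_mono (eventually_R_scale c0 all_mono)) all_ratio)).
move=> t [t1 [[hm hcm] hr]]; have t0 : 0 <= t := le_trans ler01 t1.
have ct0 : 0 <= c * t by rewrite mulr_ge0// ltW.
have [i ri Ei] := min_tail_attained t; have [k rk Ek] := min_tail_attained (c * t).
have := hr i; have := hr k; rewrite ri rk => /andP[lo _] /andP[_ up].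
have mi := min_tail_le ct0 ri; have mk := min_tail_le t0 rk.
have [fk _] := hcm k; have [fi _] := hm i.
rewrite ri in Ei mi fi; rewrite rk in Ek mk fk.
apply/andP; split; last by rewrite Ei; exact: le_trans up.
(* With a negative coefficient the lower bound follows from positivity alone. *)
have [ce|ce] := leP 0 (c `^ rho - e).
  by rewrite Ek; apply: le_trans lo; rewrite ler_wpM2l.
by rewrite Ek Ei; apply: le_trans (ltW fk); rewrite nmulr_rle0// ltW.
Qed.

Lemma min_tail_le_eventually i : eventually_R (fun t => min_tail t <= f i t).
Proof.
have [ri|ri] := eqVneq (r i) rho.
  apply: eventually_R_imp (eventually_R_le 1) => t t1.
  by apply: min_tail_le => //; exact: le_trans t1.
have /andP[r0 _] := min_exponent01.
apply: (regular_dominated r0 _ min_tail_regular (reg i)).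
by rewrite lt_neqAle eq_sym ri min_exponent_le.
Qed.

End minimal_exponent.

(** * The truncated exponential moment at the Chernoff slope *)

Section truncated_moment_generating_function.
Context {R : realType}.

Lemma regular_linear (kappa : R) : 0 < kappa -> regular (fun t => kappa * t) 1.
Proof.
move=> k0; split.
  apply: eventually_R_imp (eventually_R_le 1) => t t1.
  have t0 : 0 < t := lt_le_trans ltr01 t1.
  by split => [|x _]; [exact: mulr_gt0|rewrite -mulrA -[leRHS]mulrA [x * t]mulrC].
move=> c e c0 e0; apply: eventually_R_imp (eventually_R_le 1) => t t1.
have t0 : 0 < t := lt_le_trans ltr01 t1.
rewrite powRr1; last exact: ltW.
have kt : 0 < kappa * t by exact: mulr_gt0.
by rewrite (mulrCA kappa) !ler_pM2r//; apply/andP; split; lra.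
Qed.

Lemma regular_little_o (g : R -> R) r (kappa : R) : 0 < r < 1 -> regular g r ->
  0 < kappa -> eventually_R (fun t => g t <= kappa * t).
Proof.
move=> /andP[r0 r1] rg k0.
exact: (regular_dominated r0 r1 rg (regular_linear k0)).
Qed.

Lemma sum_half_powers_le (K n : nat) :
  \sum_(K <= k < n) (1 / 2 : R) ^+ k <= 2 - 2 * (1 / 2) ^+ n.
Proof.
elim: n => [|n IH]; first by rewrite big_geq// expr0; lra.
have [Kn|nK] := leqP K n; first by rewrite big_nat_recr//= exprS; lra.
have h1 : (1 / 2 : R) ^+ n.+1 <= 1 by rewrite exprn_ile1//; lra.
by rewrite big_geq//; lra.
Qed.

Lemma expRN1_le_half : expR (- 1) <= (1 / 2 : R).
Proof.
rewrite expRN -div1r ler_pdivrMr ?expR_gt0//.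
by have := expR_ge1Dx (1 : R); lra.
Qed.

Context d (T : measurableType d) (Q : probability T R) (Y : {mfun T >-> R}).
Variables (g : R -> R) (r e : R).
Hypotheses (r01 : 0 < r < 1) (reg : regular g r) (e01 : 0 < e < 1 / 2).
Hypothesis tail : eventually_R (fun t =>
  Q [set u | (t <= Y u)%R] <= (expR (- ((1 - e) * g t)))%:E)%E.

Let c := 1 + e.

Let c1 : 1 < c. Proof. by have /andP[e0 _] := e01; rewrite /c ltrDl. Qed.

(** [Y] is cut into blocks c^k <= Y < c^(k+1). On such a block the truncated exponential is at most
    exp((1-2e) c g(c^k)), a bound free of z, so one K serves all truncation levels. *)
Let blocks (eta : R) : 0 < eta -> exists K,
  (forall k, (K <= k)%N -> 0 < g (c ^+ k) /\
     (forall t, c ^+ k <= t -> g t * c ^+ k <= g (c ^+ k) * t)) /\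
  forall n, (\sum_(K <= k < n) (expR ((1 - 2 * e) * c * g (c ^+ k)))%:E *
     Q [set u | (c ^+ k <= Y u)%R] <= eta%:E)%E.
Proof.
move=> eta0; have /andP[r0 _] := r01; have /andP[e0 e1] := e01.
have [q q1 hq] := regular_ratio_gt reg r0 c1.
have [K hK] := eventually_grid c1 ltr01 (eventually_R_and tail
  (eventually_R_and reg.1 hq)).
have gK k : (K <= k)%N -> 0 < g (c ^+ k) by move=> /hK[_ [[]]]; rewrite mulr1.
have qK k : (K <= k)%N -> q * g (c ^+ k) <= g (c ^+ k.+1).
  by move=> /hK[_ [_]]; rewrite mulr1 exprS.
(* The excess of the tail exponent over the weight: (1-e) - (1-2e)(1+e) = 2 e^2. *)
pose delta := 2 * e ^+ 2; have d0 : 0 < delta by rewrite mulr_gt0// exprn_gt0.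
have dq0 : 0 < delta * (q - 1) by rewrite mulr_gt0// subr_gt0.
have [K1 [KK1 hK1]] := eventually_ge_of_ratio (2 / (delta * (q - 1))) q1 gK qK.
(* Beyond K2 a block contributes at most (eta/2) exp(-k) <= (eta/2) 2^(-k), and these terms sum to
   at most eta. *)
have [K2 [K12 hK2]] : exists K2, (K1 <= K2)%N /\ forall k, (K2 <= k)%N ->
    - ln (eta / 2) <= delta * g (c ^+ k) - k%:R.
  apply: (@eventually_ge_of_increments _
    (fun k => delta * g (c ^+ k) - k%:R) 1) => // k K1k.
  have := hK1 k K1k; rewrite ler_pdivrMr// => h.
  have := qK k (leq_trans KK1 K1k); rewrite -natr1; nra.
have KK2 : (K <= K2)%N := leq_trans KK1 K12.
exists K2; split => [k K2k|n].
  have [_ [[gk0 gmono] _]] := hK k (leq_trans KK2 K2k).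
  by rewrite mulr1 in gk0 gmono.
apply: (@le_trans _ _ (\sum_(K2 <= k < n) (eta / 2 * (1 / 2) ^+ k)%:E)%E).
  rewrite big_seq [leRHS]big_seq; apply: lee_sum => k.
  rewrite mem_index_iota => /andP[K2k _]; have [tk _] := hK k (leq_trans KK2 K2k).
  rewrite mulr1 in tk.
  apply: (@le_trans _ _ ((expR ((1 - 2 * e) * c * g (c ^+ k)))%:E *
      (expR (- ((1 - e) * g (c ^+ k))))%:E)%E).
    by apply: lee_wpmul2l => //; rewrite lee_fin expR_ge0.
  rewrite -EFinM lee_fin -expRD.
  have -> : (1 - 2 * e) * c * g (c ^+ k) + - ((1 - e) * g (c ^+ k)) =
      - (delta * g (c ^+ k)) by rewrite /c /delta; ring.
  apply: (@le_trans _ _ (expR (ln (eta / 2) - k%:R))).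
    by rewrite ler_expR; have := hK2 k K2k; lra.
  rewrite expRD lnK ?posrE ?divr_gt0//.
  apply: ler_wpM2l; first by rewrite divr_ge0// ltW.
  rewrite -[X in - X]mulr1 -mulrN expRM_natl.
  by apply: lerXn2r; rewrite ?nnegrE ?expR_ge0// expRN1_le_half.
rewrite sumEFin lee_fin -mulr_sumr -[leRHS](@divfK _ 2)//.
apply: ler_wpM2l; first by rewrite divr_ge0// ltW.
apply: le_trans (sum_half_powers_le _ _) _.
by rewrite lerBlDr lerDl mulr_ge0// exprn_ge0.
Qed.

(** Below c^K the exponential is at most exp(s c^K). On a later block, g(z)/z <= g(c^k)/c^k turns s
    c^(k+1) into (1-2e) c g(c^k), the weight of [blocks]. *)
Lemma truncated_mgf_le (eta : R) : 0 < eta -> exists2 B, 0 < B &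
  eventually_R (fun z => (\int[Q]_u (truncated_exp ((1 - 2 * e) * g z / z) z (Y u))%:E
    <= (expR ((1 - 2 * e) * g z / z * B) + eta)%:E)%E).
Proof.
move=> eta0; have [K [gK sumK]] := blocks eta0; have /andP[e0 e1] := e01.
have c0 : 0 < c := lt_trans ltr01 c1.
have ck0 k : 0 < c ^+ k by rewrite exprn_gt0.
exists (c ^+ K) => //.
apply: eventually_R_imp (eventually_R_and reg.1 (eventually_R_le (c ^+ K))) => z.
move=> [[gz0 _] Kz]; have z0 : 0 < z := lt_le_trans (ck0 K) Kz.
have e2 : 0 < 1 - 2 * e by lra.
set s := _ * g z / z; have s0 : 0 < s by rewrite divr_gt0// mulr_gt0.
have [n0 [_ /andP[_ zn]]] := geometric_grid c1 Kz; pose n := n0.+1.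
pose w k := expR ((1 - 2 * e) * c * g (c ^+ k)).
have mge k : measurable [set u | c ^+ k <= Y u].
  rewrite (_ : [set _ | _] = Y @^-1` `[c ^+ k, +oo[%classic).
    by rewrite -[X in measurable X]setTI; exact: measurable_funP.
  by apply/seteqP; split => u /=; rewrite in_itv /= andbT.
have mtr : measurable_fun setT (fun u => truncated_exp s z (Y u)).
  by apply: measurableT_comp; [exact: measurable_truncated_exp|exact: measurable_funP].
have mw k : measurable_fun setT (fun u => (w k * \1_[set u | c ^+ k <= Y u] u)).
  by apply: measurable_funM => //; exact: measurable_indic.
have w0 k u : 0 <= w k * \1_[set u | c ^+ k <= Y u] u.
  by rewrite mulr_ge0 ?expR_ge0.
apply: (@le_trans _ _ (\int[Q]_u ((expR (s * c ^+ K))%:E +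
   (\sum_(K <= k < n) w k * \1_[set u | c ^+ k <= Y u] u)%:E))%E).
  apply: ge0_le_integral => //.
  - by move=> u _; rewrite lee_fin truncated_exp_ge0.
  - exact/measurable_EFinP.
  - apply: emeasurable_funD; apply/measurable_EFinP; first exact: measurable_cst.
    by apply: measurable_sum.
  move=> u _; rewrite -EFinD lee_fin /truncated_exp indicE.
  have [/set_mem/= Yz|_] := boolP (Y u \in _); last first.
    by rewrite mulr0 addr_ge0 ?expR_ge0 ?sumr_ge0.
  rewrite mulr1; have [YK|KY] := ltP (Y u) (c ^+ K).
    apply: (@le_trans _ _ (expR (s * c ^+ K))); first by rewrite ler_expR ler_wpM2l ?ltW.
    by rewrite lerDl sumr_ge0.
  have [k [Kk /andP[ckY Yck]]] := geometric_grid c1 KY.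
  have kn : (k < n)%N.
    rewrite ltnNge; apply/negP => nk; have : c ^+ n <= c ^+ k.
      by rewrite ler_weXn2l// ltW.
    by rewrite leNgt (le_lt_trans ckY)// (lt_trans Yz).
  rewrite (bigD1_seq k) ?mem_index_iota ?Kk ?iota_uniq//= indicE mem_set// mulr1 addrCA.
  apply: ler_wpDr; first by rewrite addr_ge0 ?expR_ge0 ?sumr_ge0.
  rewrite ler_expR; have [gk0 gmono] := gK k Kk.
  have := gmono z (le_trans ckY (ltW Yz)) => gz.
  apply: (@le_trans _ _ (s * c ^+ k.+1)); first by rewrite ler_wpM2l ?ltW.
  rewrite /s exprS mulrAC ler_pdivrMr// -!mulrA ler_wpM2l ?(ltW e2)//.
  by rewrite mulrCA ler_wpM2l ?(ltW c0).
rewrite ge0_integralD//; first last.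
- by apply/measurable_EFinP; apply: measurable_sum.
- by move=> u _; rewrite lee_fin sumr_ge0.
rewrite EFinD; apply: leeD.
  have -> : (\int[Q]_u (expR (s * c ^+ K))%:E = (expR (s * c ^+ K))%:E * Q setT)%E.
    by rewrite -integral_cst.
  by rewrite probability_setT mule1.
apply: le_trans (sumK n).
under eq_integral do rewrite -sumEFin.
rewrite ge0_integral_sum//; first last.
- by move=> k u _; rewrite lee_fin.
- by move=> k; exact/measurable_EFinP.
rewrite big_seq [leRHS]big_seq; apply: lee_sum => k _.
under eq_integral do rewrite EFinM.
rewrite ge0_integralZl//; first last.
- by rewrite lee_fin expR_ge0.
- exact/measurable_EFinP/measurable_indic.
by rewrite integral_indic// setIT.
Qed.

(** The slope tends to 0 because g(z) = o(z), so exp(s B) <= 1 + eta/2 for large z, and 1 + eta <=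
    exp(eta). *)
Lemma truncated_mgf_small (eta : R) : 0 < eta ->
  eventually_R (fun z => (\int[Q]_u (truncated_exp ((1 - 2 * e) * g z / z) z (Y u))%:E
    <= (expR eta)%:E)%E).
Proof.
move=> eta0; have eta2 : 0 < eta / 2 by lra.
have [B B0 hB] := truncated_mgf_le eta2.
have l0 : 0 < ln (1 + eta / 2) by rewrite ln_gt0; lra.
have k0 : 0 < ln (1 + eta / 2) / B by rewrite divr_gt0.
apply: eventually_R_imp (eventually_R_and hB (eventually_R_and (eventually_R_and
  (eventually_R_le 1) reg.1) (regular_little_o r01 reg k0))).
move=> z [hz [[z1 [gz _]] gk]]; have z0 : 0 < z := lt_le_trans ltr01 z1.
apply: le_trans hz _; rewrite lee_fin; apply: le_trans (expR_ge1Dx _).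
rewrite [eta in leRHS](splitr eta) addrA lerD2r.
rewrite -[leRHS]lnK ?posrE; last by lra.
rewrite ler_expR -ler_pdivlMr// ler_pdivrMr//; apply: le_trans gk.
have /andP[e0 e1] := e01.
by rewrite ler_piMl ?ltW//; lra.
Qed.

End truncated_moment_generating_function.

(** * Growth of the population *)

Section perron_frobenius.
Context {R : realType} {d : nat}.
Variables (M : 'M[R]_d.+1) (rho : R).
Hypothesis M0 : forall i j, 0 <= M i j.
Hypothesis PF : perron_frobenius_eigenvalue M rho.

Local Notation C := (R[i]).
Local Notation k := (real_complex R).

(* Peeling one root of the characteristic polynomial: the iterates x_n = A^n U obey
   x_(n+1) = z x_n + A^n (A - z) U. *)
Let growth_of_factor (A U : 'M[C]_d.+1) (z : C) (s C1 : R) :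
  0 <= rho -> rho < s -> `|z| <= k rho -> 0 <= C1 ->
  (forall n i j, `|(A ^+ n *m ((A - z%:M) *m U)) i j| <= k (C1 * s ^+ n)) ->
  exists2 C2 : R, 0 <= C2 & forall n i j, `|(A ^+ n *m U) i j| <= k (C2 * s ^+ n).
Proof.
move=> rho0 rs zr C10 hW.
have s0 : 0 < s := le_lt_trans rho0 rs.
have sr : 0 < s - rho by rewrite subr_gt0.
have [cn [cnE cn0]] : exists cn : C -> R,
    (forall x, k (cn x) = `|x|) /\ forall x, 0 <= cn x.
  exists (fun x => complex.Re `|x|).
  have kRe (x : C) : k (complex.Re `|x|) = `|x| by exact: RRe_real (normr_real x).
  by split => // x; have := normr_ge0 x; rewrite -kRe => h; rewrite -(lecR 0).
pose U1 : R := \sum_i \sum_j cn (U i j).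
have U10 : 0 <= U1 by rewrite sumr_ge0// => i _; rewrite sumr_ge0.
(* [U1] covers n = 0, and C1/(s - rho) solves rho C + C1 = s C, so the bound propagates through the
   recursion. *)
exists (U1 + C1 / (s - rho)); first by rewrite addr_ge0// divr_ge0// ltW.
elim=> [|n IH] i j.
  rewrite expr0 mul1mx expr0 mulr1 -cnE lecR.
  apply: (@le_trans _ _ U1); last by rewrite lerDl divr_ge0// ltW.
  rewrite /U1 (bigD1 i)//= (bigD1 j)//= -addrA lerDl addr_ge0//.
    by rewrite sumr_ge0.
  by rewrite sumr_ge0// => ? _; rewrite sumr_ge0.
have -> : A ^+ n.+1 *m U = z *: (A ^+ n *m U) + A ^+ n *m ((A - z%:M) *m U).
  rewrite mulmxBl mulmxBr mul_scalar_mx -scalemxAr addrCA subrr addr0.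
  by rewrite mulmxA exprSr.
rewrite mxE [X in X + _]mxE; apply: le_trans (ler_normD _ _) _.
rewrite normrM -cnE -(cnE (_ i j)) -[X in _ + X]cnE -rmorphM -rmorphD lecR exprS.
have {}IH : cn ((A ^+ n *m U) i j) <= (U1 + C1 / (s - rho)) * s ^+ n.
  by rewrite -lecR cnE.
have {}hW : cn ((A ^+ n *m ((A - z%:M) *m U)) i j) <= C1 * s ^+ n.
  by rewrite -lecR cnE.
have {}zr : cn z <= rho by rewrite -lecR cnE.
apply: (@le_trans _ _ (rho * ((U1 + C1 / (s - rho)) * s ^+ n) + C1 * s ^+ n)).
  by apply: lerD => //; apply: ler_pM.
have sn : 0 <= s ^+ n by rewrite exprn_ge0// ltW.
have E : C1 = C1 / (s - rho) * (s - rho) by rewrite divfK// gt_eqF.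
rewrite mulrA -mulrDl mulrA ler_wpM2r//.
rewrite [X in _ + X]E; have : U1 * rho <= U1 * s by rewrite ler_wpM2l// ltW.
by set X := C1 / (s - rho); move=> h; nra.
Qed.

Let growth_of_annihilated (A U : 'M[C]_d.+1) (rs : seq C) (s : R) :
  0 <= rho -> rho < s -> (forall z, z \in rs -> `|z| <= k rho) ->
  horner_mx A (\prod_(z <- rs) ('X - z%:P)) *m U = 0 ->
  exists2 C2 : R, 0 <= C2 & forall n i j, `|(A ^+ n *m U) i j| <= k (C2 * s ^+ n).
Proof.
move=> rho0 rs'; elim: rs U => [|z rs IH] U hz.
  rewrite big_nil rmorph1 mul1mx => ->; exists 0 => // n i j.
  by rewrite mulmx0 mxE normr0 mul0r.
rewrite big_cons mulrC rmorphM/= rmorphB/= horner_mx_X horner_mx_C -mulmxA.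
move=> /IH[|C1 C10 hC1].
  by move=> y yrs; apply: hz; rewrite inE yrs orbT.
by apply: growth_of_factor hC1 => //; apply: hz; rewrite mem_head.
Qed.

(** Over the complex numbers the characteristic polynomial splits and annihilates the matrix by
    Cayley-Hamilton. Its roots, all of modulus at most rho, are peeled off one by one down to the
    zero matrix. *)
Lemma mxpow_growth s : 0 <= rho -> rho < s ->
  exists2 C2 : R, 0 <= C2 & forall n i j, (M ^+ n) i j <= C2 * s ^+ n.
Proof.
move=> rho0 rs; pose A := map_mx k M.
have [sq Esq] := closed_field_poly_normal (char_poly A).
have mon : lead_coef (char_poly A) = 1 by exact/eqP/(char_poly_monic A).
rewrite mon scale1r in Esq.
have [||C2 C20 hC2] := @growth_of_annihilated A 1%:M sq s rho0 rs.
- move=> z zs; apply: PF.2; rewrite eigenvalue_root_char Esq root_prod_XsubC//.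
- by rewrite -Esq mulmx1 Cayley_Hamilton.
exists C2 => // n i j; have := hC2 n i j.
have -> : (A ^+ n *m 1%:M) i j = k ((M ^+ n) i j).
  by rewrite mulmx1 /A -(rmorphXn (map_mx k)) mxE.
move=> h; rewrite -lecR; apply: le_trans h; apply: real_ler_norm.
by apply/complex_realP; eexists.
Qed.

(** If M v = rho v, the triangle inequality gives M|v| >= rho |v|. Applying M^l, which commutes with
    M, keeps this inequality and makes the vector positive in every coordinate. *)
Lemma positive_superharmonic l : (forall i j, 0 < (M ^+ l) i j) ->
  exists u : 'I_d.+1 -> R, (forall i, 0 < u i) /\
    forall i, rho * u i <= \sum_j M i j * u j.
Proof.
(* [eigenvalue] refers to row vectors; a column eigenvector comes from the transpose, which has the
   same characteristic polynomial. *)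
move=> Ml; have : eigenvalue M^T rho.
  have := PF.1; rewrite !eigenvalue_root_char.
  suff -> : char_poly M^T = char_poly M by [].
  rewrite /char_poly -det_tr; congr (\det _); apply/matrixP => i j.
  by rewrite !mxE eq_sym.
move=> /eigenvalueP[v vM v0].
have Mv i : \sum_j M i j * v 0 j = rho * v 0 i.
  have := congr1 (fun B : 'rV_d.+1 => B 0 i) vM; rewrite !mxE => <-.
  by apply: eq_bigr => j _; rewrite mxE mulrC.
have [j0 vj0] : exists j, v 0 j != 0.
  apply/existsP; apply: contraNT v0; rewrite negb_exists => /forallP h.
  by apply/eqP/rowP => j; rewrite mxE; apply/eqP; have := h j; rewrite negbK.
have Mabs i : rho * `|v 0 i| <= \sum_j M i j * `|v 0 j|.
  apply: (@le_trans _ _ `|rho * v 0 i|).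
    by rewrite normrM ler_wpM2r// ler_norm.
  rewrite -Mv; apply: le_trans (ler_norm_sum _ _ _) _.
  by apply: ler_sum => j _; rewrite normrM ger0_norm.
exists (fun i => \sum_j (M ^+ l) i j * `|v 0 j|); split => i.
  rewrite (bigD1 j0)//= ltr_pwDl// ?sumr_ge0//.
    by rewrite mulr_gt0// normr_gt0.
  by move=> j _; rewrite mulr_ge0// ltW.
rewrite mulr_sumr; under [leRHS]eq_bigr do rewrite mulr_sumr.
rewrite exchange_big/=.
have -> : \sum_j \sum_i0 M i i0 * ((M ^+ l) i0 j * `|v 0 j|) =
    \sum_j (M ^+ l) i j * \sum_k M j k * `|v 0 k|.
  transitivity (\sum_j (M ^+ l.+1) i j * `|v 0 j|).
    apply: eq_bigr => j _; rewrite exprS mxE mulr_suml.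
    by apply: eq_bigr => k' _; rewrite mulrA.
  under [RHS]eq_bigr do rewrite mulr_sumr.
  rewrite exchange_big/=; apply: eq_bigr => j _; rewrite exprSr mxE mulr_suml.
  by apply: eq_bigr => k' _; rewrite mulrA.
by apply: ler_sum => j _; rewrite mulrCA ler_wpM2l// ltW.
Qed.

End perron_frobenius.

(** * First-order bounds for Laplace transforms *)

Section laplace_transform.
Context {R : realType} {disp : measure_display} {Omega : measurableType disp}.
Variable Q : probability Omega R.

(** Through this bound an x log x moment yields a finite mean. *)
Lemma le1_xlnx (x : nat) : x%:R <= 1 + x%:R * ln x%:R :> R.
Proof.
case: x => [|x]; first by rewrite mul0r addr0.
have x0 : 0 < x.+1%:R :> R by [].
have := @ln_le_subr1 R x.+1%:R^-1; rewrite invr_gt0 => /(_ x0).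
rewrite lnV ?posrE// => h.
rewrite -lerBlDl -[leLHS]opprK opprB -[leRHS]opprK lerN2 -mulrN.
apply: (@le_trans _ _ (x.+1%:R * (x.+1%:R^-1 - 1))); first by rewrite ler_wpM2l.
by rewrite mulrBr mulr1 divff// gt_eqF.
Qed.

Lemma fin_num_mean_of_xlnx (Y : Omega -> nat) :
  measurable_fun setT (fun w => (Y w)%:R : R) ->
  ('E_Q[fun w => ((Y w)%:R * ln (Y w)%:R)%R] < +oo)%E ->
  ((\int[Q]_w ((Y w)%:R : R)%:E) \is a fin_num)%E.
Proof.
move=> mY; rewrite unlock => fY.
have mYE : measurable_fun setT (fun w => ((Y w)%:R : R)%:E) by exact/measurable_EFinP.
have mlY : measurable_fun setT (fun w => (Y w)%:R * ln (Y w)%:R : R).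
  by apply: measurable_funM => //; exact: measurableT_comp.
have lY0 w : 0 <= (Y w)%:R * ln (Y w)%:R :> R.
  by case: (Y w) => [|y]; rewrite ?mul0r// mulr_ge0// ln_ge0// ler1n.
rewrite ge0_fin_numE; last by apply: integral_ge0 => w _; rewrite lee_fin.
apply: (@le_lt_trans _ _ (\int[Q]_w (1 + ((Y w)%:R * ln (Y w)%:R)%:E))%E).
  apply: ge0_le_integral => //.
  - by apply: emeasurable_funD => //; exact/measurable_EFinP.
  - by move=> w _; rewrite -EFinD lee_fin le1_xlnx.
rewrite ge0_integralD//.
- by rewrite integral_cst// [X in (_ * X)%E]probability_setT mule1 lte_add_pinfty// ltry.
- by move=> w _; rewrite lee_fin.
- exact/measurable_EFinP.
Qed.

Lemma expRN_le (x delta : R) : 0 <= x -> x <= delta -> expR (- x) <= 1 - x * (1 - delta).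
Proof.
move=> x0 xd; have [d1|d1] := leP 1 delta.
  apply: (@le_trans _ _ 1); first by rewrite -expR0 ler_expR oppr_le0.
  by rewrite lerDl oppr_ge0 mulr_ge0_le0// subr_le0.
rewrite expRN -[leRHS]invrK lef_pV2 ?posrE ?expR_gt0//; last first.
  by rewrite invr_gt0 subr_gt0; nra.
apply: le_trans (expR_ge1Dx x).
have y0 : 0 < 1 - x * (1 - delta) by nra.
rewrite -[leLHS]mul1r ler_pdivrMr//.
have : x * (x * (1 - delta)) <= x * delta by rewrite ler_wpM2l//; nra.
nra.
Qed.

Lemma truncated_mean_gt (Y : Omega -> R) m a : measurable_fun setT Y ->
  (forall w, 0 <= Y w) -> (\int[Q]_w (Y w)%:E = m%:E)%E -> a < m ->
  exists K : nat, (a%:E <= \int[Q]_w (Num.min (Y w) K%:R)%:E)%E.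
Proof.
move=> mY Y0 Ym am.
have h : (\int[Q]_w (Num.min (Y w) n%:R)%:E @[n --> \oo] --> \int[Q]_w (Y w)%:E)%E.
  have := @cvg_monotone_convergence _ _ _ Q setT measurableT
    (fun n w => (Num.min (Y w) n%:R)%:E).
  have E w : limn (fun n : nat => (Num.min (Y w) n%:R)%:E) = (Y w)%:E.
    apply/cvg_lim => //; apply/fine_cvgP; split; first exact: nearW.
    apply: cvg_near_cst; near=> n; rewrite /=; apply/min_idPl.
    by near: n; exact: nbhs_infty_ger.
  move=> H.
  have -> : (\int[Q]_w (Y w)%:E = \int[Q]_w limn (fun n : nat => (Num.min (Y w) n%:R)%:E))%E.
    by apply: eq_integral => w _; rewrite E.
  apply: H => [n|n w _|w _ n n' nn'].
  - by apply/measurable_EFinP; apply: measurable_minr.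
  - by rewrite lee_fin le_min Y0 ler0n.
  - by rewrite lee_fin le_min ge_min lexx/= ge_min orbC (ler_nat R n n') nn'.
move: h; rewrite Ym => /fine_cvgP[fin /cvgr_gt h].
have [K _ /(_ K (leqnn K)) [K1 K2]] : \forall n \near \oo,
    ((\int[Q]_w (Num.min (Y w) n%:R)%:E)%E \is a fin_num) /\
    a < fine (\int[Q]_w (Num.min (Y w) n%:R)%:E)%E.
  by near=> n; split; near: n => //; exact: h.
by exists K; rewrite -(fineK K1) lee_fin ltW.
Unshelve. all: by end_near. Qed.

(** Without a second moment the expansion at 0 is made for Y truncated at [K], where monotone
    convergence keeps (1 - eta/2) m of the mean. Linearizing the exponential costs another factor 1
    - eta/2, and (1 - eta/2)^2 >= 1 - eta. *)
Lemma laplace_le_mean (Y : Omega -> R) (m eta : R) : measurable_fun setT Y ->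
  (forall w, 0 <= Y w) -> (\int[Q]_w (Y w)%:E = m%:E)%E -> 0 < eta ->
  exists2 theta0 : R, 0 < theta0 & forall theta : R, 0 <= theta -> theta <= theta0 ->
    (\int[Q]_w (expR (- (theta * Y w)))%:E <= (expR (- (theta * ((1 - eta) * m))))%:E)%E.
Proof.
move=> mY Y0 Ym eta0.
have m0 : 0 <= m.
  by rewrite -lee_fin -Ym; apply: integral_ge0 => w _; rewrite lee_fin.
have cst1 : (\int[Q]_w (1 : R)%:E = 1)%E.
  by rewrite integral_cst// [X in (_ * X)%E]probability_setT mule1.
have triv (theta : R) : 0 <= theta -> (1 - eta) * m <= 0 ->
    (\int[Q]_w (expR (- (theta * Y w)))%:E <= (expR (- (theta * ((1 - eta) * m))))%:E)%E.
  move=> t0 h; apply: (@le_trans _ _ 1%E).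
    rewrite -cst1; apply: ge0_le_integral => //.
    - apply/measurable_EFinP; apply: measurableT_comp => //.
      by apply: measurableT_comp => //; exact: measurable_funM.
    - by move=> w _; rewrite lee_fin -expR0 ler_expR oppr_le0 mulr_ge0.
  by rewrite lee_fin -[leLHS]expR0 ler_expR oppr_ge0 mulr_ge0_le0.
have [m00|] := eqVneq m 0; first by exists 1 => // theta t0 _; apply: triv => //; rewrite m00 mulr0.
move=> mn0; have {mn0} m00 : 0 < m by rewrite lt_neqAle eq_sym mn0.
have [eta1|eta1] := leP 1 eta.
  by exists 1 => // theta t0 _; apply: triv => //; rewrite mulr_le0_ge0// subr_le0.
have [|K hK] := @truncated_mean_gt Y m ((1 - eta / 2) * m) mY Y0 Ym.
  by rewrite gtr_pMl//; lra.
(* This makes theta K <= eta/2, the range where [expRN_le] applies; the added 1 covers K = 0. *)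
exists (eta / 2 / (K%:R + 1)); first by rewrite !divr_gt0// ltr_wpDl.
move=> theta t0 tle.
have tK : theta * K%:R <= eta / 2.
  apply: (@le_trans _ _ (theta * (K%:R + 1))); first by rewrite ler_wpM2l// lerDl.
  by rewrite -ler_pdivlMr// ltr_wpDl.
have mmin : measurable_fun setT (fun w => Num.min (Y w) K%:R) by exact: measurable_minr.
have min0 w : 0 <= Num.min (Y w) K%:R by rewrite le_min Y0 ler0n.
have minK w : Num.min (Y w) K%:R <= K%:R by rewrite ge_min lexx orbT.
set e2 := eta / 2 in hK tle tK *.
have e20 : 0 < e2 by rewrite divr_gt0.
have e21 : e2 < 1 / 2 by rewrite /e2; lra.
have Emin : (\int[Q]_w (expR (- (theta * Y w)))%:E +
    (theta * (1 - e2))%:E * \int[Q]_w (Num.min (Y w) K%:R)%:E <= 1)%E.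
  have mm0 : measurable_fun setT (fun w => (Num.min (Y w) K%:R)%:E).
    exact/measurable_EFinP.
  rewrite -ge0_integralZl//; last first.
  - by rewrite lee_fin mulr_ge0//; lra.
  - by move=> w _; rewrite lee_fin.
  have me : measurable_fun setT (fun w => (expR (- (theta * Y w)))%:E).
    apply/measurable_EFinP; apply: measurableT_comp => //.
    by apply: measurableT_comp => //; exact: measurable_funM.
  have mm : measurable_fun setT (fun w => ((theta * (1 - e2))%:E * (Num.min (Y w) K%:R)%:E)%E).
    by apply: measurable_funeM; exact/measurable_EFinP.
  rewrite -ge0_integralD//; last first.
  - by move=> w _; rewrite -EFinM lee_fin mulr_ge0// mulr_ge0//; lra.
  rewrite -cst1; apply: ge0_le_integral => //.
  - move=> w _; rewrite adde_ge0// ?lee_fin ?expR_ge0// mulr_ge0// mulr_ge0//; lra.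
  - exact: emeasurable_funD.
  - move=> w _; rewrite -EFinM -EFinD lee_fin.
    have : expR (- (theta * Y w)) <= expR (- (theta * Num.min (Y w) K%:R)).
      by rewrite ler_expR lerN2 ler_wpM2l// ge_min lexx.
    have := @expRN_le (theta * Num.min (Y w) K%:R) e2.
    rewrite mulr_ge0// => /(_ isT).
    have : theta * Num.min (Y w) K%:R <= e2 by apply: le_trans tK; rewrite ler_wpM2l.
    by move=> h /(_ h); lra.
have le1 : (\int[Q]_w (expR (- (theta * Y w)))%:E + (theta * (1 - e2) * ((1 - e2) * m))%:E <= 1)%E.
  apply: le_trans Emin; apply: leeD2l; rewrite EFinM; apply: lee_wpmul2l => //.
  by rewrite lee_fin mulr_ge0//; lra.
apply: (@le_trans _ _ (1 - (theta * (1 - e2) * ((1 - e2) * m)))%:E).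
  by rewrite EFinB leeBrDr.
rewrite lee_fin; apply: le_trans (expR_ge1Dx _).
rewrite lerD2l lerN2 -mulrA ler_wpM2l// mulrA ler_wpM2r//.
rewrite /e2; nra.
Qed.

End laplace_transform.

(** * Exponential lower bounds for the number of particles of a type *)

Section population_growth.
Context {R : realType} {d : nat} {disp disp0 : measure_display}
  {Omega : measurableType disp} {Omega0 : measurableType disp0}.
Variables (P : probability Omega R) (Q : probability Omega0 R).
Variables (N0 : 'I_d.+1 -> 'I_d.+1 -> {mfun Omega0 >-> nat})
  (N : label d.+1 -> 'I_d.+1 -> {mfun Omega >-> nat})
  (X : label d.+1 -> {mfun Omega >-> R}) (root : 'I_d.+1).
Hypothesis indep : mutually_independent P (driving_events N X).
Hypothesis law_offspring : forall v (k : 'I_d.+1 -> nat),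
  P [set w | forall j, N v j w = k j] =
  Q [set u | forall j, N0 (ptype root v) j u = k j].
Variable M : 'M[R]_d.+1.
Hypothesis meanM : forall i j, (\int[Q]_u ((N0 i j u)%:R)%:E = (M i j)%:E)%E.

Local Notation act c := (fun i => \sum_j M i j * c j).
Local Notation wgt := (weight root).

Let M0 i j : 0 <= M i j.
Proof. by rewrite -lee_fin -meanM; apply: integral_ge0 => u _; rewrite lee_fin. Qed.

Let act_ge0 (c : 'I_d.+1 -> R) : (forall i, 0 <= c i) -> forall i, 0 <= act c i.
Proof. by move=> c0 i; apply: sumr_ge0 => j _; rewrite mulr_ge0. Qed.

Let measurable_N0 i j : measurable_fun setT (fun u => (N0 i j u)%:R : R).
Proof. by apply: measurableT_comp => //; exact: measurable_funP. Qed.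

Let measurable_combination (c : 'I_d.+1 -> R) i :
  measurable_fun setT (fun u => \sum_j c j * (N0 i j u)%:R : R).
Proof. by apply: measurable_sum => j; exact: measurable_funM. Qed.

Lemma mean_combination (c : 'I_d.+1 -> R) i : (forall i, 0 <= c i) ->
  (\int[Q]_u (\sum_j c j * (N0 i j u)%:R)%:E = (act c i)%:E)%E.
Proof.
move=> c0; under eq_integral do rewrite -sumEFin.
rewrite ge0_integral_sum//; last 2 first.
- by move=> j; apply/measurable_EFinP; exact: measurable_funM.
- by move=> j u _; rewrite lee_fin mulr_ge0.
rewrite -sumEFin; apply: eq_bigr => j _.
under eq_integral do rewrite EFinM.
rewrite ge0_integralZl//; [|exact/measurable_EFinP|by rewrite lee_fin].
by rewrite meanM -EFinM mulrC.
Qed.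

(** The induction removes the last generation, so [c] becomes [M c] while the root type stays
    fixed. *)
Lemma mean_weight_generation (c : 'I_d.+1 -> R) n : (forall i, 0 <= c i) ->
  (\int[P]_w (wgt c (generation N n w))%:E <= (\sum_j (M ^+ n) root j * c j)%:E)%E.
Proof.
elim: n c => [|n IH] c c0.
  under eq_integral do rewrite /weight big_seq1.
  rewrite integral_cst// [X in (_ * X)%E]probability_setT mule1 lee_fin.
  rewrite (bigD1 root)//= expr0 mxE eqxx mul1r lerDl sumr_ge0// => j _.
  by rewrite mulr_ge0// mxE.
apply: le_trans (mean_step indep law_offspring n c0 (c' := act c) _) _.
  by move=> i; rewrite mean_combination.
apply: le_trans (IH _ (act_ge0 c0)) _; rewrite lee_fin.
under eq_bigr do rewrite mulr_sumr.
rewrite exchange_big/=; apply: ler_sum => k _.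
by rewrite exprSr mxE mulr_suml ler_sum// => j _; rewrite mulrA.
Qed.

Local Notation Lam n c :=
  (\int[P]_w (expR (- wgt c (generation N n w)))%:E)%E.

Let measurable_exp_weight n (c : 'I_d.+1 -> R) :
  measurable_fun setT (fun w => (expR (- wgt c (generation N n w)))%:E).
Proof.
by apply/measurable_EFinP; exact: (measurable_fun_generation N n (fun g => expR (- wgt c g))).
Qed.

Let laplace_anti n (c c' : 'I_d.+1 -> R) : (forall i, c i <= c' i) ->
  (Lam n c' <= Lam n c)%E.
Proof.
move=> cc'; apply: ge0_le_integral => //.
by move=> w _; rewrite lee_fin ler_expR lerN2 ler_sum.
Qed.

Let laplace_small_step (c : 'I_d.+1 -> R) (eta : R) :
  (forall i, 0 <= c i) -> 0 < eta ->
  exists2 theta0 : R, 0 < theta0 & forall (theta : R) n, 0 <= theta -> theta <= theta0 ->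
    (Lam n.+1 (fun i => theta * c i) <=
     Lam n (fun i => theta * ((1 - eta) * act c i)))%E.
Proof.
move=> c0 eta0.
have /choice[th hth] : forall i, exists theta0 : R, 0 < theta0 /\
    forall theta : R, 0 <= theta -> theta <= theta0 ->
    (\int[Q]_u (expR (- (theta * \sum_j c j * (N0 i j u)%:R)))%:E <=
     (expR (- (theta * ((1 - eta) * act c i))))%:E)%E.
  move=> i.
  have [|t t0 ht] := @laplace_le_mean _ _ _ Q (fun u => \sum_j c j * (N0 i j u)%:R)
    (act c i) eta (measurable_combination c i) _ (mean_combination i c0) eta0.
    by move=> u; apply: sumr_ge0 => j _; rewrite mulr_ge0.
  by exists t.
exists (\big[Num.min/1]_i th i).
  by rewrite lt_bigmin// => i _; have [] := hth i.
move=> theta n t0 /bigmin_geP[_ tle].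
apply: (laplace_step indep law_offspring) => [i|i]; first by rewrite mulr_ge0.
under eq_integral => u _.
  under eq_bigr do rewrite -mulrA.
  rewrite -mulr_sumr; over.
by apply: (hth i).2 => //; exact: tle.
Qed.

(** Used with l such that M^l > 0, to replace the indicator of one type by a vector positive in
    every coordinate. *)
Let laplace_small_steps (c : 'I_d.+1 -> R) (eta : R) l :
  (forall i, 0 <= c i) -> 0 < eta -> eta < 1 ->
  exists2 theta0 : R, 0 < theta0 & forall (theta : R) n, 0 <= theta -> theta <= theta0 ->
    (Lam (n + l) (fun i => theta * c i) <=
     Lam n (fun i => theta * ((1 - eta) ^+ l * \sum_j (M ^+ l) i j * c j)))%E.
Proof.
move=> c0 eta0 eta1; elim: l c c0 => [|l IH] c c0.
  exists 1 => // theta n _ _; rewrite addn0.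
  rewrite (_ : (fun i => theta * ((1 - eta) ^+ 0 * _)) = fun i => theta * c i)//.
  apply/funext => i; rewrite expr0 mul1r (bigD1 i)//= expr0 mxE eqxx mul1r.
  by rewrite big1 ?addr0// => j ij; rewrite mxE eq_sym (negPf ij) mul0r.
have [t1 t10 h1] := laplace_small_step c0 eta0.
have [t2 t20 h2] := IH _ (act_ge0 c0).
exists (Num.min t1 t2); first by rewrite lt_min t10.
move=> theta n th0; rewrite le_min => /andP[tt1 tt2].
rewrite addnS; apply: le_trans (h1 theta (n + l)%N th0 tt1) _.
have -> : (fun i => theta * ((1 - eta) * act c i)) = fun i => (theta * (1 - eta)) * act c i.
  by apply/funext => i; rewrite mulrA.
apply: le_trans (h2 (theta * (1 - eta)) n _ _) _.
- by rewrite mulr_ge0//; lra.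
- by apply: le_trans tt2; rewrite ler_piMr//; lra.
rewrite (_ : (fun i => theta * (1 - eta) * _) = fun i =>
  theta * ((1 - eta) ^+ l.+1 * \sum_j (M ^+ l.+1) i j * c j))//.
apply/funext => i; rewrite -mulrA [in RHS]exprS -mulrA; congr (_ * (_ * (_ * _))).
under eq_bigr do rewrite mulr_sumr.
rewrite exchange_big/=; apply: eq_bigr => k _.
by rewrite exprSr mxE mulr_suml; apply: eq_bigr => j _; rewrite mulrA.
Qed.

Hypothesis survival : forall n, {ae P, forall w, generation N n w != [::]}.

(** With 1 - eta = lam/rho, one generation multiplies theta by lam as long as theta <= theta0. From
    theta0 lam^(-m), m generations reach theta0; each of the remaining n generations then gains a
    factor kappa. *)
Let laplace_decay (u : 'I_d.+1 -> R) (rho lam : R) : (forall i, 0 < u i) ->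
  (forall i, rho * u i <= act u i) -> 1 < lam -> lam < rho ->
  exists theta0 kappa : R, [/\ 0 < theta0, 0 < kappa < 1 & forall n m,
    (Lam (n + m) (fun i => theta0 * lam ^- m * u i) <= (kappa ^+ n)%:E)%E].
Proof.
move=> u0 hu lam1 lamrho.
have rho0 : 0 < rho by lra.
have lam0 : 0 < lam by lra.
have [|th0 th00 hth] := @laplace_small_step u (1 - lam / rho) (fun i => ltW (u0 i)).
  by rewrite subr_gt0 ltr_pdivrMr// mul1r.
have step theta n : 0 <= theta -> theta <= th0 ->
    (Lam n.+1 (fun i => theta * u i)%R <= Lam n (fun i => theta * lam * u i)%R)%E.
  move=> t0 tle; apply: le_trans (hth theta n t0 tle) _; apply: laplace_anti => i.
  rewrite -mulrA ler_wpM2l// opprB addrC subrK.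
  have -> : lam * u i = lam / rho * (rho * u i) by rewrite mulrA divfK// gt_eqF.
  by rewrite ler_wpM2l// divr_ge0// ltW.
pose umin := \big[Num.min/u ord0]_i u i.
have umin0 : 0 < umin by rewrite lt_bigmin.
have uminle i : umin <= u i by exact: bigmin_le_cond.
(* A nonempty generation has u-weight at least [umin], so passing from theta0 u to theta0 lam u
   costs at least this factor; survival enters here. *)
pose kap := expR (- (th0 * (lam - 1) * umin)).
have kap0 : 0 < kap by exact: expR_gt0.
have kap1 : kap < 1.
  by rewrite -expR0 ltr_expR oppr_lt0 !mulr_gt0// subr_gt0.
exists th0, kap; rewrite kap0 kap1; split => // n m.
have base k : (Lam k (fun i => th0 * u i)%R <= (kap ^+ k)%:E)%E.
  elim: k => [|k IH].
    rewrite expr0; under eq_integral do rewrite /weight big_seq1.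
    rewrite integral_cst// [X in (_ * X)%E]probability_setT mule1 lee_fin.
    by rewrite -expR0 ler_expR oppr_le0 mulr_ge0// ltW.
  apply: le_trans (step th0 k (ltW th00) (lexx _)) _.
  rewrite exprS EFinM; apply: (@le_trans _ _ (kap%:E * Lam k (fun i => th0 * u i)%R)%E); last first.
    by apply: lee_wpmul2l => //; rewrite lee_fin ltW.
  rewrite -ge0_integralZl//; last by rewrite lee_fin ltW.
  apply: ae_ge0_le_integral => //.
  - by move=> w _; rewrite -EFinM lee_fin mulr_ge0// ?expR_ge0// ltW.
  - by apply: measurable_funeM.
  apply: filterS (survival k) => w wn _.
  rewrite -EFinM lee_fin -expRD ler_expR -opprD lerN2.
  have -> : wgt (fun i => th0 * lam * u i) (generation N k w) =
      th0 * (lam - 1) * wgt u (generation N k w) + wgt (fun i => th0 * u i) (generation N k w).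
    by rewrite /weight mulr_sumr -big_split/=; apply: eq_bigr => v _; ring.
  rewrite lerD2r ler_wpM2l ?mulr_ge0 ?subr_ge0 ?(ltW th00) ?(ltW lam1)//.
  case: (generation N k w) wn => // v g _.
  by rewrite /weight big_cons ler_wpDr// sumr_ge0// => ? _; rewrite ltW.
elim: m => [|m IH]; first by rewrite addn0 expr0 invr1 mulr1; exact: base.
rewrite addnS; apply: le_trans (step _ _ _ _) _.
- by rewrite mulr_ge0 ?invr_ge0 ?exprn_ge0// ltW.
- by rewrite ler_piMr ?(ltW th00)// invf_le1 ?exprn_gt0// exprn_ege1// ltW.
rewrite (_ : th0 * lam ^- m.+1 * lam = th0 * lam ^- m)//.
by rewrite exprSr invfM -!mulrA mulVf ?mulr1// gt_eqF.
Qed.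

(** Markov's inequality for exp(1 - W/x), with W the weight. *)
Let prob_weight_le n (c : 'I_d.+1 -> R) (x : R) : 0 < x -> (forall i, 0 <= c i) ->
  (P [set w | wgt c (generation N n w) <= x]%R <=
   (expR 1)%:E * Lam n (fun i => x^-1 * c i)%R)%E.
Proof.
move=> x0 c0.
have mA : measurable [set w | wgt c (generation N n w) <= x].
  have := @measurable_fun_generation R _ _ _ N n (wgt c).
  move=> /(_ measurableT _ (measurable_itv `]-oo, x])); rewrite setTI.
  rewrite [X in measurable X -> _](_ : _ = [set w | wgt c (generation N n w) <= x])//.
rewrite -ge0_integralZl ?lee_fin ?expR_ge0//.
set A := [set w | _] in mA *.
have -> : (P A = \int[P]_w (\1_A w)%:E)%E by rewrite integral_indic// setIT.
apply: ge0_le_integral => //.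
- by apply/measurable_EFinP; exact: measurable_indic.
- by apply: measurable_funeM.
- move=> w _; rewrite -EFinM lee_fin -expRD indicE.
  case: (boolP (w \in _)) => [|_]; last exact: expR_ge0.
  rewrite inE /= => h; apply: (@le_trans _ _ (1 + (1 - wgt (fun i => x^-1 * c i) (generation N n w)))).
    rewrite lerDl subr_ge0 /weight -mulr_sumr mulrC ler_pdivrMr// mul1r; exact: h.
  exact: expR_ge1Dx.
Qed.

(** Write n = a + m + l. At scale mu^(-n), the last l generations turn the indicator of type j into
    a multiple of [u], the middle m raise the parameter to theta0 provided theta0 mu^n <= c0 lam^m,
    and the first a give kappa^a. Since lam > mu, the proviso leaves room for a to be a fixed
    fraction of n. *)
Lemma population_growth (u : 'I_d.+1 -> R) (rho mu : R) l j :
  (forall i, 0 < u i) -> (forall i, rho * u i <= act u i) ->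
  (forall i k, 0 < (M ^+ l) i k) -> 1 < mu -> mu < rho ->
  exists C beta : R, [/\ 0 <= C, 0 < beta < 1 & \forall n \near \oo,
    (P [set w | (count (fun v => ptype root v == j) (generation N n w))%:R <= mu ^+ n]%R
     <= (C * beta ^+ n)%:E)%E].
Proof.
move=> u0 hu Ml mu1 murho.
pose lam := (mu + rho) / 2.
have mulam : mu < lam by rewrite /lam; lra.
have lamrho : lam < rho by rewrite /lam; lra.
have mu0 : 0 < mu by lra.
have lam0 : 0 < lam by lra.
have lam1 : 1 < lam by lra.
have [th0 [kap [th00 /andP[kap0 kap1] decay]]] := laplace_decay u0 hu lam1 lamrho.
pose e i : R := (i == j)%:R.
have e0 i : 0 <= e i by exact: ler0n.
have [t1 t10 steps] := laplace_small_steps l e0 (eta := 2^-1) ltac:(lra) ltac:(lra).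
have Mle i : \sum_k (M ^+ l) i k * e k = (M ^+ l) i j.
  rewrite (bigD1 j)//= /e eqxx mulr1 big1 ?addr0// => k kj.
  by rewrite (negPf kj) mulr0.
pose c0 := \big[Num.min/1]_i ((1 - 2^-1) ^+ l * (M ^+ l) i j / u i).
have h0 : 0 < 1 - 2^-1 :> R by lra.
have c00 : 0 < c0.
  by rewrite lt_bigmin// => i _; rewrite !(mulr_gt0, exprn_gt0, invr_gt0, divr_gt0).
have c0le i : c0 * u i <= (1 - 2^-1) ^+ l * (M ^+ l) i j.
  by rewrite -ler_pdivlMr//; exact: bigmin_le_cond.
pose gam := lam / mu.
have gam1 : 1 < gam by rewrite ltr_pdivlMr// mul1r.
have gam0 : 0 < gam by lra.
have large (g M' : R) : 1 < g -> exists K, (1 <= K)%N /\ forall k, (K <= k)%N -> M' <= g ^+ k.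
  move=> g1; have [||K [K1 hK]] := @eventually_ge_of_ratio R (fun k => g ^+ k) g M' 1 g1.
  - by move=> k _; rewrite exprn_gt0//; lra.
  - by move=> k _; rewrite exprS.
  - by exists K.
(* gam^q0 >= lam with a = n %/ (q0 + 1) gives lam^a gam^a <= gam^n: the spare growth pays for the a
   generations, and gam^a absorbs the constants once a >= a0. *)
have [q0 [q01 /(_ _ (leqnn _)) hq0]] := large gam lam gam1.
pose q := q0.+1.
have [a0 [_ ha0]] := large gam (th0 * lam ^+ l / c0) gam1.
have [n1 [_ hn1]] := large mu t1^-1 mu1.
pose beta := kap `^ (q%:R^-1).
have beta0 : 0 < beta by exact: powR_gt0.
have betaq : beta ^+ q = kap.
  by rewrite -powR_mulrn ?powR_ge0// -powRrM mulVf ?pnatr_eq0// powRr1// ltW.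
have beta1 : beta < 1.
  rewrite ltNge; apply/negP => b1; have := exprn_ege1 q b1; rewrite betaq; lra.
exists (expR 1 / kap), beta; split; first by rewrite divr_ge0 ?expR_ge0// ltW.
  by rewrite beta0 beta1.
exists (maxn n1 (maxn (q * a0)%N (2 * l)%N)) => // n /=.
rewrite !geq_max => /and3P[nn1 na0 nl].
pose a := (n %/ q)%N.
have aa0 : (a0 <= a)%N by rewrite leq_divRL// mulnC.
have an : (a.*2 <= n)%N.
  by apply: leq_trans (leq_divM n q); rewrite -muln2 leq_mul.
pose m := (n - a - l)%N.
have lna : (l <= n - a)%N.
  rewrite leq_subRL; last by rewrite (leq_trans _ an)// -addnn leq_addr.
  by rewrite -leq_double doubleD -[leqRHS]addnn leq_add// -mul2n.
have nE : n = (a + m + l)%N.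
  rewrite /m -addnA subnK// subnKC// (leq_trans _ an)// -addnn leq_addr//.
have bn : (n < q * a + q)%N by rewrite {1}(divn_eq n q) mulnC ltn_add2l ltn_pmod.
have qan : (q * a <= n)%N by rewrite mulnC leq_divM.
have x0 : 0 < mu ^+ n by rewrite exprn_gt0.
have cE w : (count (fun v => ptype root v == j) (generation N n w))%:R =
    wgt e (generation N n w).
  by rewrite /weight /e -natr_sum -sum1_count big_mkcond/=; congr (_%:R);
     apply: eq_bigr => v _; case: (_ == _).
under eq_set do rewrite cE.
apply: le_trans (prob_weight_le n x0 e0) _.
(* From n < q (a + 1); the incomplete block accounts for 1/kappa in the constant. *)
have kapn : kap ^+ a <= beta ^+ n / kap.
  rewrite ler_pdivlMr// -{2}betaq -betaq -exprM -exprD.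
  by apply: ler_wiXn2l; [exact: ltW|exact: ltW|exact: ltnW].
rewrite -mulrA [kap^-1 * _]mulrC EFinM; apply: lee_wpmul2l; first by rewrite lee_fin expR_ge0.
apply: (@le_trans _ _ (kap ^+ a)%:E); last by rewrite lee_fin.
have := steps (mu ^+ n)^-1 (a + m)%N; rewrite -nE => /(_ _ _)/le_trans; apply.
- by rewrite invr_ge0 ltW.
- by rewrite -[leRHS]invrK lef_pV2 ?posrE ?invr_gt0// hn1.
apply: le_trans (decay a m); apply: laplace_anti => i; rewrite Mle.
apply: (@le_trans _ _ ((mu ^+ n)^-1 * (c0 * u i))); last first.
  by rewrite ler_wpM2l// invr_ge0 ltW.
have := ha0 a aa0; rewrite ler_pdivrMr// => h1.
have lamn : lam ^+ m * lam ^+ l * lam ^+ a = gam ^+ n * mu ^+ n.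
  by rewrite -!exprD -exprMn /gam divfK ?gt_eqF//; congr (_ ^+ _); rewrite [RHS]nE [LHS]addnC addnA.
have h2 : gam ^+ a * lam ^+ a <= gam ^+ n.
  apply: (@le_trans _ _ (gam ^+ (q * a))); last by rewrite ler_weXn2l// ltW.
  rewrite /q mulSn exprD ler_wpM2l ?exprn_ge0 ?(ltW gam0)// exprM.
  by rewrite lerXn2r// nnegrE ltW// exprn_gt0.
suff key : th0 * mu ^+ n <= c0 * lam ^+ m.
  rewrite mulrA ler_wpM2r ?(ltW (u0 i))// ler_pdivrMr ?exprn_gt0//.
  by rewrite -mulrA ler_pdivlMl// mulrC.
have la0 : 0 < lam ^+ l * lam ^+ a by rewrite mulr_gt0 ?exprn_gt0.
rewrite -(ler_pM2r la0).
apply: (@le_trans _ _ (c0 * (gam ^+ a * lam ^+ a) * mu ^+ n)); last first.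
  have -> : c0 * lam ^+ m * (lam ^+ l * lam ^+ a) = c0 * gam ^+ n * mu ^+ n.
    by rewrite -[RHS]mulrA -lamn !mulrA.
  by rewrite ler_wpM2r ?(ltW x0)// ler_wpM2l ?(ltW c00).
have -> : th0 * mu ^+ n * (lam ^+ l * lam ^+ a) = th0 * lam ^+ l * (lam ^+ a * mu ^+ n) by ring.
have -> : c0 * (gam ^+ a * lam ^+ a) * mu ^+ n = gam ^+ a * c0 * (lam ^+ a * mu ^+ n) by ring.
by rewrite ler_wpM2r// mulr_ge0 ?exprn_ge0 ?ltW.
Qed.

End population_growth.

(** * Almost sure bounds on the maximal displacement *)

Section borel_cantelli.
Context {R : realType} {disp : measure_display} {Omega : measurableType disp}.
Variable P : probability Omega R.

Lemma borel_cantelli (A : nat -> set Omega) (v : nat -> R) :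
  (forall n, measurable (A n)) -> (forall n, 0 <= v n) -> cvgn (series v) ->
  (\forall n \near \oo, (P (A n) <= (v n)%:E)%E) ->
  {ae P, forall w, \forall n \near \oo, ~ A n w}.
Proof.
move=> mA v0 cv [n0 _ h0].
pose B n := A (n + n0)%N.
have mB n : measurable (B n) by exact: mA.
have sumB : (\sum_(n <oo) P (B n) < +oo)%E.
  apply: (@le_lt_trans _ _ (limn (series v))%:E); last exact: ltry.
  apply: lime_le; first exact: is_cvg_nneseries.
  apply: nearW => n; apply: (@le_trans _ _ (\sum_(0 <= i < n) (v (i + n0)%N)%:E)%E).
    by apply: lee_sum => i _; apply: h0; rewrite /= leq_addl.
  rewrite sumEFin lee_fin.
  apply: (@le_trans _ _ (series v (n + n0)%N)); last first.
    apply: nondecreasing_cvgn_le => //; apply: nondecreasing_series => i _ _; exact: v0.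
  rewrite /series/= (@big_cat_nat _ _ _ n0 0%N (n + n0)%N) ?leq_addl//=.
  have -> : \sum_(n0 <= i < n + n0) v i = \sum_(0 <= i < n) v (i + n0)%N.
    by rewrite -{1}(add0n n0) big_addn addnK.
  by rewrite lerDr sumr_ge0.
have := lim_sup_set_cvg0 mB sumB => h.
exists (lim_sup_set B); split => //.
- by apply: bigcap_measurable => // n _; apply: bigcup_measurable.
- move=> w /= nw n _; apply: contrapT => nB; apply: nw.
  exists (n + n0)%N => // k /= nk Ak; apply: nB; exists (k - n0)%N.
    by rewrite /= leq_subRL// ?(leq_trans (leq_addl _ _) nk)// addnC.
  by rewrite /B subnK// (leq_trans (leq_addl _ _) nk).
Qed.

Lemma borel_cantelli_geometric (A : nat -> set Omega) (C beta : R) :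
  (forall n, measurable (A n)) -> 0 <= C -> 0 < beta < 1 ->
  (\forall n \near \oo, (P (A n) <= (C * beta ^+ n)%:E)%E) ->
  {ae P, forall w, \forall n \near \oo, ~ A n w}.
Proof.
move=> mA C0 /andP[b0 b1]; apply: borel_cantelli => // [n|].
  by rewrite mulr_ge0// exprn_ge0// ltW.
by apply: is_cvg_geometric_series; rewrite ger0_norm// ltW.
Qed.

(** Bounded by the telescoping comparison 1/n^2 <= 1/(n-1) - 1/n; the term at n = 0 is 0 by the
    convention on inverses. *)
Lemma is_cvg_series_inv_sqr : cvgn (series (fun n => (n%:R ^+ 2)^-1 : R)).
Proof.
apply: nondecreasing_is_cvgn.
  by apply: nondecreasing_series => n _ _; rewrite invr_ge0 sqr_ge0.
exists 2 => _ [n _ <-].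
suff h k : series (fun n => (n%:R ^+ 2)^-1 : R) k.+2 <= 2 - k.+1%:R^-1.
  case: n => [|[|n]]; first by rewrite /series/= big_geq.
    by rewrite /series/= big_nat1 expr0n invr0.
  by apply: le_trans (h n) _; rewrite lerBlDr lerDl invr_ge0.
elim: k => [|k IH].
  by rewrite /series/= !big_nat_recr//= big_geq// expr0n invr0 expr1n invr1; lra.
rewrite [series _ _]/series/= big_nat_recr//=.
apply: le_trans (lerD IH (lexx _)) _.
set x : R := k.+1%:R.
have -> : k.+2%:R = x + 1 :> R by rewrite /x natr1.
have x0 : 0 < x by rewrite /x.
rewrite -subr_ge0; have -> : 2 - (x + 1)^-1 - (2 - x^-1 + ((x + 1) ^+ 2)^-1) =
    (x * (x + 1) ^+ 2)^-1 by field; rewrite !gt_eqF//; lra.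
by rewrite invr_ge0 mulr_ge0 ?sqr_ge0// ltW.
Qed.

End borel_cantelli.

(** * The normalizing sequence *)

Section normalization.
Context {R : realType}.
Variables (g : R -> R) (p : R) (psi : nat -> R).
Hypotheses (p01 : 0 < p < 1) (reg : regular g p).
Hypothesis psi_gt0 : forall n, 0 < psi n.
Hypothesis psi_oo : psi n @[n --> \oo] --> +oo.
Hypothesis psi_norm : g (psi n) / n%:R @[n --> \oo] --> (1 : R).

Lemma eventually_psi (A : R -> Prop) (c : R) : 0 < c -> eventually_R A ->
  \forall n \near \oo, A (c * psi n).
Proof.
move=> c0 /(eventually_R_scale c0)[T T1 hT]; near=> n; apply: hT.
by near: n; apply: cvgry_ge psi_oo _.
Unshelve. all: by end_near. Qed.

Lemma eventually_psi1 (A : R -> Prop) : eventually_R A -> \forall n \near \oo, A (psi n).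
Proof. by move/(eventually_psi ltr01); apply: filterS => n; rewrite mul1r. Qed.

Lemma psi_norm_le (e : R) : 0 < e -> \forall n \near \oo, `|g (psi n) - n%:R| <= e * n%:R.
Proof.
move=> e0; move/cvgrPdist_le: psi_norm => /(_ e e0) h.
near=> n; have n0 : 0 < n%:R :> R by rewrite ltr0n; near: n; exact: nbhs_infty_gt.
have : `|1 - g (psi n) / n%:R| <= e by near: n.
move=> h1.
have -> : g (psi n) - n%:R = - ((1 - g (psi n) / n%:R) * n%:R).
  by rewrite mulrBl mul1r divfK ?opprB// gt_eqF.
by rewrite normrN normrM (ger0_norm (ltW n0)) ler_wpM2r// ltW.
Unshelve. all: by end_near. Qed.

Lemma psi_scale (y e : R) : 0 < y -> 0 < e ->
  \forall n \near \oo, (y `^ p - e) * n%:R <= g (y * psi n) <= (y `^ p + e) * n%:R.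
Proof.
move=> y0 e0; have yp : 0 < y `^ p by exact: powR_gt0.
pose dl := Num.min 1 (e / (2 * (y `^ p + 1))).
have dl0 : 0 < dl by rewrite lt_min ltr01 divr_gt0// mulr_gt0// ltr_pwDr// ltW.
have dl1 : dl <= 1 by rewrite ge_min lexx.
have dl2 : y `^ p * dl <= e / 2.
  apply: (@le_trans _ _ (y `^ p * (e / (2 * (y `^ p + 1))))).
    by rewrite ler_wpM2l ?(ltW yp)// ge_min lexx orbT.
  have -> : y `^ p * (e / (2 * (y `^ p + 1))) = (e / 2) * (y `^ p / (y `^ p + 1)).
    by field; rewrite gt_eqF//; lra.
  rewrite ler_piMr//; first by lra.
  by rewrite ler_pdivrMr ?mul1r; lra.
have e40 : 0 < e / 4 by lra.
have [_ /(_ y (e / 4) y0 e40)/eventually_psi1 rg] := reg.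
near=> n; set N : R := n%:R; have N0 : 0 <= N by [].
have /andP[r1 r2] : (y `^ p - e / 4) * g (psi n) <= g (y * psi n) <=
  (y `^ p + e / 4) * g (psi n) by near: n.
have : `|g (psi n) - n%:R| <= dl * n%:R by near: n; exact: psi_norm_le.
rewrite -/N ler_norml => /andP[h1 h2].
have h3 : g (psi n) <= 2 * N by nra.
have h4 : e / 4 * g (psi n) <= e / 2 * N by nra.
have h5 : y `^ p * (g (psi n) - N) <= e / 2 * N.
  apply: (@le_trans _ _ (y `^ p * (dl * N))); first by rewrite ler_wpM2l// ltW.
  by rewrite mulrA ler_wpM2r.
have h6 : - (e / 2 * N) <= y `^ p * (g (psi n) - N).
  rewrite lerNl -mulrN; apply: (@le_trans _ _ (y `^ p * (dl * N))).
    by rewrite ler_wpM2l ?(ltW yp)// lerNl.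
  by rewrite mulrA ler_wpM2r.
by apply/andP; split; lra.
Unshelve. all: by end_near. Qed.

(** g(t) <= t^s for some s < 1, so n/2 <= g(psi n) <= (psi n)^s, and q = 1/s. *)
Lemma psi_growth : exists2 q, 1 < q & \forall n \near \oo, (n%:R / 2) `^ q <= psi n.
Proof.
have [s /andP[s0 s1] /eventually_psi1 hs] := regular_sublinear p01 reg.
exists s^-1; first by rewrite invf_gt1.
near=> n.
have : `|g (psi n) - n%:R| <= 2^-1 * n%:R.
  by near: n; apply: psi_norm_le; rewrite invr_gt0.
rewrite ler_norml => /andP[h1 _].
have h : n%:R / 2 <= psi n `^ s.
  apply: (@le_trans _ _ (g (psi n))); last by near: n.
  by lra.
apply: (@le_trans _ _ ((psi n `^ s) `^ s^-1)).
  by apply: ge0_ler_powR => //; rewrite ?nnegrE ?invr_ge0 ?(ltW s0)// ?powR_ge0// divr_ge0.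
by rewrite -powRrM divff ?gt_eqF// powRr1// ltW.
Unshelve. all: by end_near. Qed.

End normalization.

(** * Upper and lower bounds along the normalizing sequence *)

Section maximal_displacement.
Context {R : realType} {d : nat} {disp disp0 : measure_display}
  {Omega : measurableType disp} {Omega0 : measurableType disp0}.
Variables (P : probability Omega R) (Q : probability Omega0 R).
Variable xi : 'I_d.+1 -> {mfun Omega0 >-> R}.
Variables (N : label d.+1 -> 'I_d.+1 -> {mfun Omega >-> nat})
  (X : label d.+1 -> {mfun Omega >-> R}) (root : 'I_d.+1).
Hypothesis indep : mutually_independent P (driving_events N X).
Hypothesis law_displacement : forall v j k (B : set R), measurable B ->
  P (X ((j, k) :: v) @^-1` B) = Q (xi j @^-1` B).
Variables (g : R -> R) (p : R) (psi : nat -> R) (rho : R).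
Hypotheses (p01 : 0 < p < 1) (reg : regular g p).
Hypothesis psi_gt0 : forall n, 0 < psi n.
Hypothesis psi_oo : psi n @[n --> \oo] --> +oo.
Hypothesis psi_norm : g (psi n) / n%:R @[n --> \oo] --> (1 : R).
Hypothesis rho1 : 1 < rho.

Let lnrho0 : 0 < ln rho. Proof. exact: ln_gt0. Qed.

Lemma eventually_not_hit (y : R) :
  (forall s : R, rho < s -> exists2 C : R, 0 <= C & forall n,
     (\int[P]_w (weight root (fun=> 1) (generation N n w))%:E <= (C * s ^+ n)%:E)%E) ->
  (forall (e : R) j, 0 < e < 1 / 2 -> eventually_R (fun t =>
     Q [set u | (t <= xi j u)%R] <= (expR (- ((1 - e) * g t)))%:E)%E) ->
  0 < y -> ln rho < y `^ p ->
  {ae P, forall w, \forall n \near \oo, ~ hit N X n (y * psi n) w}.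
Proof.
move=> mean tail y0 yrho; have yp : 0 < y `^ p by exact: powR_gt0.
(* The gap dl is spent as follows: dl/4 on [e], dl/4 on the truncated moments or on the factor n,
   dl/8 on the growth of the mean. The rest, 3 dl/8, is the exponent of [beta]. *)
pose dl := y `^ p - ln rho; have dl0 : 0 < dl by rewrite subr_gt0.
pose e := Num.min (1 / 4) (dl / 4 / (1 + 2 * y `^ p)).
have yp2 : 0 < 1 + 2 * y `^ p by lra.
have e0 : 0 < e by rewrite lt_min !divr_gt0.
have e14 : e <= 1 / 4 by rewrite ge_min lexx.
have ey : e + 2 * e * y `^ p <= dl / 4.
  have : e * (1 + 2 * y `^ p) <= dl / 4 by rewrite -ler_pdivlMr// ge_min lexx orbT.
  by lra.
have e01 : 0 < e < 1 / 2 by lra.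
have [|C C0 hC] := mean (rho * expR (dl / 8)).
  by rewrite ltr_pMr ?(lt_trans ltr01)// -expR0 ltr_expR divr_gt0.
pose beta := expR (- (3 * dl / 8)).
apply: (@borel_cantelli_geometric _ _ _ P _ ((1 + 4 / dl) * C) beta).
- by move=> n; exact: measurable_hit.
- by rewrite mulr_ge0// addr_ge0// divr_ge0// ltW.
- by rewrite expR_gt0 -expR0 ltr_expR oppr_lt0 divr_gt0// mulr_gt0.
have Htail := eventually_psi psi_oo y0 (eventually_R_forall (fun j => tail e j e01)).
have Hmgf := eventually_psi psi_oo y0 (eventually_R_forall (fun j =>
  truncated_mgf_small p01 reg e01 (tail e j e01) (eta := dl / 4) ltac:(lra))).
near=> n.
have tailn : forall j, (Q [set u | (y * psi n <= xi j u)%R] <=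
    (expR (- ((1 - e) * g (y * psi n))))%:E)%E by near: n.
have mgfn : forall j, (\int[Q]_u (truncated_exp ((1 - 2 * e) * g (y * psi n) / (y * psi n))
    (y * psi n) (xi j u))%:E <= (expR (dl / 4))%:E)%E by near: n.
set z := y * psi n in tailn mgfn *; have z0 : 0 < z by rewrite mulr_gt0.
set nn : R := n%:R; have nn0 : 0 <= nn by exact: ler0n.
have /andP[gz _] : (y `^ p - e) * n%:R <= g (y * psi n) <= (y `^ p + e) * n%:R.
  by near: n; exact: psi_scale.
rewrite -/z -/nn in gz.
have gz2 : (y `^ p - dl / 4) * nn <= (1 - 2 * e) * g z.
  apply: (@le_trans _ _ ((1 - 2 * e) * ((y `^ p - e) * nn))).
    by rewrite mulrA ler_wpM2r//; nra.
  by rewrite ler_wpM2l//; lra.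
have ype : 0 <= y `^ p - e.
  have : dl <= y `^ p by rewrite /dl lerBlDr lerDl ltW.
  have : 0 <= e * y `^ p by rewrite mulr_ge0// ltW.
  lra.
have gz0 : 0 <= g z by apply: le_trans gz; rewrite mulr_ge0.
pose x := expR (- ((y `^ p - dl / 4) * nn)).
apply: (@le_trans _ _ (((1 + 4 / dl) * expR (- ((y `^ p - dl / 2) * nn)))%:E *
    \int[P]_w (weight root (fun=> 1%R) (generation N n w))%:E)%E).
  apply: (@prob_hit _ _ _ _ _ _ P Q xi N X root indep law_displacement n z
    ((1 - 2 * e) * g z / z) x (expR (dl / 4))).
  - by rewrite !mulr_ge0 ?invr_ge0// ?(ltW z0)//; lra.
  - move=> j; apply: (@le_trans _ _ (expR (- ((1 - e) * g z)))%:E).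
      exact: tailn.
    rewrite lee_fin ler_expR lerN2; apply: le_trans gz2 _.
    by rewrite ler_wpM2r//; lra.
  - exact: mgfn.
  have -> : - ((1 - 2 * e) * g z / z * z) = - ((1 - 2 * e) * g z).
    by rewrite divfK// gt_eqF.
  rewrite -expRM_natl -/nn.
  have h1 : expR (- ((1 - 2 * e) * g z)) <= x by rewrite ler_expR lerN2.
  have h2 : expR (- ((y `^ p - dl / 2) * nn)) = x * expR (nn * (dl / 4)).
    by rewrite -expRD; congr expR; lra.
  have h3 : nn <= 4 / dl * expR (nn * (dl / 4)).
    rewrite -ler_pdivrMl ?divr_gt0// invf_div mulrC.
    by apply: le_trans (expR_ge1Dx _); rewrite lerDr.
  rewrite h2 [leRHS]mulrDl mul1r [leLHS]addrC; apply: lerD.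
    by rewrite ler_wpM2r// expR_ge0.
  by rewrite [leRHS]mulrCA mulrC ler_wpM2l// expR_ge0.
apply: (@le_trans _ _ (((1 + 4 / dl) * expR (- ((y `^ p - dl / 2) * nn)))%:E *
    (C * (rho * expR (dl / 8)) ^+ n)%:E)%E).
  apply: lee_wpmul2l => //.
  by rewrite lee_fin mulr_ge0 ?expR_ge0// addr_ge0// divr_ge0// ltW.
rewrite -EFinM lee_fin le_eqVlt; apply/orP; left; apply/eqP.
have -> : rho * expR (dl / 8) = expR (ln rho + dl / 8).
  by rewrite expRD lnK// posrE (lt_trans ltr01).
rewrite /beta -!expRM_natl -/nn.
have -> : nn * - (3 * dl / 8) = - ((y `^ p - dl / 2) * nn) + nn * (ln rho + dl / 8).
  rewrite /dl; lra.
by rewrite expRD; ring.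
Unshelve. all: by end_near. Qed.

(** A drop by c psi(n)/n, which exceeds a constant times n^(q-1), has probability at most m over its
    k-th power; n ancestors together must cost a summable amount. *)
Let negligible_jumps : exists k : nat, forall c m : R, 0 < c ->
  exists2 C : R, 0 <= C &
  \forall n \near \oo, n%:R * (`|m| / (c * psi n / n%:R) ^+ k) <= C * (n%:R ^+ 2)^-1.
Proof.
have [q q1 hpsi] := psi_growth p01 reg psi_gt0 psi_oo psi_norm.
have q10 : 0 < q - 1 by lra.
(* (q-1) k >= 3 gives n^(-3) per ancestor, hence n^(-2) for n of them. *)
pose k := (Num.truncn (3 / (q - 1))).+1.
have hk : 3 <= (q - 1) * k%:R.
  by rewrite mulrC -ler_pdivrMr// ltW// truncnS_gt.
exists k => c m c0; exists (`|m| * 8 * (2 / c) ^+ k).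
  by rewrite !mulr_ge0// exprn_ge0// divr_ge0// ltW.
near=> n.
have n2 : (2 <= n)%N by near: n; exact: nbhs_infty_ge.
have n0 : 0 < n%:R :> R by rewrite ltr0n (leq_trans _ n2).
pose x : R := n%:R / 2.
have nx : n%:R = x * 2 by rewrite /x divfK.
have x1 : 1 <= x by rewrite /x ler_pdivlMr// mul1r ler_nat.
have x0 : 0 < x := lt_le_trans ltr01 x1.
have bx : c / 2 * x `^ (q - 1) <= c * psi n / n%:R.
  rewrite ler_pdivlMr// nx.
  have -> : c / 2 * x `^ (q - 1) * (x * 2) = c * (x `^ (q - 1) * x) by lra.
  rewrite ler_wpM2l ?(ltW c0)//.
  have -> : x `^ (q - 1) * x = x `^ q.
    rewrite -[X in _ * X](powRr1 (ltW x0)) -powRD ?subrK//.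
    by rewrite (gt_eqF x0) implybT.
  by rewrite /x; near: n.
have bk : (c / 2) ^+ k * x ^+ 3 <= (c * psi n / n%:R) ^+ k.
  apply: (@le_trans _ _ ((c / 2 * x `^ (q - 1)) ^+ k)).
    rewrite [leRHS]exprMn ler_wpM2l ?exprn_ge0 ?divr_ge0 ?(ltW c0)//.
    rewrite -[leLHS]powR_mulrn ?(ltW x0)// -[leRHS]powR_mulrn ?powR_ge0// -powRrM.
    by apply: ler_powR.
  apply: lerXn2r => //; rewrite nnegrE ?mulr_ge0 ?powR_ge0 ?divr_ge0 ?invr_ge0 ?(ltW c0)//.
  exact: ltW.
have p1 : 0 < (c / 2) ^+ k * x ^+ 3 by rewrite mulr_gt0 ?exprn_gt0 ?divr_gt0.
have p2 : 0 < (c * psi n / n%:R) ^+ k := lt_le_trans p1 bk.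
apply: (@le_trans _ _ (n%:R * (`|m| / ((c / 2) ^+ k * x ^+ 3)))).
  by rewrite ler_wpM2l ?(ltW n0)// ler_wpM2l// lef_pV2.
rewrite le_eqVlt; apply/orP; left; apply/eqP.
rewrite nx -[2 / c]invf_div exprVn; field.
by rewrite !gt_eqF ?exprn_gt0 ?divr_gt0.
Unshelve. all: by end_near. Qed.

Lemma eventually_hit (y : R) :
  (forall (mu : R) j, 1 < mu -> mu < rho -> exists C beta : R,
    [/\ 0 <= C, 0 < beta < 1 & \forall n \near \oo,
    (P [set w | (count (fun v => ptype root v == j) (generation N n w))%:R <= mu ^+ n]%R
     <= (C * beta ^+ n)%:E)%E]) ->
  (forall e : R, 0 < e < 1 -> eventually_R (fun t => exists j,
     (expR (- ((1 + e) * g t)))%:E <= Q [set u | (t <= xi j u)%R])%E) ->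
  (forall k : nat, exists m : R, forall (b : R) j, 0 < b ->
     (Q (xi j @^-1` `]-oo, (- b)%R[%classic) <= (m / b ^+ k)%:E)%E) ->
  0 < y -> y `^ p < ln rho ->
  {ae P, forall w, \forall n \near \oo, hit N X n (y * psi n) w}.
Proof.
move=> growth tail moment y0 yrho; have yp : 0 < y `^ p by exact: powR_gt0.
have /andP[p0 p1] := p01.
(* The jump aims at the higher level y2 psi(n), still subcritical; the margin (y2 - y) psi(n) is
   shared among the ancestors as their allowed drops [b]. *)
pose Y := (y `^ p + ln rho) / 2; pose y2 := Y `^ p^-1.
have Y0 : 0 < Y by rewrite /Y; lra.
have y20 : 0 < y2 by exact: powR_gt0.
have y2p : y2 `^ p = Y by rewrite /y2 -powRrM mulVf ?gt_eqF// powRr1// ltW.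
have yy2 : y < y2.
  rewrite ltNge; apply/negP => /(ge0_ler_powR (ltW p0)).
  by rewrite !nnegrE (ltW y20) (ltW y0) y2p => /(_ isT isT); rewrite /Y; lra.
pose dl := ln rho - Y; have dl0 : 0 < dl by rewrite /dl /Y; lra.
have dl1 : dl < ln rho by rewrite /dl; lra.
(* A jump beyond y2 psi(n) then has probability at least exp(- (Y + dl/4) n), against about mu^n =
   exp((Y + 3 dl/4) n) candidates: the mean number of successes is at least exp(n dl/2). *)
pose e := Num.min (1 / 2) (dl / 4 / (2 + Y)).
have Y20 : 0 < 2 + Y by lra.
have e0 : 0 < e by rewrite lt_min !divr_gt0.
have e12 : e <= 1 / 2 by rewrite ge_min lexx.
have eY : (1 + e) * (Y + e) <= Y + dl / 4.
  have : e * (2 + Y) <= dl / 4 by rewrite -ler_pdivlMr// ge_min lexx orbT.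
  nra.
have e01 : 0 < e < 1 by lra.
pose mu := expR (ln rho - dl / 4).
have mu1 : 1 < mu by rewrite -expR0 ltr_expR; lra.
have murho : mu < rho.
  by rewrite -[ltRHS]lnK ?posrE ?(lt_trans ltr01)// ltr_expR; lra.
have counts : {ae P, forall w, forall j, \forall n \near \oo,
    mu ^+ n < (count (fun v => ptype root v == j) (generation N n w))%:R}.
  apply: filter_forall => j; have [C [beta [C0 beta01 hC]]] := growth mu j mu1 murho.
  apply: filterS (borel_cantelli_geometric _ C0 beta01 hC) => [w|n].
    by apply: filterS => n /=; rewrite ltNge => /negP.
  have -> : [set w | (count (fun v => ptype root v == j) (generation N n w))%:R <= mu ^+ n] =
      generation N n @^-1` [set h : seq (label d.+1) |
        (count (fun v => ptype root v == j) h)%:R <= mu ^+ n] by [].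
  exact/measurable_countable_preimage/measurable_generation.
have [k hk] := negligible_jumps; have [m hm] := moment k.
have [C C0 hC] := hk (y2 - y) m ltac:(lra).
(* The jumping type is chosen for each n, outside the probability space. The implication makes the
   choice total; when no type qualifies, [root] is a default, and this ceases for large n. *)
have /choice[jn hjn] : forall n, exists j, forall j',
    ((expR (- ((1 + e) * g (y2 * psi n))))%:E <= Q [set u | (y2 * psi n <= xi j' u)%R] ->
     (expR (- ((1 + e) * g (y2 * psi n))))%:E <= Q [set u | (y2 * psi n <= xi j u)%R])%E.
  move=> n; have [[j hj]|nj] := pselect (exists j, (expR (- ((1 + e) * g (y2 * psi n))))%:E <=
      Q [set u | (y2 * psi n <= xi j u)%R])%E.
    by exists j.
  by exists root => j' hj'; exfalso; apply: nj; exists j'.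
pose K n := Num.truncn (mu ^+ n).
pose A n := all_below N X n (y * psi n) `&`
  [set w | (K n <= count (fun v => ptype root v == jn n) (generation N n w))%N].
have mA n : measurable (A n).
  apply: measurableI; first by rewrite all_belowE; apply/measurableC/measurable_hit.
  exact: (measurable_countable_preimage (@measurable_generation _ _ _ N n)
    [set h : seq (label d.+1) | (K n <= count (fun v => ptype root v == jn n) h)%N]).
(* pi^K <= exp(- x K) with x <= 1 and K >= mu^n - 1, which is the origin of exp(1). The second term
   is the cost of bad ancestors. *)
pose v n : R := expR 1 * expR (- (dl / 2)) ^+ n + C * (n%:R ^+ 2)^-1.
have notA : {ae P, forall w, \forall n \near \oo, ~ A n w}.
  apply: (@borel_cantelli _ _ _ P A v) => // [n||].
  - by rewrite addr_ge0 ?mulr_ge0 ?exprn_ge0 ?expR_ge0// invr_ge0 sqr_ge0.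
  - apply: is_cvg_seriesD.
      apply: is_cvg_geometric_series; rewrite ger0_norm ?expR_ge0//.
      by rewrite -[ltRHS]expR0 ltr_expR oppr_lt0 divr_gt0.
    exact: (@is_cvg_seriesZ _ _ C (@is_cvg_series_inv_sqr R)).
  have Htail := eventually_psi psi_oo y20 (tail e e01).
  near=> n.
  have [j' /hjn hp] : exists j, ((expR (- ((1 + e) * g (y2 * psi n))))%:E <=
      Q [set u | (y2 * psi n <= xi j u)%R])%E by near: n.
  have hCn : n%:R * (`|m| / ((y2 - y) * psi n / n%:R) ^+ k) <= C * (n%:R ^+ 2)^-1 by near: n.
  have /andP[gz1 gz2] : (Y - e) * n%:R <= g (y2 * psi n) <= (Y + e) * n%:R.
    by rewrite -y2p; near: n; exact: psi_scale.
  have n0 : (0 < n)%N by near: n; exact: nbhs_infty_gt.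
  have nn0 : 0 < n%:R :> R by rewrite ltr0n.
  set z := y2 * psi n in hp gz1 gz2; set b := (y2 - y) * psi n / n%:R in hCn.
  have b0 : 0 < b by rewrite divr_gt0// mulr_gt0// subr_gt0.
  set x := expR (- ((1 + e) * g z)) in hp.
  pose pi := fine (Q (xi (jn n) @^-1` `]-oo, z[%classic)).
  have mB : measurable (xi (jn n) @^-1` `]-oo, z[%classic).
    by rewrite -[Z in measurable Z]setTI; exact: measurable_funP.
  have piE : Q (xi (jn n) @^-1` `]-oo, z[%classic) = pi%:E.
    by rewrite fineK// fin_num_measure.
  have pi0 : 0 <= pi by rewrite -lee_fin -piE.
  have pix : pi <= 1 - x.
    rewrite -lee_fin EFinB -piE.
    have -> : xi (jn n) @^-1` `]-oo, z[%classic = ~` [set u | z <= xi (jn n) u].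
      apply/seteqP; split => u /=; rewrite in_itv/= ltNge; first by move/negP.
      by move=> h; apply/negP.
    rewrite probability_setC; first exact: leeB.
    have -> : [set u | z <= xi (jn n) u] = xi (jn n) @^-1` `[z, +oo[%classic.
      by apply/seteqP; split => u /=; rewrite in_itv/= andbT.
    by rewrite -[Z in measurable Z]setTI; exact: measurable_funP.
  (* [prob_all_below] concerns generation n'+1, whose particles have n' strict ancestors with a
     displacement. *)
  have [n' nE] : exists n', n = n'.+1 by exists n.-1; rewrite prednK.
  have Abound : (P (A n) <= (pi ^+ K n + n'%:R * (`|m| / b ^+ k))%:E)%E.
    have := prob_all_below root indep law_displacement (n := n') (j := jn n)
      (y := y * psi n) (z := z) (b := b) (q := `|m| / b ^+ k) (pi := pi) (K n).
    rewrite -nE; apply => //.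
    - exact: ltW.
    - have -> : z - n'%:R * b = y * psi n + b.
        rewrite /z /b nE -natr1; field.
        by rewrite natr1 pnatr_eq0.
      by rewrite lerDl ltW.
    - move=> i; apply: le_trans (hm b i b0) _; rewrite lee_fin.
      by rewrite ler_wpM2r ?ler_norm// invr_ge0 exprn_ge0// ltW.
  apply: le_trans Abound _; rewrite lee_fin; apply: lerD; last first.
    apply: le_trans hCn; rewrite ler_wpM2r ?divr_ge0 ?exprn_ge0 ?(ltW b0)//.
    by rewrite ler_nat nE.
  have x0 : 0 < x by exact: expR_gt0.
  have x1 : x <= 1 by lra.
  have Kmu : mu ^+ n - 1 <= (K n)%:R by rewrite lerBlDr natr1 ltW// truncnS_gt.
  apply: (@le_trans _ _ (expR (- x) ^+ K n)).
    apply: lerXn2r; rewrite ?nnegrE ?expR_ge0//.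
    by apply: le_trans pix _; exact: expR_ge1Dx.
  rewrite -!expRM_natl -expRD ler_expR.
  have xmu : dl / 2 * n%:R <= x * mu ^+ n.
    rewrite /mu -expRM_natl -expRD.
    apply: (@le_trans _ _ (expR (dl / 2 * n%:R))).
      by apply: le_trans (expR_ge1Dx _); rewrite lerDr.
    rewrite ler_expR.
    have : (1 + e) * g z <= (Y + dl / 4) * n%:R.
      apply: (@le_trans _ _ ((1 + e) * ((Y + e) * n%:R))).
        by rewrite ler_wpM2l//; lra.
      by rewrite mulrA ler_wpM2r// ltW.
    rewrite /dl; lra.
  have : x * (mu ^+ n - 1) <= x * (K n)%:R by rewrite ler_wpM2l// ltW.
  lra.
apply: filterS2 counts notA => w hc hA.
have hc' := @filter_forall nat 'I_d.+1 _ _ _ hc.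
apply: filterS2 (hc' _) hA => n countn nA.
apply: contrapT => nhit; apply: nA; split; first by rewrite all_belowE.
rewrite /= -(ler_nat R); apply: le_trans (ltW (countn (jn n))).
by rewrite truncn_le exprn_ge0// expR_ge0.
Unshelve. all: by end_near. Qed.

End maximal_displacement.

(** * From the hypotheses on the model to the estimates *)

Section consequences_of_the_model.
Context {R : realType} {d : nat} {disp disp0 : measure_display}
  {Omega : measurableType disp} {Omega0 : measurableType disp0}.
Variables (P : 'I_d.+1 -> probability Omega R) (Q : probability Omega0 R).
Variables (N0 : 'I_d.+1 -> 'I_d.+1 -> {mfun Omega0 >-> nat})
  (xi : 'I_d.+1 -> {mfun Omega0 >-> R}).
Variables (N : label d.+1 -> 'I_d.+1 -> {mfun Omega >-> nat})
  (X : label d.+1 -> {mfun Omega >-> R}).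

Lemma population1 i j w : population N i 1 j w = N [::] j w.
Proof.
apply/eqP; rewrite -(eqr_nat R); apply/eqP.
have -> : (population N i 1 j w)%:R =
    weight i (fun k => (k == j)%:R) (generation N 1 w) :> R.
  rewrite /weight -natr_sum /population; move: (generation N 1 w) => h.
  by rewrite -sum1_count big_mkcond/=; congr (_%:R); apply: eq_bigr => v _; case: (_ == _).
rewrite weight_generationS [generation N 0 w]/= big_seq1 (bigD1 j)//= eqxx mul1r big1 ?addr0// => k kj.
by rewrite (negPf kj) mul0r.
Qed.

(** Entries of [mean_matrix] are taken through [fine]; the x log x moment guarantees that they are
    the true means. *)
Lemma mean_matrixE (hbrw : branching_random_walk P Q N0 xi N X) i j :
  ('E_(P i)[fun w => ((population N i 1 j w)%:R * ln (population N i 1 j w)%:R)%R] < +oo)%E ->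
  (\int[Q]_u ((N0 i j u)%:R)%:E = (mean_matrix Q N0 i j)%:E)%E.
Proof.
have -> : population N i 1 j = N [::] j by apply/funext => w; exact: population1.
move=> /fin_num_mean_of_xlnx fin; rewrite mxE unlock fineK//.
have <- : (\int[P i]_w (((N [::] j w)%:R : R)%:E) = \int[Q]_u ((N0 i j u)%:R)%:E)%E.
  exact: (integral_offspring (brw_offspring hbrw i) [::] (phi := fun k => (k j)%:R)).
by apply: fin; apply: measurableT_comp => //; exact: measurable_funP.
Qed.

(** Markov's inequality for |xi|^k. Summing the moments over the types gives a common constant, and
    k = 0 is separate because only positive exponents are available. *)
Lemma lower_tail_le_moment :
  (forall (j : 'I_d.+1) (p : R), 0 < p -> ('E_Q[fun u => (`|xi j u| `^ p)%R] < +oo)%E) ->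
  forall k : nat, exists m : R, forall (b : R) j, 0 < b ->
     (Q (xi j @^-1` `]-oo, (- b)%R[%classic) <= (m / b ^+ k)%:E)%E.
Proof.
move=> hmom [|k].
  exists 1 => b j b0; rewrite expr0 divr1; apply: probability_le1.
  by rewrite -[Z in measurable Z]setTI; exact: measurable_funP.
pose m j := (\int[Q]_u (`|xi j u| `^ k.+1%:R)%:E)%E.
have m0 j : (0 <= m j)%E by apply: integral_ge0 => u _; rewrite lee_fin powR_ge0.
have mfin j : m j \is a fin_num.
  by rewrite ge0_fin_numE//; have := hmom j k.+1%:R; rewrite unlock; apply.
have fm0 j : 0 <= fine (m j) by exact: fine_ge0.
exists (\sum_j fine (m j)) => b j b0; set B := _ @^-1` _.
have mB : measurable B by rewrite -[Z in measurable Z]setTI; exact: measurable_funP.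
have bk0 : 0 < b ^+ k.+1 by rewrite exprn_gt0.
have bB : ((b ^+ k.+1)%:E * Q B <= m j)%E.
  have -> : (Q B = \int[Q]_u (\1_B u)%:E)%E by rewrite integral_indic// setIT.
  rewrite -ge0_integralZl ?lee_fin ?(ltW bk0)//; last first.
    by apply/measurable_EFinP; exact: measurable_indic.
  apply: ge0_le_integral => //.
  - by move=> u _; rewrite -EFinM lee_fin mulr_ge0// ltW.
  - by apply: measurable_funeM; apply/measurable_EFinP; exact: measurable_indic.
  - by apply/measurable_EFinP; apply: (measurableT_comp (measurable_powR _)); exact: measurableT_comp.
  - move=> u _; rewrite -EFinM lee_fin indicE.
    case: (boolP (u \in B)) => [|_]; last by rewrite mulr0 powR_ge0.
    rewrite inE /B /= in_itv/= mulr1 => ub.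
    rewrite -powR_mulrn ?(ltW b0)//; apply: ge0_ler_powR => //; rewrite ?nnegrE ?(ltW b0)//.
    by rewrite ler0_norm; lra.
apply: (@le_trans _ _ (fine (m j) / b ^+ k.+1)%:E); last first.
  by rewrite lee_fin ler_wpM2r ?invr_ge0 ?(ltW bk0)// (bigD1 j)//= lerDl sumr_ge0.
rewrite -(fineK (fin_num_measure Q B mB)) lee_fin ler_pdivlMr// mulrC -lee_fin EFinM.
by rewrite !fineK// fin_num_measure.
Qed.

(** Integers tending to 0 are eventually 0, so the null event is extinction, which contains every
    event that generation n is empty. *)
Lemma generation_neq_nil root (mu : probability Omega R) :
  mu [set w | forall j, (population N root n j w)%:R @[n --> \oo] --> (0 : R)] = 0%E ->
  forall n, {ae mu, forall w, generation N n w != [::]}.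
Proof.
move=> h0 n.
have mono k m w : generation N k w = [::] -> generation N (k + m) w = [::].
  by move=> gk; elim: m => [|m IH]; rewrite ?addn0// addnS generationS IH.
have mE k : measurable (generation N k @^-1` [set [::]]) by exact: measurable_generation.
have E : [set w | forall j, (population N root n j w)%:R @[n --> \oo] --> (0 : R)] =
    \bigcup_k (generation N k @^-1` [set [::]]).
  apply/seteqP; split => [w h|w [k _ /= gk] j].
    have : \forall k \near \oo, forall j, population N root k j w = 0%N.
      apply: filter_forall => j; have /cvgr_lt/(_ 1 ltr01) := h j.
      by apply: filterS => k; rewrite ltrn1 ltnS leqn0 => /eqP.
    move=> [k _ /(_ k (leqnn k)) hk]; exists k => //=.
    case gE: (generation N k w) => [//|v g]; have := hk (ptype root v).
    by rewrite /population gE /= eqxx.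
  apply: cvg_near_cst; exists k => // m /= km.
  by rewrite /population -(subnKC km) mono.
exists (generation N n @^-1` [set [::]]); split => //.
  apply: le_anti; rewrite measure_ge0 andbT -h0 E.
  apply: le_measure; rewrite ?inE//; first exact: bigcup_measurable.
  by move=> w gw; exists n.
by move=> w /=; have [//|_ []] := eqVneq (generation N n w) [::].
Qed.

End consequences_of_the_model.

Section maximum.
Context {R : realType} {d : nat} {disp : measure_display} {Omega : measurableType disp}.
Variables (N : label d.+1 -> 'I_d.+1 -> {mfun Omega >-> nat})
  (X : label d.+1 -> {mfun Omega >-> R}).

Lemma max_position_le n z w : ~ hit N X n z w -> (max_position N X n w <= z%:E)%E.
Proof.
move=> nh; apply: ge_ereal_sup => _ [v vg <-]; rewrite lee_fin leNgt.
by apply/negP => zv; apply: nh; exists v => //; exact: ltW.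
Qed.

Lemma max_position_ge n z w : hit N X n z w -> (z%:E <= max_position N X n w)%E.
Proof.
move=> [v vg zv]; apply: (@le_trans _ _ (position X v w)%:E); first by rewrite lee_fin.
by apply: ereal_sup_ubound; exists v.
Qed.

(** Only the levels y + 1/(k+1) and y - 1/(k+1) are used, so the exceptional null sets are countably
    many. *)
Lemma cvg_max_position (psi : nat -> R) (y : R) w : (forall n, 0 < psi n) -> 0 < y ->
  (forall k : nat, \forall n \near \oo, ~ hit N X n ((y + k.+1%:R^-1) * psi n) w) ->
  (forall k : nat, k.+1%:R^-1 < y ->
     \forall n \near \oo, hit N X n ((y - k.+1%:R^-1) * psi n) w) ->
  (max_position N X n w * ((psi n)^-1)%:E)%E @[n --> \oo] --> y%:E.
Proof.
move=> psi0 y0 up low.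
have bounds (e : R) : 0 < e -> \forall n \near \oo,
    ((y - e)%:E <= max_position N X n w * ((psi n)^-1)%:E <= (y + e)%:E)%E.
  move=> e0; pose k := Num.truncn (Num.min e y)^-1.
  have m0 : 0 < Num.min e y by rewrite lt_min e0.
  have hk : k.+1%:R^-1 < Num.min e y.
    by rewrite -[ltRHS]invrK ltf_pV2 ?posrE ?invr_gt0// truncnS_gt.
  move: hk; rewrite lt_min => /andP[ke ky]; move: ke ky (low k ky); set ik := k.+1%:R^-1 => ke ky.
  move: (up k); rewrite -/ik; apply: filterS2 => n /max_position_le hu /max_position_ge hl.
  rewrite lee_pdivlMr// lee_pdivrMr//; apply/andP; split.
    by apply: le_trans hl; rewrite -EFinM lee_fin; apply: ler_wpM2r; [exact: ltW|lra].
  by apply: (le_trans hu); rewrite -EFinM lee_fin; apply: ler_wpM2r; [exact: ltW|lra].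
apply/fine_cvgP; split.
  apply: filterS (bounds 1 ltr01) => n /andP[h1 h2].
  by rewrite fin_real// (lt_le_trans _ h1) ?ltNyr// (le_lt_trans h2)// ltry.
apply/cvgrPdist_le => e e0; apply: filterS (bounds e e0) => n /andP[h1 h2].
have fin : (max_position N X n w * ((psi n)^-1)%:E)%E \is a fin_num.
  by rewrite fin_real// (lt_le_trans _ h1) ?ltNyr// (le_lt_trans h2)// ltry.
move: h1 h2; rewrite /= -(fineK fin) !lee_fin ler_norml => h1 h2.
by apply/andP; split; rewrite /=; lra.
Qed.

End maximum.

Unset Implicit Arguments.
Set Strict Implicit.
Set Printing Implicit Defensive.

(* d.+1 types; ord0 is the type numbered 1 on paper. *)
Theorem theorem2p5 (R : realType) (d : nat)
    (disp disp0 : measure_display)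
    (Omega : measurableType disp) (Omega0 : measurableType disp0)
    (P : 'I_d.+1 -> probability Omega R) (Q : probability Omega0 R)
    (N0 : 'I_d.+1 -> 'I_d.+1 -> {mfun Omega0 >-> nat})
    (xi : 'I_d.+1 -> {mfun Omega0 >-> R})
    (N : label d.+1 -> 'I_d.+1 -> {mfun Omega >-> nat})
    (X : label d.+1 -> {mfun Omega >-> R})
    (hbrw : branching_random_walk P Q N0 xi N X)
    (hirr : exists l : nat, (1 <= l)%N /\
      forall i j, 0 < ((mean_matrix Q N0) ^+ l) i j)
    (rho : R) (hrho : perron_frobenius_eigenvalue (mean_matrix Q N0) rho)
    (hrho1 : 1 < rho)
    (hLlogL : forall i j : 'I_d.+1,
      ('E_(P i)[fun w => ((population N i 1 j w)%:R
                          * ln (population N i 1 j w)%:R)%R] < +oo)%E)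
    (hsurv : P ord0 [set w | forall j,
      (population N ord0 n j w)%:R @[n --> \oo] --> (0 : R)] = 0%E)
    (hmom : forall (j : 'I_d.+1) (p : R), 0 < p ->
      ('E_Q[fun u => (`|xi j u| `^ p)%R] < +oo)%E)
    (a L : 'I_d.+1 -> R -> R) (r : 'I_d.+1 -> R)
    (htail : forall (j : 'I_d.+1) (t : R), 0 < t ->
      Q [set u | t <= xi j u] = (a j t * expR (- (L j t * t `^ r j)))%:E)
    (ha : forall j, slowly_varying (a j))
    (hL : forall j, slowly_varying (L j))
    (hLmono : forall j,
      eventually_nonincreasing (fun t => L j t / t `^ (1 - r j)))
    (hr : forall j, 0 < r j < 1)
    (psi : nat -> R) (hpsi_pos : forall n, 0 < psi n)
    (hpsi_oo : psi n @[n --> \oo] --> +oo)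
    (hpsi : min_slow r L (psi n) * psi n `^ min_exponent r / n%:R
      @[n --> \oo] --> (1 : R)) :
  {ae P ord0, forall w,
    (max_position N X n w * ((psi n)^-1)%:E)%E @[n --> \oo]
      --> ((ln rho `^ (min_exponent r)^-1)%:E)}.

Proof.
have [l [_ Ml]] := hirr.
have meanM i j := mean_matrixE hbrw (hLlogL i j).
have M0 i j : 0 <= mean_matrix Q N0 i j.
  by rewrite -lee_fin -meanM; apply: integral_ge0 => w _; rewrite lee_fin.
have [u [u0 hu]] := positive_superharmonic M0 hrho Ml.
have indep := brw_independent hbrw ord0.
have loff := brw_offspring hbrw ord0.
have ldis := brw_displacement hbrw ord0.
have surv := generation_neq_nil hsurv.
(* Neither [a] nor [L] has a prescribed sign; monotonicity and the bounds 0 and 1 are properties of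
   the tail itself. *)
pose H j t := fine (Q [set w | t <= xi j w]).
have mH j t : measurable [set w | t <= xi j w].
  have -> : [set w | t <= xi j w] = xi j @^-1` `[t, +oo[%classic.
    by apply/seteqP; split => w /=; rewrite in_itv/= andbT.
  by rewrite -[Z in measurable Z]setTI; exact: measurable_funP.
have HQ j t : Q [set w | t <= xi j w] = (H j t)%:E by rewrite fineK// fin_num_measure.
have HE j t : 0 < t -> H j t = a j t * expR (- (L j t * t `^ r j)).
  by move=> t0; apply: EFin_inj; rewrite -HQ htail.
have H_anti j s t : s <= t -> H j t <= H j s.
  move=> st; rewrite -lee_fin -!HQ; apply: le_measure; rewrite ?inE//.
  by move=> w /=; exact: le_trans.
have H0 j t : 0 <= H j t by rewrite -lee_fin -HQ.
have H1 j t : H j t <= 1 by rewrite -lee_fin -HQ probability_le1.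
have reg j : regular (fun t => L j t * t `^ r j) (r j).
  exact: (tail_exponent_regular (HE j) (H0 j) (H1 j) (ha j) (hL j) (hLmono j)).
have bounds j := tail_bounds (HE j) (H_anti j) (H0 j) (H1 j) (ha j) (hL j) (hLmono j) (hr j).
have r01 := min_exponent01 hr.
have reg_g := min_tail_regular reg.
have lnrho0 : 0 < ln rho by exact: ln_gt0.
have upper (y : R) : 0 < y -> ln rho < y `^ min_exponent r ->
    {ae P ord0, forall w, \forall n \near \oo, ~ hit N X n (y * psi n) w}.
  apply: (eventually_not_hit indep ldis r01 reg_g hpsi_pos hpsi_oo hpsi hrho1).
    move=> s rhos; have [C2 C20 hC2] := mxpow_growth hrho (ltW (lt_trans ltr01 hrho1)) rhos.
    (* For c = 1 the mean is bounded by the row sum of M^n at the root, with d+1 entries of size at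
       most C2 s^n. *)
    exists (d.+1%:R * C2) => [|n]; first by rewrite mulr_ge0.
    apply: le_trans (mean_weight_generation indep loff meanM n (fun=> ler01)) _.
    rewrite lee_fin; apply: (@le_trans _ _ (\sum_(j < d.+1) C2 * s ^+ n)).
      by apply: ler_sum => j _; rewrite mulr1.
    by rewrite sumr_const card_ord -[leLHS]mulr_natl mulrA.
  move=> e j e01; have e1 : 0 < e < 1 by lra.
  apply: eventually_R_imp (eventually_R_and (bounds j _ e1) (min_tail_le_eventually hr reg j)).
  move=> t [/andP[_ Ht] gt]; rewrite HQ lee_fin; apply: le_trans Ht _.
  by rewrite ler_expR lerN2 ler_wpM2l//; lra.
have lower (y : R) : 0 < y -> y `^ min_exponent r < ln rho ->
    {ae P ord0, forall w, \forall n \near \oo, hit N X n (y * psi n) w}.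
  apply: (eventually_hit indep ldis r01 reg_g hpsi_pos hpsi_oo hpsi hrho1).
  - by move=> mu j mu1 murho; exact: (population_growth indep loff meanM surv j u0 hu Ml).
  - move=> e e01; apply: eventually_R_imp (eventually_R_forall (fun j => bounds j _ e01)).
    move=> t Ht; have [j _ ->] := min_tail_attained L r t.
    by exists j; rewrite HQ lee_fin; case/andP: (Ht j).
  - exact: lower_tail_le_moment.
have /andP[p0 p1] := r01.
pose y := ln rho `^ (min_exponent r)^-1.
have y0 : 0 < y by exact: powR_gt0.
have yp : y `^ min_exponent r = ln rho.
  by rewrite /y -powRrM mulVf ?gt_eqF// powRr1// ltW.
have up : {ae P ord0, forall w, forall k : nat,
    \forall n \near \oo, ~ hit N X n ((y + k.+1%:R^-1) * psi n) w}.
  apply: ae_foralln => k; have k0 : 0 < k.+1%:R^-1 :> R by [].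
  apply: upper; first by rewrite addr_gt0.
  by rewrite -[ltLHS]yp; apply: gt0_ltr_powR => //; rewrite ?nnegrE ?addr_ge0 ?ltW// ltrDl.
have low : {ae P ord0, forall w, forall k : nat, k.+1%:R^-1 < y ->
    \forall n \near \oo, hit N X n ((y - k.+1%:R^-1) * psi n) w}.
  apply: ae_foralln => k; have k0 : 0 < k.+1%:R^-1 :> R by [].
  have [ky|ky] := ltP k.+1%:R^-1 y; last by apply: nearW.
  have y1 : 0 < y - k.+1%:R^-1 by rewrite subr_gt0.
  apply: filterS (lower _ y1 _) => //.
  by rewrite -[ltRHS]yp; apply: gt0_ltr_powR => //; rewrite ?nnegrE ?ltW// gtrDl oppr_lt0.
by apply: filterS2 up low => w hu' hl; exact: cvg_max_position.
Qed.
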